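(* Let $(X_\infty,\omega_\infty)$ be the surface with 1-form described in the context. Then $X_\infty$ is a Riemann surface of infinite genus with exactly one (topological) end, and $\omega_\infty$ is an abelian differential (holomorphic 1-form) of finite area on $X_\infty$ without zeroes on $X_\infty$. Moreover $\mathrm{Aff}(X_\infty,\omega_\infty)$ includes an orientation-reversing isometric involution $\rho_\infty$ without fixed points on $X_\infty$ and a pseudo-Anosov homeomorphism $\psi_\infty$ with expansion constant $2$, and these two elements commute.
   Context: A translation surface is a pair $(X,\omega)$ with $X$ a Riemann surface (not assumed compact) and $\omega\neq 0$ a holomorphic 1-form on $X$; it carries the flat metric $|\omega|^2$, whose total area is the area of $\omega$. A homeomorphism $\phi:X\to X$ is affine if it is (real-)affine in the canonical charts of $\omega$ (charts in which $\omega=\mathrm{d}z$); orientation-reversing maps are allowed. $\mathrm{Aff}(X,\omega)$ is the group of affine homeomorphisms of $X$; each has a globally constant derivative in $\mathrm{GL}_2(\mathbb{R})$. On a finite-area surface an affine homeomorphism is called pseudo-Anosov if its derivative (which has determinant $\pm1$) has trace of absolute value greater than $2$; its expansion constant is the larger absolute value of an eigenvalue of the derivative. The surface $(X_\infty,\omega_\infty)$: let $D=([0,1]\times[1/2,1])\cup([-1/2,1/2]\times[0,1/2])\subset\mathbb{R}^2=\mathbb{C}$. For $n\ge 1$ put $s_n=\sum_{0\le j<n/2}2^{-(n-2j)}$ (so $s_1=\frac12$, $s_2=\frac14$, $s_3=\frac58$, $s_4=\frac5{16}$, ...). Identify the following open edges of $D$ in pairs by translations: (i) $(x,1/2)\sim(x+1,1/2)$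 for $-1/2<x<0$; (ii) for each $n\ge1$: $(x,1)\sim(x-\frac12+2^{-n-1},0)$ for $1-2^{1-n}<x<1-3\cdot2^{-n-1}$ (edge $C'_n$), and $(x,1)\sim(x-\frac12-2^{-n-1},0)$ for $1-3\cdot2^{-n-1}<x<1-2^{-n}$ (edge $C''_n$); (iii) for each $n\ge1$: $(1,y)\sim(e,y-s_n)$ for $1-2^{-n}<y<1-2^{-n-1}$ (edge $A_n$), where $e=-\frac12$ if $n$ is odd and $e=0$ if $n$ is even; (iv) for each $n\ge1$: $(\frac12,y)\sim(e',y+s_n)$ for $2^{-n-1}<y<2^{-n}$ (edge $B_n$), where $e'=0$ if $n$ is odd and $e'=-\frac12$ if $n$ is even. All boundary points of $D$ not lying on one of these open edges are removed. The quotient is $X_\infty$, and $\omega_\infty$ is the 1-form induced by $\mathrm{d}z$. *)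

(* Defs.v *)
From Stdlib Require Import Relation_Operators.
From HB Require Import structures.
From mathcomp Require Import all_boot all_order all_algebra.
From mathcomp Require Import generic_quotient complex.
From mathcomp Require Import all_classical all_reals all_analysis.
From mathcomp Require Import ring lra.

Set Implicit Arguments.
Unset Strict Implicit.
Unset Printing Implicit Defensive.

Import Order.TTheory GRing.Theory Num.Theory.
Import numFieldNormedType.Exports.

Local Open Scope classical_set_scope.
Local Open Scope ring_scope.
Local Open Scope complex_scope.
Local Open Scope quotient_scope.

(* The complex plane as a normed space over itself: [derivable f z 1] is
   complex differentiability at [z] and [derive1 f z] the complex derivative. *)
HB.instance Definition _ (R : realType) :=
  NormedModule.copy R[i] ((R[i] : numFieldType)^o).

Section Topology.
Variables (R : realType) (X : topologicalType).

Definition homeomorphism (phi : X -> X) : Prop :=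
  continuous phi /\
  exists psi : X -> X, [/\ continuous psi, cancel phi psi & cancel psi phi].

Definition simple_closed_curve (S : set X) : Prop :=
  exists gamma : R -> X,
    [/\ {within `[0, 1], continuous gamma},
        gamma 0 = gamma 1,
        set_inj `[0, 1[ gamma
      & S = gamma @` `[0, 1]].

(* The genus of a connected orientable surface, compact or not, is the maximal
   number of disjoint simple closed curves that together do not separate it. *)
Definition genus_ge (g : nat) : Prop :=
  exists S : 'I_g -> set X,
    [/\ forall i, simple_closed_curve (S i),
        trivIset setT S
      & connected (~` \bigcup_i S i)].

Definition infinite_genus : Prop := forall g, genus_ge g.

(* Freudenthal ends: points of the inverse limit, over the compact sets [K], of
   the sets of components of the complement of [K].  Only the values of [e] on
   compact sets are meaningful. *)
Definition is_end (e : set X -> set X) : Prop :=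
  (forall K, compact K ->
     exists2 x, (~` K) x & e K = connected_component (~` K) x) /\
  (forall K L, compact K -> compact L -> K `<=` L -> e L `<=` e K).

Definition exactly_one_end : Prop :=
  (exists e, is_end e) /\
  (forall e1 e2, is_end e1 -> is_end e2 ->
     forall K, compact K -> e1 K = e2 K).

End Topology.

Section RiemannSurfaces.
Variables (R : realType) (X : ptopologicalType).
Local Notation C := R[i].

Record chart := Chart {
  chart_dom : set X;
  chart_map : X -> C;
  chart_inv : C -> X;
  chart_dom_open : open chart_dom;
  chart_codom_open : open (chart_map @` chart_dom);
  chart_mapK : forall x, chart_dom x -> chart_inv (chart_map x) = x;
  chart_map_continuous : {within chart_dom, continuous chart_map};
  chart_inv_continuous : {within chart_map @` chart_dom, continuous chart_inv} }.

Implicit Types (c : chart) (A : set chart) (w : chart -> C -> C).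

Definition overlap c1 c2 : set C :=
  chart_map c1 @` (chart_dom c1 `&` chart_dom c2).
Definition transition c1 c2 : C -> C := chart_map c2 \o chart_inv c1.

Definition holomorphic_on (U : set C) (f : C -> C) : Prop :=
  forall z, U z -> derivable f z 1.

Definition complex_atlas A : Prop :=
  (forall x, exists2 c, A c & chart_dom c x) /\
  (forall c1 c2, A c1 -> A c2 ->
     holomorphic_on (overlap c1 c2) (transition c1 c2)).

Definition riemann_surface A : Prop :=
  [/\ hausdorff_space X, @second_countable X, connected [set: X]
    & complex_atlas A].

(* A 1-form is given by its coefficients: it is [w c z dz] in the chart [c]. *)
Definition holomorphic_form A w : Prop :=
  (forall c, A c -> holomorphic_on (chart_map c @` chart_dom c) (w c)) /\
  (forall c1 c2, A c1 -> A c2 -> forall z, overlap c1 c2 z ->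
     w c1 z = w c2 (transition c1 c2 z) * derive1 (transition c1 c2) z).

Definition without_zeros A w : Prop :=
  forall c, A c -> forall z, (chart_map c @` chart_dom c) z -> w c z != 0.

(* The area of the flat metric |w|^2, as a Borel measure on X. *)
Definition area_measure A w
    (mu : {measure set (g_sigma_algebraType (@open X)) -> \bar R}) : Prop :=
  forall c, A c -> forall B : set (g_sigma_algebraType (@open X)),
    measurable B -> B `<=` chart_dom c ->
    mu B = (\int[(@lebesgue_measure R \x @lebesgue_measure R)%E]_(p in
              [set p : R * R | (chart_map c @` B) (p.1 +i* p.2)])
              (Normc.normc (w c (p.1 +i* p.2)) ^+ 2)%:E)%E.

Definition finite_area A w : Prop :=
  exists2 mu, area_measure A w mu & (mu setT < +oo)%E.

(* The charts, compatible with the atlas, in which the form is dz. *)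
Definition canonical_chart A w c : Prop :=
  forall c', A c' ->
    [/\ holomorphic_on (overlap c c') (transition c c'),
        holomorphic_on (overlap c' c) (transition c' c)
      & forall z, overlap c' c z -> w c' z = derive1 (transition c' c) z].

Definition vec (z : C) : 'cV[R]_2 :=
  \col_(k < 2) (if k == 0 then complex.Re z else complex.Im z).

Definition affine_at A w (phi : X -> X) (M : 'M[R]_2) (x : X) : Prop :=
  forall c c', canonical_chart A w c -> canonical_chart A w c' ->
    chart_dom c x -> chart_dom c' (phi x) ->
    \forall y \near x,
      vec (chart_map c' (phi y) - chart_map c' (phi x))
      = M *m vec (chart_map c y - chart_map c x).

Definition Aff A w : set (X -> X) :=
  [set phi | homeomorphism phi /\
     forall x, exists2 M, M \in unitmx & affine_at A w phi M x].

Definition has_derivative A w (phi : X -> X) (M : 'M[R]_2) : Prop :=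
  forall x, affine_at A w phi M x.

Definition orientation_reversing A w (phi : X -> X) : Prop :=
  exists2 M, has_derivative A w phi M & \det M < 0.

(* In canonical charts |w|^2 is the Euclidean metric, whose pullback by [phi]
   has matrix [M^T *m M]. *)
Definition isometric A w (phi : X -> X) : Prop :=
  exists2 M, has_derivative A w phi M & M^T *m M = 1%:M.

Definition pseudo_Anosov A w (phi : X -> X) : Prop :=
  Aff A w phi /\
  exists2 M, has_derivative A w phi M & 2 < `|\tr M|.

Definition expansion_constant A w (phi : X -> X) (lambda : R) : Prop :=
  exists M, [/\ has_derivative A w phi M,
    exists2 a, eigenvalue M a & `|a| = lambda
  & forall a, eigenvalue M a -> `|a| <= lambda].

End RiemannSurfaces.

Section SurfaceInfinity.
Variable R : realType.
Local Notation C := R[i].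

Definition polygon : set C := [set z |
  (0 <= complex.Re z <= 1 /\ 1 / 2 <= complex.Im z <= 1) \/
  (- (1 / 2) <= complex.Re z <= 1 / 2 /\ 0 <= complex.Im z <= 1 / 2)].

Definition s_ (n : nat) : R :=
  \sum_(0 <= j < n | (2 * j < n)%N) 2 ^- (n - 2 * j).

Definition edge_A_left (n : nat) : R := if odd n then - (1 / 2) else 0.
Definition edge_B_left (n : nat) : R := if odd n then 0 else - (1 / 2).

Inductive edge_glue : C -> C -> Prop :=
| edge_glue_slit (x : R) : - (1 / 2) < x < 0 ->
    edge_glue (x +i* (1 / 2)) ((x + 1) +i* (1 / 2))
| edge_glue_C' n (x : R) : (1 <= n)%N ->
    1 - 2 ^- (n - 1) < x < 1 - 3 * 2 ^- (n + 1) ->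
    edge_glue (x +i* 1) ((x - 1 / 2 + 2 ^- (n + 1)) +i* 0)
| edge_glue_C'' n (x : R) : (1 <= n)%N ->
    1 - 3 * 2 ^- (n + 1) < x < 1 - 2 ^- n ->
    edge_glue (x +i* 1) ((x - 1 / 2 - 2 ^- (n + 1)) +i* 0)
| edge_glue_A n (y : R) : (1 <= n)%N ->
    1 - 2 ^- n < y < 1 - 2 ^- (n + 1) ->
    edge_glue (1 +i* y) (edge_A_left n +i* (y - s_ n))
| edge_glue_B n (y : R) : (1 <= n)%N ->
    2 ^- (n + 1) < y < 2 ^- n ->
    edge_glue ((1 / 2) +i* y) (edge_B_left n +i* (y + s_ n)).

Definition on_open_edge (z : C) : Prop :=
  exists w, edge_glue z w \/ edge_glue w z.

Definition punctured_polygon : set C :=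
  [set z | polygon z /\ (polygon° z \/ on_open_edge z)].

Lemma slit_point_punctured_polygon :
  punctured_polygon (- (1 / 4) +i* (1 / 2)).
Proof.
split; first by right=> /=; split; lra.
right; exists ((- (1 / 4) + 1) +i* (1 / 2)); left.
by apply: edge_glue_slit; lra.
Qed.

HB.instance Definition _ :=
  isPointed.Build (set_type punctured_polygon)
    (SigSub (mem_set slit_point_punctured_polygon)).

Definition glued : rel (set_type punctured_polygon) := fun p q =>
  `[< clos_refl_sym_trans _ (fun p q => edge_glue (\val p) (\val q)) p q >].

Lemma glued_refl : reflexive glued.
Proof. by move=> p; apply/asboolP; exact: rst_refl. Qed.

Lemma glued_sym : symmetric glued.
Proof. by move=> p q; apply/asboolP/asboolP; exact: rst_sym. Qed.

Lemma glued_trans : transitive glued.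
Proof.
move=> q p r /asboolP pq /asboolP qr; apply/asboolP.
exact: rst_trans pq qr.
Qed.

Definition glued_equiv := EquivRel _ glued_refl glued_sym glued_trans.

Definition Xinf := {eq_quot glued_equiv}.

HB.instance Definition _ := Topological.copy Xinf (quotient_topology Xinf).
HB.instance Definition _ := Quotient.on Xinf.
HB.instance Definition _ :=
  isPointed.Build Xinf (\pi_Xinf (point : set_type punctured_polygon)).

(* The charts in which the form induced by dz is dz: those that, read in the
   polygon, are locally translations, on both sides of each glued edge. *)
Definition Ainf : set (chart R Xinf) := [set c |
  forall p : set_type punctured_polygon, chart_dom c (\pi_Xinf p) ->
  \forall q \near p,
    chart_map c (\pi_Xinf q) - chart_map c (\pi_Xinf p) = \val q - \val p].

(* The form with coefficient 1 in the charts of [Ainf]; its value on other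
   charts is irrelevant. *)
Definition omega_inf : chart R Xinf -> C -> C := fun _ _ => 1.

End SurfaceInfinity.

(* Main.v *)
(* Around each open edge of the polygon D, and on the three open rectangles that
   cover its interior, put a box of the plane.  The part of the box of an edge
   that lies outside D is moved into D by the gluing translation, so that every
   box maps homeomorphically onto an open set of X_oo, on which the charts are
   translations.  Separation, area and affinity are then read off from the boxes.

   The involution rho is (x, y) |-> (x -+ 1/2, 1 - y), and exchanges the two
   rectangles of D.  The map psi contracts horizontally and expands vertically by
   2, then cuts the image and translates the pieces back into D; this is
   compatible with the gluings because it shifts the index of the edges by 1.

   For the genus, the edges A_n with n even are glued to the left side of the
   upper rectangle; the segments that cross this rectangle between the midpoints
   of two glued edges are disjoint simple closed curves, and each strip between
   two of them is joined to the lower rectangle through an edge A_n with n odd.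

   For the end, small neighbourhoods of the removed points form a basis of the
   complements of compact sets.  They are connected: the gluing of an edge joins
   the neighbourhoods of its endpoints to those of the endpoints of its image,
   which links the removed points in chains that accumulate at (1, 1), (1/2, 0),
   (-1/2, 1/3) and (0, 2/3). *)

Require Import Defs.
From Stdlib Require Import Relation_Operators.
From HB Require Import structures.
From mathcomp Require Import all_boot all_order all_algebra.
From mathcomp Require Import generic_quotient complex.
From mathcomp Require Import all_classical all_reals all_analysis.
From mathcomp Require Import measurable_realfun.
From mathcomp Require Import ring lra.

Set Implicit Arguments.
Unset Strict Implicit.
Unset Printing Implicit Defensive.

Import Order.TTheory GRing.Theory Num.Theory.
Import numFieldNormedType.Exports.

Local Open Scope classical_set_scope.
Local Open Scope ring_scope.
Local Open Scope complex_scope.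
Local Open Scope quotient_scope.

Local Notation Re := complex.Re.
Local Notation Im := complex.Im.

(** * Squares and rectangles of the plane *)

Section Squares.
Variable R : realType.
Local Notation C := R[i].

(** The gluing is a partial matching: sources lie on upper or right sides, targets on lower or left
    sides, so no point is both and a class has at most two points. This makes the quotient explicit,
    and a box together with its translate contains all representatives of its points.

    [Ainf] contains every chart that is locally a translation, and affinity is tested in all
    canonical charts, which are only known to be holomorphic with derivative 1 against [Ainf]. The
    latter become translations of box coordinates because a function with zero complex derivative is
    locally constant.

    A measure has to be constructed for the area: it is Lebesgue measure on a fundamental domain,
    pushed to the surface and compared with each chart after a countable cutting.

    The numerical facts are mostly linear once [u n] is an unknown in ]0, 1], at most 1/2 for odd
    [n], two distinct values having ratio at least 2, and at least 4 for equal parity.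

    The removed points form four chains. They share starting points two by two, and the two
    resulting families are joined through the accumulation point (1, 1). *)

Definition square (r : R) (p : C) : set C :=
  [set q | `|Re q - Re p| < r /\ `|Im q - Im p| < r].

Lemma square_center r p : 0 < r -> square r p p.
Proof. by move=> r0; split; rewrite subrr normr0. Qed.

Lemma squareP r p q : square r p q <->
  (Re p - r < Re q < Re p + r) /\ (Im p - r < Im q < Im p + r).
Proof.
rewrite /square /=; split=> -[].
  by rewrite !ltr_norml => /andP[? ?] /andP[? ?]; split; lra.
by move=> /andP[? ?] /andP[? ?]; split; rewrite ltr_norml; lra.
Qed.

Lemma subset_square r s p : r <= s -> square r p `<=` square s p.
Proof. by move=> rs q [? ?]; split; exact: lt_le_trans rs. Qed.

(** The norm of the plane takes values in [R[i]], so balls have complex radii, whose positivity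
    forces a zero imaginary part. Squares have real radii and turn neighbourhoods into linear
    inequalities. *)
Lemma nbhs_squareP (p : C) (A : set C) :
  nbhs p A <-> exists2 r : R, 0 < r & square r p `<=` A.
Proof.
split=> [/nbhs_ballP[[a b] /= e0 eA]|[r r0 rA]].
  move: e0; rewrite ltcE /= => /andP[/eqP b0 a0].
  (* Half the radius is enough, since twice its square is less than [a ^+ 2]. *)
  exists (a / 2) => [|q [qre qim]]; first by rewrite divr_gt0.
  apply: eA; rewrite /ball /= ltcE /= b0 eqxx /=.
  have q1 : (Re p - Re q) ^+ 2 < (a / 2) ^+ 2.
    by rewrite -[X in X < _]real_normK ?num_real// distrC ltrXn2r// divr_ge0 ?ltW.
  have q2 : (Im p - Im q) ^+ 2 < (a / 2) ^+ 2.
    by rewrite -[X in X < _]real_normK ?num_real// distrC ltrXn2r// divr_ge0 ?ltW.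
  case: (p) q1 q2 => pr pi; case: (q) => qr qi /= q1 q2.
  rewrite -(@ltr_pXn2r _ 2)// ?nnegrE ?sqrtr_ge0 ?(ltW a0)//.
  rewrite sqr_sqrtr ?addr_ge0 ?sqr_ge0//.
  have : 0 < a ^+ 2 by rewrite exprn_gt0.
  rewrite exprMn in q1 q2; lra.
apply/nbhs_ballP; exists (r%:C) => /=; first by rewrite ltcE /= eqxx.
move=> q; rewrite /ball /= ltcE /= => /andP[_].
case: (p) rA => pr pi rA; case: (q) => qr qi /= pq; apply: rA.
have h (x y : R) : `|x| <= Num.sqrt (x ^+ 2 + y ^+ 2).
  rewrite -sqrtr_sqr ler_sqrt ?addr_ge0 ?sqr_ge0//.
  by rewrite lerDl sqr_ge0.
split=> /=; rewrite distrC.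
  by apply: le_lt_trans pq; exact: h.
by apply: le_lt_trans pq; rewrite [X in Num.sqrt X]addrC; exact: h.
Qed.

Lemma near_square (p : C) r : 0 < r -> \forall q \near p, square r p q.
Proof. by move=> r0; apply/nbhs_squareP; exists r. Qed.

Lemma square_open r p : open (square r p : set C).
Proof.
rewrite openE => q /squareP[/andP[? ?] /andP[? ?]].
apply/nbhs_squareP.
pose s := Num.min (Num.min (Re q - (Re p - r)) (Re p + r - Re q))
                  (Num.min (Im q - (Im p - r)) (Im p + r - Im q)).
exists s; first by rewrite !lt_min; lra.
move=> w /squareP[/andP[w1 w2] /andP[w3 w4]]; apply/squareP.
have : s <= s by [].
rewrite {2}/s !le_min => /andP[/andP[? ?] /andP[? ?]].
by split; lra.
Qed.

Definition rect (a b c d : R) : set C :=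
  [set z | (a < Re z < b) /\ (c < Im z < d)].

Lemma rect_open a b c d : open (rect a b c d : set C).
Proof.
rewrite openE => q [/andP[? ?] /andP[? ?]].
apply/nbhs_squareP.
pose s := Num.min (Num.min (Re q - a) (b - Re q))
                  (Num.min (Im q - c) (d - Im q)).
exists s; first by rewrite !lt_min; lra.
move=> w /squareP[/andP[w1 w2] /andP[w3 w4]].
have : s <= s by [].
rewrite {2}/s !le_min => /andP[/andP[? ?] /andP[? ?]].
by split; lra.
Qed.

Definition crect (a b c d : R) : set C :=
  [set z | (a <= Re z <= b) /\ (c <= Im z <= d)].

Lemma crect_closed a b c d : closed (crect a b c d).
Proof.
rewrite -[X in closed X]setCK; apply: open_closedC; rewrite openE => z nz.
apply/nbhs_squareP.
have h r : 0 < r -> Re z + r <= a \/ b <= Re z - r \/ Im z + r <= c \/ d <= Im z - r ->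
    square r z `<=` ~` crect a b c d.
  by move=> r0 rz w /squareP[? ?] [? ?]; lra.
case: (ltrP (Re z) a) => z1; first by exists (a - Re z); [lra|apply: h; lra].
case: (ltrP b (Re z)) => z2; first by exists (Re z - b); [lra|apply: h; lra].
case: (ltrP (Im z) c) => z3; first by exists (c - Im z); [lra|apply: h; lra].
case: (ltrP d (Im z)) => z4; first by exists (Im z - d); [lra|apply: h; lra].
by case: nz; split; apply/andP; split.
Qed.

Lemma ReD (p q : C) : Re (p + q) = Re p + Re q. Proof. by case: p; case: q. Qed.
Lemma ImD (p q : C) : Im (p + q) = Im p + Im q. Proof. by case: p; case: q. Qed.
Lemma ReB (p q : C) : Re (p - q) = Re p - Re q. Proof. by case: p; case: q. Qed.
Lemma ImB (p q : C) : Im (p - q) = Im p - Im q. Proof. by case: p; case: q. Qed.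

Lemma square_shift r (p q t : C) :
  square r (p + t) (q + t) <-> square r p q.
Proof.
case: p => ? ?; case: q => ? ?; case: t => ? ?.
by split=> /squareP[/= /andP[? ?] /andP[? ?]]; apply/squareP => /=;
  split; lra.
Qed.

Lemma near_shiftC (p t : C) (A : set C) :
  (\forall q \near (p + t), A q) <-> (\forall q \near p, A (q + t)).
Proof.
split=> /nbhs_squareP[r r0 rA]; apply/nbhs_squareP; exists r => // q.
  by move=> pq; apply: rA; apply/square_shift.
by rewrite -{1}(subrK t q) => /square_shift/rA; rewrite subrK.
Qed.

End Squares.

(** * Boxes and gluings *)

Section Combinatorics.
Variable R : realType.
Local Notation C := R[i].
Local Notation D := (@polygon R).

Definition u (n : nat) : R := 2 ^- n.

Lemma u_gt0 n : 0 < u n. Proof. by rewrite invr_gt0 exprn_gt0. Qed.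

Lemma uS n : u n.+1 = u n / 2.
Proof. by rewrite /u exprSr invfM mulrC. Qed.

Lemma u0 : u 0 = 1. Proof. by rewrite /u expr0 invr1. Qed.

Lemma u_le1 n : u n <= 1.
Proof.
by elim: n => [|n ih]; rewrite ?u0// uS; have := u_gt0 n; lra.
Qed.

(** For odd [n] the targets of the side edges reach the heights 2/3 - [u n] / 3 and 1/3 + [u n] / 3,
    which stay on the correct side of 1/2 only if [u n] is at most 1/2. *)
Lemma u_parity n : u n <= if odd n then 1 / 2 else 1.
Proof. by case: n => [|n]; rewrite ?u0//; have := u_le1 n; case: ifP; rewrite uS; lra. Qed.

Lemma u_half m n : (m < n)%N -> u n <= u m / 2.
Proof.
elim: n => // n ih; rewrite ltnS leq_eqVlt => /predU1P[->|/ih]; rewrite uS//.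
by have := u_gt0 n; lra.
Qed.

Lemma u_cmp m n : m = n \/ u m <= u n / 2 \/ u n <= u m / 2.
Proof.
case: (ltngtP m n) => [mn|nm|->]; [right; right|right; left|by left];
  exact: u_half.
Qed.

(** On a left side, the targets on one side of the accumulation point have indices of one parity and
    extend from distance [u n] / 12 to distance [u n] / 3 of it. Separating them takes the ratio
    4. *)
Lemma u_cmp_parity m n : odd m = odd n ->
  m = n \/ u m <= u n / 4 \/ u n <= u m / 4.
Proof.
have h a b : odd a = odd b -> (a < b)%N -> u b <= u a / 4.
  move=> ab; rewrite leq_eqVlt => /predU1P[e|].
    by move: ab; rewrite -e /=; case: (odd a).
  by move=> /u_half; rewrite uS; lra.
move=> e; case: (ltngtP m n) => [mn|nm|->]; [right; right|right; left|by left].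
  exact: h.
exact: h.
Qed.

Lemma u_small (e : R) : 0 < e -> exists n, u n < e.
Proof. by move=> e0; eexists; exact: (@realalg.RealAlg.upper_nthrootVP _ e). Qed.

(** Closed form of [s_ R n.+1]: within one parity of the index, [s_] is the partial sum of a
    geometric series of ratio 1/4, with limit 2/3 or 1/3. *)
Definition gap (n : nat) : R := (if odd n then 1 / 3 else 2 / 3) - u n / 6.

Lemma s_S n : s_ R n.+1 = gap n.
Proof.
have s2 m : s_ R m.+2 = s_ R m + u m.+2.
  rewrite /s_ big_ltn_cond// muln0 ltnS leq0n subn0 addrC; congr (_ + _).
  rewrite big_add1 /= [LHS]big_mkcond big_nat_recr//= mulnS !ltnS.
  rewrite ltnNge leq_pmull// addr0 [RHS]big_mkcond.
  by apply: eq_bigr => i _; rewrite mulnS.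
have s0 : s_ R 0 = 0 by rewrite /s_ big_geq.
have s1 : s_ R 1 = 1 / 2.
  by rewrite /s_ big_mkcond big_nat1/= muln0 subn0 expr1 div1r.
(* The recurrence [s2] has step 2, so two consecutive indices are carried together. *)
suff: s_ R n.+1 = gap n /\ s_ R n.+2 = gap n.+1 by case.
elim: n => [|n [ih1 ih2]].
  by rewrite s2 s0 s1 /gap /= !uS u0; split; lra.
split=> //; rewrite s2 ih1 /gap /= negbK !uS; case: (odd n); lra.
Qed.

Inductive kind := Low | Up | Mid | Slit | TopL | TopR | SideA | SideB.

(* The boxes [Low], [Up], [Mid] cover the interior of the polygon; the others
   are centred on the edges.  A box indexed by [n] is that of an edge of index
   [n.+1] in the paper. *)
Definition box (k : kind) (n : nat) : set C :=
  match k with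
  | Low => rect (- (1 / 2)) (1 / 2) 0 (1 / 2)
  | Up => rect 0 1 (1 / 2) 1
  | Mid => rect 0 (1 / 2) 0 1
  | Slit => rect (- (1 / 2)) 0 0 1
  | TopL => rect (1 - u n) (1 - 3 / 4 * u n) (1 / 2) (3 / 2)
  | TopR => rect (1 - 3 / 4 * u n) (1 - u n / 2) (1 / 2) (3 / 2)
  | SideA => rect (1 / 2) (3 / 2) (1 - u n / 2) (1 - u n / 4)
  | SideB => rect 0 1 (u n / 4) (u n / 2)
  end.

(* A translation by [2] moves every box off the polygon. *)
Definition trans (k : kind) (n : nat) : C :=
  match k with
  | Low | Up | Mid => 2 +i* 0
  | Slit => 1 +i* 0
  | TopL => (- (1 / 2) + u n / 4) +i* (- 1)
  | TopR => (- (1 / 2) - u n / 4) +i* (- 1)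
  | SideA => (if odd n then - 1 else - (3 / 2)) +i* (- gap n)
  | SideB => (if odd n then - 1 else - (1 / 2)) +i* gap n
  end.

Definition source (k : kind) (n : nat) (z : C) : Prop :=
  match k with
  | Low | Up | Mid => False
  | Slit => - (1 / 2) < Re z < 0 /\ Im z = 1 / 2
  | TopL => 1 - u n < Re z < 1 - 3 / 4 * u n /\ Im z = 1
  | TopR => 1 - 3 / 4 * u n < Re z < 1 - u n / 2 /\ Im z = 1
  | SideA => Re z = 1 /\ 1 - u n / 2 < Im z < 1 - u n / 4
  | SideB => Re z = 1 / 2 /\ u n / 4 < Im z < u n / 2
  end.

Definition Din : set C := box Low 0 `|` box Up 0 `|` box Mid 0.

Lemma glueP (z w : C) :
  edge_glue z w <-> exists k n, source k n z /\ w = z + trans k n.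
Proof.
split.
  case=> [x xx|n x|n x|n y|n y].
  - by exists Slit, 0; split => //; apply/eqP; rewrite eq_complex /= ?addr0 !eqxx.
  - case: n => // n _; rewrite subn1 addn1 /= -/(u _) -/(u _) !uS => xx.
    exists TopL, n; split => /=; first by split=> //; lra.
    by apply/eqP; rewrite eq_complex /=; apply/andP; split; apply/eqP; lra.
  - case: n => // n _; rewrite addn1 /= -/(u _) -/(u _) !uS => xx.
    exists TopR, n; split => /=; first by split=> //; lra.
    by apply/eqP; rewrite eq_complex /=; apply/andP; split; apply/eqP; lra.
  - case: n => // n _; rewrite addn1 /= -/(u _) -/(u _) s_S !uS => xx.
    exists SideA, n; split => /=; first by split=> //; lra.
    apply/eqP; rewrite eq_complex /= /edge_A_left /=.
    by apply/andP; split; apply/eqP; case: (odd n) => /=; lra.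
  - case: n => // n _; rewrite addn1 /= -/(u _) -/(u _) s_S !uS => xx.
    exists SideB, n; split => /=; first by split=> //; lra.
    apply/eqP; rewrite eq_complex /= /edge_B_left /=.
    by apply/andP; split; apply/eqP; case: (odd n) => /=; lra.
have e (a b c d : R) : a = c -> b = d -> a +i* b = c +i* d by move=> -> ->.
case: z => x y [[] [n [/= + ->]]] //=.
- move=> [xx ->]; rewrite [X in edge_glue _ X](_ : _ = (x + 1) +i* (1 / 2)).
    exact: edge_glue_slit.
  by apply: e; lra.
- move=> [xx ->].
  rewrite [X in edge_glue _ X](_ : _ =
    (x - 1 / 2 + 2 ^- (n.+1 + 1)) +i* 0).
    apply: edge_glue_C' => //; rewrite subn1 addn1 /= -/(u _) -/(u _) !uS.
    by lra.
  by rewrite addn1 -/(u _) !uS; apply: e; lra.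
- move=> [xx ->].
  rewrite [X in edge_glue _ X](_ : _ =
    (x - 1 / 2 - 2 ^- (n.+1 + 1)) +i* 0).
    apply: edge_glue_C'' => //; rewrite addn1 /= -/(u _) -/(u _) !uS.
    by lra.
  by rewrite addn1 -/(u _) !uS; apply: e; lra.
- move=> [-> yy].
  rewrite [X in edge_glue _ X](_ : _ = edge_A_left R n.+1 +i* (y - s_ R n.+1)).
    apply: edge_glue_A => //; rewrite addn1 -/(u _) -/(u _) !uS.
    by lra.
  by rewrite s_S /edge_A_left /=; apply: e => //; case: (odd n) => /=; lra.
- move=> [-> yy].
  rewrite [X in edge_glue _ X](_ : _ = edge_B_left R n.+1 +i* (y + s_ R n.+1)).
    apply: edge_glue_B => //; rewrite addn1 -/(u _) -/(u _) !uS.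
    by lra.
  by rewrite s_S /edge_B_left /=; apply: e => //; case: (odd n) => /=; lra.
Qed.

Lemma Din_polygon : Din `<=` D.
Proof.
by case=> x y; rewrite /Din /polygon /box /rect /setU /mkset /=; lra.
Qed.

Lemma Din_open : open Din.
Proof. by do !apply: openU; exact: rect_open. Qed.

(** It is enough to test the four corners of a small square around the point: if all of them are in
    the union of the two closed rectangles, linear arithmetic puts the centre in one of the three
    open ones, even near the reentrant corners. *)
Lemma interior_polygon : D° = Din.
Proof.
apply/seteqP; split=> z; last first.
  move=> Dz; exact: filterS Din_polygon (open_nbhs_nbhs (conj Din_open Dz)).
move=> /nbhs_squareP[r r0 rD].
pose e := r / 2.
have e0 : 0 < e by rewrite /e; lra.
have near (a b : R) : a = e \/ a = - e -> b = e \/ b = - e ->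
    D ((Re z + a) +i* (Im z + b)).
  by case=> -> [] ->; apply: rD; apply/squareP; rewrite /e /=; lra.
have npp := near e e (or_introl erefl) (or_introl erefl).
have npn := near e (- e) (or_introl erefl) (or_intror erefl).
have nnp := near (- e) e (or_intror erefl) (or_introl erefl).
have nnn := near (- e) (- e) (or_intror erefl) (or_intror erefl).
by move: npp npn nnp nnn; rewrite /Din /polygon /box /rect /setU /mkset /=; lra.
Qed.

Lemma polygon_closed : closed D.
Proof.
rewrite (_ : D = crect 0 1 (1 / 2) 1 `|` crect (- (1 / 2)) (1 / 2) 0 (1 / 2))//.
by apply: closedU; exact: crect_closed.
Qed.

Local Notation Y := (@punctured_polygon R).

Lemma box_open k n : open (box k n).
Proof. by case: k; exact: rect_open. Qed.

Lemma source_box k n z : source k n z -> box k n z.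
Proof.
case: z => x y; have := u_gt0 n; have := u_le1 n.
by case: k => //; rewrite /box /rect /mkset /=; lra.
Qed.

(* The lines that carry the sources of the gluings, and those that carry their
   targets. *)
Definition upper_right (z : C) : Prop :=
  (Re z < 0 /\ Im z = 1 / 2) \/ Im z = 1 \/ Re z = 1 \/ (Re z = 1 / 2 /\ Im z < 1 / 2).

Definition lower_left (z : C) : Prop :=
  (1 / 2 < Re z /\ Im z = 1 / 2) \/ Im z = 0 \/ Re z = - (1 / 2) \/ (Re z = 0 /\ 1 / 2 < Im z).

Lemma source_upper_right k n z : source k n z -> upper_right z.
Proof.
case: z => x y; have := u_le1 n.
by case: k => //; rewrite /upper_right /=; lra.
Qed.

Lemma target_lower_left k n z : source k n z -> lower_left (z + trans k n).
Proof.
case: z => x y; have := u_gt0 n; have := u_parity n.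
by case: k => //; rewrite /lower_left /= /gap; case: (odd n); lra.
Qed.

(** With the two lemmas that follow, this makes a box blind to every gluing but its own: a source
    inside it lies on its edge, no target lies inside it, and no source lies in its translate. *)
Lemma box_upper_right k n z : box k n z -> upper_right z -> source k n z.
Proof.
case: z => x y; have := u_gt0 n; have := u_le1 n.
by case: k; rewrite /upper_right /box /rect /mkset /=; lra.
Qed.

Lemma box_lower_left k n z : box k n z -> ~ lower_left z.
Proof.
case: z => x y; have := u_gt0 n; have := u_le1 n.
by case: k; rewrite /lower_left /box /rect /mkset /=; lra.
Qed.

Lemma box_trans_upper_right k n z : box k n z -> ~ upper_right (z + trans k n).
Proof.
case: z => x y; have := u_gt0 n; have := u_parity n.
by case: k; rewrite /upper_right /box /rect /mkset /= /gap; case: (odd n); lra.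
Qed.
(** The conclusion is about translations and not indices because [Slit] denotes the same edge for
    every [n]. *)
Lemma source_inj z k n k' n' : source k n z -> source k' n' z ->
  trans k n = trans k' n'.
Proof.
case: z => x y; have := u_gt0 n; have := u_gt0 n'; have := u_le1 n; have := u_le1 n'.
move=> ? ? ? ?; case: k => //=; case: k' => //= ? ?;
  by [exfalso; lra|case: (u_cmp n n') => [e|?]; [subst n'|]; by [|exfalso; lra]].
Qed.

(** Different kinds can land on the same side: [TopL] and [TopR] on the bottom, [SideA] and [SideB]
    on a left side, where they stay respectively below and above the accumulation point. *)
Lemma target_inj z w k n k' n' : source k n z -> source k' n' w ->
  z + trans k n = w + trans k' n' -> w = z.
Proof.
case: z => x y; case: w => x' y' kz kw e.
suff [-> ->] : x' = x /\ y' = y by [].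
move: (congr1 (@complex.Re R) e) (congr1 (@complex.Im R) e) kz kw => {e}.
have := u_gt0 n; have := u_gt0 n'.
case: k => //; case: k' => //; rewrite /= /gap.
(* Fixes the parity of each index together with its bound. Then kinds and parities that cannot meet
   are separated by [lra], and the others by comparing the two powers of 1/2. *)
all: repeat match goal with |- context [odd ?m] =>
  let e := fresh in have := u_parity m; case e : (odd m) end.
all: by [lra|move=> *; case: (u_cmp n n') => [e|]; [subst n'|]; lra
  |match goal with a : odd ?m = ?c, b : odd ?m' = ?c |- _ =>
  move=> *; case: (u_cmp_parity (etrans a (esym b))) => [e|]; [subst m|]; lra end].
Qed.

Lemma box_cover k n z : box k n z -> D z \/ D (z + trans k n).
Proof.
case: z => x y; have := u_gt0 n; have := u_parity n.
by case: k; rewrite /polygon /box /rect /mkset /= /gap; case: (odd n); lra.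
Qed.

Lemma box_in k n z : box k n z -> D z -> Din z \/ source k n z.
Proof.
case: z => x y; have := u_gt0 n; have := u_le1 n.
by case: k; rewrite /Din /polygon /box /rect /setU /mkset /=; lra.
Qed.

Lemma box_trans_in k n z : box k n z -> D (z + trans k n) ->
  Din (z + trans k n) \/ source k n z.
Proof.
case: z => x y; have := u_gt0 n; have := u_parity n.
by case: k; rewrite /Din /polygon /box /rect /setU /mkset /= /gap; case: (odd n); lra.
Qed.

Lemma box_both k n z : box k n z -> D z -> D (z + trans k n) -> source k n z.
Proof.
case: z => x y; have := u_gt0 n; have := u_parity n.
by case: k; rewrite /polygon /box /rect /mkset /= /gap; case: (odd n); lra.
Qed.

Lemma box_source z k n k' n' : box k n z -> source k' n' z ->
  source k n z /\ trans k n = trans k' n'.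
Proof.
move=> kz kz'; have kz2 := box_upper_right kz (source_upper_right kz').
by split=> //; exact: source_inj kz2 kz'.
Qed.

Lemma box_target z w k n k' n' : box k n z -> source k' n' w -> z <> w + trans k' n'.
Proof. by move=> /box_lower_left nz /target_lower_left wt e; apply: nz; rewrite e. Qed.

Lemma box_trans_source z k n k' n' : box k n z -> ~ source k' n' (z + trans k n).
Proof. by move=> /box_trans_upper_right nz /source_upper_right. Qed.

Lemma box_trans_disj k n z z' : box k n z -> box k n z' -> z <> z' + trans k n.
Proof.
case: z => x y; case: z' => x' y'; have := u_gt0 n; have := u_parity n.
case: k; rewrite /= /gap => + ? [/=? ?] [/= ? ?]; case: (odd n) => ? [? ?]; lra.
Qed.

Lemma glue_polygon z w : edge_glue z w -> D z /\ D w.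
Proof.
move=> /glueP[k [n [kz ->]]].
have := u_gt0 n; have := u_parity n; case: z kz => x y.
by case: k; rewrite //= /polygon /= /gap; case: (odd n); lra.
Qed.

(** A target is never in the interior of D, so the translate of [z] can only be one if [z] is on the
    source edge of its own box; [target_inj] then applies. *)
Lemma box_trans_target z w k n k' n' : box k n z -> source k' n' w ->
  z + trans k n = w + trans k' n' -> w = z.
Proof.
move=> kz kw e.
have [_ Dw] : D w /\ D (w + trans k' n').
  by apply: glue_polygon; apply/glueP; exists k', n'.
have nll := target_lower_left kw; rewrite -e in Dw nll.
case: (box_trans_in kz Dw) => [di|kz2]; last exact: target_inj kz2 kw e.
by case: di => [[|]|] /box_lower_left /(_ nll).
Qed.

Lemma puncturedP z : Y z <-> Din z \/ exists k n,
  source k n z \/ exists2 w, source k n w & z = w + trans k n.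
Proof.
rewrite /punctured_polygon /= interior_polygon; split.
  move=> [_ [|[w [|]]]]; [by left| |] => /glueP[k [n [kz e]]]; right; exists k, n.
    by left.
  by right; exists w.
move=> [zi|[k [n [kz|[w kw ->]]]]]; first by split; [exact: Din_polygon|left].
  have g : edge_glue z (z + trans k n) by apply/glueP; exists k, n.
  by split; [have [] := glue_polygon g|right; eexists; left; exact: g].
have g : edge_glue w (w + trans k n) by apply/glueP; exists k, n.
by split; [have [] := glue_polygon g|right; eexists; right; exact: g].
Qed.

End Combinatorics.

(** * The quotient *)

Section Projection.
Variable R : realType.
Local Notation C := R[i].
Local Notation D := (@polygon R).
Local Notation Y := (@punctured_polygon R).
Local Notation X := (Xinf R).

Definition lift (z : C) : set_type Y := insubd (point : set_type Y) z.

Definition toX (z : C) : X := \pi_X (lift z).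

Lemma toX_val (p : set_type Y) : toX (\val p) = \pi_X p.
Proof. by rewrite /toX /lift valKd. Qed.

Lemma liftY z : Y z -> \val (lift z) = z.
Proof. by move=> Yz; rewrite /lift insubdK//; exact: mem_set. Qed.

Lemma valY (p : set_type Y) : Y (\val p).
Proof. exact: set_valP. Qed.

Lemma toX_surj x : exists2 z, Y z & toX z = x.
Proof.
exists (\val (repr x)); first exact: valY.
by rewrite toX_val reprK.
Qed.

Lemma glueY (z w : C) : edge_glue z w -> Y z /\ Y w.
Proof.
move=> g; have [Dz Dw] := glue_polygon g; rewrite /punctured_polygon /=.
by split; split=> //; right; [exists w; left|exists z; right].
Qed.

Definition related (p q : C) := [\/ p = q, edge_glue p q | edge_glue q p].

Lemma glue_target_source (z w w' : C) : edge_glue z w -> ~ edge_glue w w'.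
Proof.
move=> /glueP[k [n [kz ->]]] /glueP[k' [n' [kw _]]].
exact: box_trans_source (source_box kz) kw.
Qed.

Lemma glue_fun (z w w' : C) : edge_glue z w -> edge_glue z w' -> w = w'.
Proof.
move=> /glueP[k [n [kz ->]]] /glueP[k' [n' [kw ->]]].
by rewrite (source_inj kz kw).
Qed.

Lemma glue_inj (z z' w : C) : edge_glue z w -> edge_glue z' w -> z = z'.
Proof.
move=> /glueP[k [n [kz ->]]] /glueP[k' [n' [kw e]]].
exact/esym/(box_trans_target (source_box kz) kw e).
Qed.

(** Two gluing steps never reach a third point: a target is not a source, and the matching is
    injective both ways. Hence one step already gives the whole equivalence closure. *)
Lemma related_trans q p r : related p q -> related q r -> related p r.
Proof.
case=> [->//|pq|qp]; case=> [<-|qr|rq].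
- exact: Or32.
- by have := glue_target_source pq qr.
- by rewrite (glue_inj pq rq); exact: Or31.
- exact: Or33.
- by rewrite (glue_fun qp qr); exact: Or31.
- by have := glue_target_source rq qp.
Qed.

Lemma related_sym p q : related p q -> related q p.
Proof. by case=> [->|?|?]; [exact: Or31|exact: Or33|exact: Or32]. Qed.

Lemma toX_eqP p q : Y p -> Y q -> (toX p = toX q <-> related p q).
Proof.
move=> Yp Yq; split.
  move=> /eqmodP/asboolP h.
  rewrite -(liftY Yp) -(liftY Yq).
  elim: h => [x y g|x|x y _ ih|x y z _ ih1 _ ih2].
  - exact: Or32.
  - exact: Or31.
  - exact: related_sym.
  - exact: related_trans ih2.
case=> [->//|g|g]; apply/eqmodP/asboolP.
  by apply: rst_step; rewrite !liftY.
by apply: rst_sym; apply: rst_step; rewrite !liftY.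
Qed.

Lemma near_val (p : set_type Y) (A : C -> Prop) :
  (\forall q \near p, A (\val q)) <-> (\forall z \near (\val p : C), Y z -> A z).
Proof.
split.
  case=> _ /= [] [W oW <- /= Wp sWU].
  have : nbhs (\val p : C) W by apply: open_nbhs_nbhs.
  apply: filterS => z Wz Yz.
  have e : set_val (lift z) = z := liftY Yz.
  have : A (set_val (lift z)) by apply: sWU; rewrite /= e.
  by rewrite e.
move=> h; have : nbhs p (\val @^-1` [set z | Y z -> A z]).
  exact: (@initial_continuous (set_type Y) C set_val p).
by apply: filterS => q /= /(_ (valY q)).
Qed.

Lemma open_toXP (O : set X) :
  open O <-> forall z, Y z -> O (toX z) -> \forall w \near z, Y w -> O (toX w).
Proof.
have -> : open O = open ((\pi_X : set_type Y -> X) @^-1` O) by [].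
split=> [oO z Yz Oz|h].
  have := near_val (lift z) (fun w => O (toX w)).
  rewrite liftY// => <-.
  move: oO; rewrite openE => /(_ (lift z) Oz).
  by apply: filterS => q /=; rewrite toX_val.
rewrite openE => p Op; have := near_val p (fun w => O (toX w)).
move=> [_ /(_ (h _ (valY p) _))]; rewrite toX_val => /(_ Op).
by apply: filterS => q /=; rewrite toX_val.
Qed.

Lemma AinfP (c : chart R X) : Ainf c <->
  forall z, Y z -> chart_dom c (toX z) -> \forall w \near z, Y w ->
    chart_map c (toX w) - chart_map c (toX z) = w - z.
Proof.
split=> [h z Yz cz|h p cp].
  have := near_val (lift z) 
    (fun w => chart_map c (toX w) - chart_map c (toX z) = w - z).
  rewrite liftY// => <-.
  have := h (lift z) cz; apply: filterS => q /=.
  by rewrite toX_val liftY.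
have := near_val p (fun w => chart_map c (toX w) - chart_map c (toX (\val p)) = w - \val p).
move=> [_ /(_ (h _ (valY p) _))]; rewrite toX_val => /(_ cp).
by apply: filterS => q /=; rewrite toX_val.
Qed.

End Projection.

(** * Boxes as local coordinates of the quotient *)

Section BoxMaps.
Variable R : realType.
Local Notation C := R[i].
Local Notation D := (@polygon R).
Local Notation Y := (@punctured_polygon R).
Local Notation X := (Xinf R).

Local Notation box := (@box R).
Local Notation trans := (@trans R).

(** The test on [D] does not break the symmetry between the two sides of an edge: where both
    readings are available, the point is on the source edge and the two representatives are glued
    ([bmapr]). *)
Definition bmap (k : kind) (n : nat) (z : C) : X :=
  if `[< D z >] then toX z else toX (z + trans k n).

Lemma Din_Y (z : C) : Din z -> Y z.
Proof. by move=> zi; apply/puncturedP; left. Qed.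

Lemma source_Y k n (z : C) : source k n z -> Y z /\ Y (z + trans k n).
Proof. by move=> kz; apply: glueY; apply/glueP; exists k, n. Qed.

Lemma box_Y k n z : box k n z -> D z -> Y z.
Proof. by move=> kz /(box_in kz) [/Din_Y|/source_Y[]]. Qed.

Lemma box_trans_Y k n z : box k n z -> D (z + trans k n) -> Y (z + trans k n).
Proof. by move=> kz /(box_trans_in kz) [/Din_Y|/source_Y[]]. Qed.

Lemma Y_D (z : C) : Y z -> D z. Proof. by case. Qed.

Lemma bmapl k n z : D z -> bmap k n z = toX z.
Proof. by move=> Dz; rewrite /bmap; case: asboolP. Qed.

Lemma bmapr k n z : box k n z -> D (z + trans k n) ->
  bmap k n z = toX (z + trans k n).
Proof.
move=> kz Dzt; rewrite /bmap; case: asboolP => // Dz.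
have s := box_both kz Dz Dzt; have [Yz Yzt] := source_Y s.
by apply/(toX_eqP Yz Yzt); apply: Or32; apply/glueP; exists k, n.
Qed.

Lemma bmap_rep k n z : box k n z ->
  (Y z /\ bmap k n z = toX z) \/
  (Y (z + trans k n) /\ bmap k n z = toX (z + trans k n)).
Proof.
move=> kz; case: (box_cover kz) => h; [left|right].
  by split; [exact: box_Y kz h|exact: bmapl].
by split; [exact: box_trans_Y kz h|exact: bmapr].
Qed.

(** From either representative, a gluing step in the possible direction leads to the other one, by
    [box_source] or [box_trans_target]; the opposite directions are excluded because box points are
    not targets and translated ones are not sources. *)
Lemma toX_bmap k n z p : box k n z -> Y p -> toX p = bmap k n z ->
  p = z \/ p = z + trans k n.
Proof.
move=> kz Yp; case: (bmap_rep kz) => -[Yr ->] /(toX_eqP Yp Yr) [-> | |]; try by [left|right].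
- by move=> /glueP[k' [n' [kp e]]]; have := box_target kz kp e.
- move=> /glueP[k' [n' [kp ->]]]; right.
  by have [_ ->] := box_source kz kp.
- move=> /glueP[k' [n' [kp e]]]; left.
  exact: box_trans_target kz kp e.
- by move=> /glueP[k' [n' [kp e]]]; have := box_trans_source kz kp.
Qed.

Lemma bmap_inj k n : {in box k n &, injective (bmap k n)}.
Proof.
move=> z z' /set_mem kz /set_mem kz' e.
have [p Yp pz] := toX_surj (bmap k n z).
have := toX_bmap kz Yp pz; rewrite e in pz; have := toX_bmap kz' Yp pz.
case=> pz'; case=> pz''.
- by rewrite -pz' -pz''.
- by have := @box_trans_disj _ k n z' z kz' kz; case; rewrite -pz' -pz''.
- by have := @box_trans_disj _ k n z z' kz kz'; case; rewrite -pz' -pz''.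
- by apply: (@addIr _ (trans k n)); rewrite -pz' -pz''.
Qed.

Lemma bmap_surj x : exists k n, exists2 z, box k n z & bmap k n z = x.
Proof.
have [p Yp <-] := toX_surj x.
have /puncturedP := Yp; case=> [pi|[k [n [kp|[w kw pw]]]]].
- have [k kp] : exists k, box k 0 p by case: pi => [[]|] ?; [exists Low|exists Up|exists Mid].
  by exists k, 0%N, p => //; rewrite bmapl//; exact: Y_D.
- by exists k, n, p; [exact: source_box|rewrite bmapl//; exact: Y_D].
- exists k, n, w; first exact: source_box.
  by rewrite pw bmapr//; [exact: source_box|have [_ /Y_D] := source_Y kw].
Qed.

(** Transfers local statements from D to boxes. At an edge the neighbourhood is assembled from two
    half neighbourhoods in D, one for each representative. *)
Lemma near_box k n z (A : C -> X -> Prop) : box k n z ->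
  (Y z -> \forall w \near z, Y w -> A w (toX w)) ->
  (Y (z + trans k n) ->
    \forall w \near (z + trans k n), Y w -> A (w - trans k n) (toX w)) ->
  \forall w \near z, A w (bmap k n w).
Proof.
move=> kz h1 h2.
(* A candidate representative outside the closed set D has a neighbourhood outside D, and so imposes
   nothing. *)
have near_D (t : C) (B : C -> Prop) :
    (D t -> \forall w \near t, D w -> B w) -> \forall w \near t, D w -> B w.
  have [Dt|nDt] := pselect (D t); first by apply.
  move=> _; have : \forall w \near t, (~` D) w.
    by apply: open_nbhs_nbhs; split=> //; apply: closed_openC; exact: polygon_closed.
  by apply: filterS => w.
have kw : \forall w \near z, box k n w.
  by apply: open_nbhs_nbhs; split=> //; exact: box_open.
have k1 : \forall w \near z, D w -> box k n w -> A w (toX w).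
  apply: near_D => Dz; have := h1 (box_Y kz Dz).
  by apply: filterS => w h Dw kw'; apply: h; exact: box_Y kw' Dw.
have k2 : \forall w \near z, D (w + trans k n) -> box k n w -> A w (toX (w + trans k n)).
  have : \forall w \near (z + trans k n), D w -> box k n (w - trans k n) ->
      A (w - trans k n) (toX w).
    apply: near_D => Dz; have := h2 (box_trans_Y kz Dz).
    apply: filterS => w h Dw kw'; apply: h.
    by have := box_trans_Y kw'; rewrite subrK; apply.
  by move=> /near_shiftC; apply: filterS => w; rewrite addrK.
apply: filterS3 kw k1 k2 => w bw k1 k2.
case: (box_cover bw) => Dw; first by rewrite bmapl//; exact: k1.
by rewrite bmapr//; exact: k2.
Qed.

Lemma bmap_preimage k n (W : set C) p : W `<=` box k n -> Y p ->
  (bmap k n @` W) (toX p) <-> W p \/ W (p - trans k n).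
Proof.
move=> sW Yp; split.
  move=> [z Wz e]; case: (toX_bmap (sW _ Wz) Yp (esym e)) => ->; first by left.
  by right; rewrite addrK.
case=> Wp; [exists p|exists (p - trans k n)] => //.
  by rewrite bmapl//; exact: Y_D.
by rewrite bmapr ?subrK//; [exact: sW|exact: Y_D].
Qed.

Lemma bmap_open k n (W : set C) : W `<=` box k n -> open W ->
  open (bmap k n @` W).
Proof.
move=> sW oW; apply/open_toXP => z Yz /(bmap_preimage sW Yz) Wz.
have {Wz} : \forall w \near z, W w \/ W (w - trans k n).
  case: Wz => Wz.
    have : nbhs z W by apply: open_nbhs_nbhs.
    by apply: filterS => w ?; left.
  have : nbhs (z - trans k n) W by apply: open_nbhs_nbhs.
  by move=> /near_shiftC; apply: filterS => w ?; right.
by apply: filterS => w Ww Yw; apply/(bmap_preimage sW Yw).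
Qed.

Lemma near_bmap k n z (A : set X) : box k n z ->
  nbhs (bmap k n z) A <-> \forall w \near z, A (bmap k n w).
Proof.
move=> kz; split.
  rewrite nbhsE => -[U [oU Uz] UA].
  suff : \forall w \near z, U (bmap k n w) by apply: filterS => w /UA.
  apply: (near_box (A := fun _ => U) kz) => Yz.
    by move/open_toXP: oU; apply=> //; rewrite -(bmapl k n)//; exact: Y_D.
  by move/open_toXP: oU; apply=> //; rewrite -bmapr//; exact: Y_D.
move=> h; have : nbhs z (fun w => A (bmap k n w)) := h.
rewrite {1}nbhsE => -[W [oW Wz] WA]; rewrite nbhsE; exists (bmap k n @` (W `&` box k n)).
  split; last by exists z.
  apply: bmap_open; first by move=> w [].
  by apply: openI => //; exact: box_open.
by move=> _ [w [/WA Aw _] <-].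
Qed.

End BoxMaps.

(** * The Riemann surface *)

Section Surface.
Variable R : realType.
Local Notation C := R[i].
Local Notation D := (@polygon R).
Local Notation Y := (@punctured_polygon R).
Local Notation X := (Xinf R).
Local Notation box := (@box R).
Local Notation trans := (@trans R).

(** Equal centres are allowed outside D, where a small square contains no point of D. This is needed
    because [z] or its translate may be outside D and then represents nothing. *)
Lemma separate_squares (a b : C) : (a = b -> ~ D a) ->
  exists2 r, 0 < r & forall p, D p -> square r a p -> ~ square r b p.
Proof.
move=> ab; have [e|/eqP/negbTE] := pselect (a = b).
  have : nbhs a (~` D).
    by apply: open_nbhs_nbhs; split; [exact/closed_openC/polygon_closed|exact: ab].
  by move=> /nbhs_squareP[r r0 rD]; exists r => // p Dp /rD.
rewrite eq_complex => /negbT; rewrite negb_and => /orP[] n.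
  exists (`|Re a - Re b| / 2); first by rewrite divr_gt0// normr_gt0 subr_eq0.
  move=> p _ [h1 _] [h2 _]; have := ler_distD (Re p) (Re a) (Re b).
  by rewrite (distrC (Re a) (Re p)); lra.
exists (`|Im a - Im b| / 2); first by rewrite divr_gt0// normr_gt0 subr_eq0.
move=> p _ [_ h1] [_ h2]; have := ler_distD (Im p) (Im a) (Im b).
by rewrite (distrC (Im a) (Im p)); lra.
Qed.

Lemma Xinf_hausdorff : hausdorff_space X.
Proof.
move=> x y; have [k [n [z kz <-]]] := bmap_surj x.
have [k' [n' [w kw <-]]] := bmap_surj y => cl.
apply: contrapT => xy.
(* Each of the two points has two candidate representatives, hence four pairs of squares to
   separate. *)
have [r1 r10 s1] : exists2 r, 0 < r & forall p, D p -> square r z p -> ~ square r w p.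
  by apply: separate_squares => e Dz; apply: xy; rewrite !bmapl// -e.
have [r2 r20 s2] : exists2 r, 0 < r & forall p, D p -> square r (z + trans k n) p -> ~ square r w p.
  by apply: separate_squares => e Dz; apply: xy; rewrite bmapr// bmapl -?e.
have [r3 r30 s3] : exists2 r, 0 < r & forall p, D p -> square r z p -> ~ square r (w + trans k' n') p.
  by apply: separate_squares => e Dz; apply: xy; rewrite bmapl// bmapr -?e.
have [r4 r40 s4] : exists2 r, 0 < r & forall p, D p -> square r (z + trans k n) p -> ~ square r (w + trans k' n') p.
  by apply: separate_squares => e Dz; apply: xy; rewrite bmapr// bmapr -?e.
pose r := Num.min (Num.min r1 r2) (Num.min r3 r4).
have r0 : 0 < r by rewrite !lt_min r10 r20 r30 r40.
have [l1 l2 l3 l4] : [/\ r <= r1, r <= r2, r <= r3 & r <= r4].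
  by rewrite /r !ge_min !lexx ?orbT.
have nb k0 n0 z0 : box k0 n0 z0 -> nbhs (bmap k0 n0 z0) (bmap k0 n0 @` (square r z0 `&` box k0 n0)).
  move=> kz0; apply: open_nbhs_nbhs; split.
    apply: bmap_open; first by move=> ? [].
    by apply: openI; [exact: square_open|exact: box_open].
  by exists z0 => //; split => //; exact: square_center.
have [v [[z1 [rz1 kz1] <-] [w1 [rw1 kw1]]]] := cl _ _ (nb _ _ _ kz) (nb _ _ _ kw).
have [p Yp pz] := toX_surj (bmap k n z1); rewrite -pz => /esym pw.
have Dp := Y_D Yp.
have sqs (a b c : C) : square r a b -> square r (a + c) (b + c) by move=> ?; apply/square_shift.
case: (toX_bmap kz1 Yp pz) => e1; case: (toX_bmap kw1 Yp pw) => e2.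
- by apply: (s1 p Dp); [apply: subset_square l1 _ _; rewrite e1|
     apply: subset_square l1 _ _; rewrite e2].
- by apply: (s3 p Dp); [apply: subset_square l3 _ _; rewrite e1|
     apply: subset_square l3 _ _; rewrite e2; exact: sqs].
- by apply: (s2 p Dp); [apply: subset_square l2 _ _; rewrite e1; exact: sqs|
     apply: subset_square l2 _ _; rewrite e2].
- by apply: (s4 p Dp); [apply: subset_square l4 _ _; rewrite e1; exact: sqs|
     apply: subset_square l4 _ _; rewrite e2; exact: sqs].
Qed.

Definition kind_of (n : nat) : kind :=
  nth Low [:: Low; Up; Mid; Slit; TopL; TopR; SideA; SideB] n.

Lemma kind_ofK k : exists i, kind_of i = k.
Proof.
by case: k; [exists 0|exists 1|exists 2|exists 3|exists 4|exists 5|exists 6|exists 7].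
Qed.

Lemma rat_square (z : C) r : 0 < r -> exists a b m,
  square (u R m) (ratr a +i* ratr b) z /\
  square (u R m) (ratr a +i* ratr b) `<=` square r z.
Proof.
move=> r0; have [m mr] : exists m, u R m < r / 2 by apply: u_small; lra.
have um := u_gt0 R m.
have [a] : exists a, ratr a \in `](Re z - u R m), (Re z + u R m)[%R.
  by apply: rat_in_itvoo; lra.
rewrite in_itv /= => /andP[a1 a2].
have [b] : exists b, ratr b \in `](Im z - u R m), (Im z + u R m)[%R.
  by apply: rat_in_itvoo; lra.
rewrite in_itv /= => /andP[b1 b2].
exists a, b, m; split=> [|w /squareP /= [? ?]]; apply/squareP; rewrite /=; lra.
Qed.

(** The index type is countable: kinds are numbered, centres rational and radii powers of 1/2. The
    cells give the countable base and later cut Borel sets for the area. *)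
Definition cell (i : nat * nat * (rat * rat) * nat) : set C :=
  let: (k, n, (a, b), m) := i in
  square (u R m) (ratr a +i* ratr b) `&` box (kind_of k) n.

Definition cell_map (i : nat * nat * (rat * rat) * nat) : C -> X :=
  let: (k, n, _, _) := i in bmap (kind_of k) n.

Lemma cell_open i : open (cell i).
Proof.
by case: i => [[[k n] [a b]] m]; apply: openI; [exact: square_open|exact: box_open].
Qed.

Lemma cell_exists k n z (W : set C) : box k n z -> nbhs z W ->
  exists i, [/\ cell i z, cell i `<=` W & cell_map i = bmap k n].
Proof.
move=> kz /nbhs_squareP[r r0 rW]; have [a [b [m [mz mr]]]] := rat_square z r0.
have [j ej] := kind_ofK k; subst k.
by exists (j, n, (a, b), m); split => // w [/mr/rW].
Qed.

Lemma Xinf_second_countable : @second_countable X.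
Proof.
exists (range (fun i => cell_map i @` cell i)).
  exact: sub_countable (card_image_le _ _) (countableP _).
split.
  move=> _ [i _ <-]; have := cell_open (i := i).
  by case: i => [[[k n] [a b]] m] /= ci; apply: bmap_open => // z [].
move=> x V; have [k [n [z kz <-]]] := bmap_surj x.
move=> /(near_bmap _ kz) /(cell_exists kz)[i [iz iV fi]].
exists (cell_map i @` cell i).
  split; first by exists i.
  by exists z => //; rewrite fi.
by move=> _ [w /iV h <-]; rewrite fi.
Qed.

Definition unbox k n (x : X) : C := xget 0 [set z | box k n z /\ bmap k n z = x].

Lemma bmapK k n z : box k n z -> unbox k n (bmap k n z) = z.
Proof.
move=> kz; rewrite /unbox.
case: xgetP => [w _ [kw e]|/(_ z)/not_andP[]//].
by apply: (bmap_inj (k := k) (n := n)) => //; exact/mem_set.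
Qed.

Lemma unbox_image k n : unbox k n @` (bmap k n @` box k n) = box k n.
Proof.
apply/seteqP; split=> [_ [_ [z kz <-] <-]|z kz]; first by rewrite bmapK.
by exists (bmap k n z); [exists z|rewrite bmapK].
Qed.

Lemma box_chart_key k n : [/\ open (bmap k n @` box k n),
  open (unbox k n @` (bmap k n @` box k n)),
  forall x, (bmap k n @` box k n) x -> bmap k n (unbox k n x) = x,
  {within bmap k n @` box k n, continuous (unbox k n)} &
  {within unbox k n @` (bmap k n @` box k n), continuous (bmap k n)}].
Proof.
have ob : open (bmap k n @` box k n) by apply: bmap_open => //; exact: box_open.
split=> //.
- by rewrite unbox_image; exact: box_open.
- by move=> _ [z kz <-]; rewrite bmapK.
- rewrite continuous_open_subspace// => _ /set_mem [z kz <-] W.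
  rewrite bmapK// => Wz; apply/near_bmap => //.
  have : nbhs z (box k n) by apply: open_nbhs_nbhs; split=> //; exact: box_open.
  move: Wz; apply: filterS2 => w Ww kw; change (W (unbox k n (bmap k n w))).
  by rewrite bmapK.
- rewrite unbox_image continuous_open_subspace; last exact: box_open.
  by move=> z /set_mem kz W Wz; apply/near_bmap.
Qed.

Definition box_chart k n : chart R X :=
  let: And5 h1 h2 h3 h4 h5 := box_chart_key k n in Chart h1 h2 h3 h4 h5.

Lemma box_chart_dom k n : chart_dom (box_chart k n) = bmap k n @` box k n.
Proof. by rewrite /box_chart; case: box_chart_key. Qed.
Lemma box_chart_map k n : chart_map (box_chart k n) = unbox k n.
Proof. by rewrite /box_chart; case: box_chart_key. Qed.
Lemma box_chart_inv k n : chart_inv (box_chart k n) = bmap k n.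
Proof. by rewrite /box_chart; case: box_chart_key. Qed.

Lemma box_chart_Ainf k n : Ainf (box_chart k n).
Proof.
apply/AinfP => p Yp; rewrite box_chart_dom box_chart_map.
move=> [z kz /esym e]; rewrite e bmapK//.
have kn : nbhs z (box k n) by apply: open_nbhs_nbhs; split=> //; exact: box_open.
case: (toX_bmap kz Yp e) => ->.
  by move: kn; apply: filterS => w kw Yw; rewrite -(bmapl k n (Y_D Yw)) bmapK.
have : \forall w \near (z + trans k n), box k n (w - trans k n).
  by apply/near_shiftC; move: kn; apply: filterS => w kw; rewrite addrK.
apply: filterS => w kw Yw.
have -> : toX w = bmap k n (w - trans k n) by rewrite bmapr ?subrK//; exact: Y_D.
by rewrite bmapK// opprD addrA addrAC.
Qed.

Lemma Ainf_translation c k n z : Ainf c -> box k n z -> chart_dom c (bmap k n z) ->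
  \forall w \near z, chart_map c (bmap k n w) - chart_map c (bmap k n z) = w - z.
Proof.
move=> /AinfP Ac kz cz.
apply: (near_box (A := fun w x => chart_map c x - chart_map c (bmap k n z) = w - z)) => // Yz.
  by move: cz; rewrite (bmapl k n (Y_D Yz)); exact: Ac.
move: cz; rewrite (bmapr kz (Y_D Yz)) => cz.
have := Ac _ Yz cz; apply: filterS => w h Yw; rewrite h//.
by rewrite opprD addrA addrAC.
Qed.

Lemma chart_near (c : chart R X) x : chart_dom c x -> nbhs x (chart_dom c).
Proof. by move=> cx; apply: open_nbhs_nbhs; split=> //; exact: chart_dom_open. Qed.

Lemma Ainf_inv_translation (c : chart R X) k n z : box k n z -> chart_dom c (bmap k n z) ->
  (\forall w \near z, chart_map c (bmap k n w) - chart_map c (bmap k n z) = w - z) ->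
  \forall w \near (chart_map c (bmap k n z)),
    chart_inv c w = bmap k n (w - chart_map c (bmap k n z) + z).
Proof.
move=> kz cz; set v := chart_map c _ => h.
have : \forall w \near z, chart_inv c (w - z + v) = bmap k n w.
  have : \forall w \near z, chart_dom c (bmap k n w) by apply/near_bmap => //; exact: chart_near.
  by move: h; apply: filterS2 => w <- cw; rewrite subrK chart_mapK.
move=> h2; have : \forall w \near v, chart_inv c (w + (z - v) - z + v) = bmap k n (w + (z - v)).
  by apply/(near_shiftC v (z - v) (fun w => chart_inv c (w - z + v) = bmap k n w)); rewrite addrC subrK.
apply: filterS => w; rewrite !addrA.
rewrite -[w + z - v - z]addrA -opprD [- (v + z)]opprD addrA.
have -> : w + z - v - z + v = w by ring.
by move=> ->; congr bmap; ring.
Qed.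

(** The transition factors locally through a box containing the point, with respect to which both
    charts are translations. *)
Lemma transition_translation (c1 c2 : chart R X) v : Ainf c1 -> Ainf c2 ->
  overlap c1 c2 v ->
  \forall w \near v, transition c1 c2 w = shift (transition c1 c2 v - v) w.
Proof.
move=> A1 A2 [x [c1x c2x] <-].
have [k [n [z kz ex]]] := bmap_surj x; rewrite -ex in c1x c2x *.
have := Ainf_inv_translation kz c1x (Ainf_translation A1 kz c1x).
set v1 := chart_map c1 _.
have := Ainf_translation A2 kz c2x; set v2 := chart_map c2 _ => h2.
have : \forall w \near v1, chart_map c2 (bmap k n (w + (z - v1))) - v2 = w + (z - v1) - z.
  by apply/(near_shiftC v1 (z - v1) (fun w => chart_map c2 (bmap k n w) - v2 = w - z)); rewrite addrC subrK.
rewrite /transition /=.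
apply: filterS2 => w h e; rewrite e /v1 chart_mapK// -/v2 -/v1.
move/eqP: h; rewrite subr_eq addrA => /eqP.
have -> : w - v1 + z = w + z - v1 by ring.
by move=> ->; rewrite /shift; ring.
Qed.

Lemma transition_is_derive (c1 c2 : chart R X) v : Ainf c1 -> Ainf c2 ->
  overlap c1 c2 v -> is_derive v 1 (transition c1 c2) 1.
Proof.
move=> A1 A2 ov; apply: near_eq_is_derive (is_derive_shift _ _ _).
have := transition_translation A1 A2 ov.
by apply: filterS => w ->.
Qed.

Lemma Ainf_atlas : complex_atlas (@Ainf R).
Proof.
split=> [x|c1 c2 A1 A2 z ov].
  have [k [n [z kz ex]]] := bmap_surj x.
  exists (box_chart k n); first exact: box_chart_Ainf.
  by rewrite box_chart_dom -ex; exists z.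
by have [] := transition_is_derive A1 A2 ov.
Qed.

Lemma omega_inf_holomorphic : holomorphic_form (@Ainf R) (@omega_inf R).
Proof.
split=> [c Ac z _|c1 c2 A1 A2 z ov]; first exact: derivable_cst.
by rewrite derive1E /omega_inf mul1r; have [_ ->] := transition_is_derive A1 A2 ov.
Qed.

Lemma omega_inf_without_zeros : without_zeros (@Ainf R) (@omega_inf R).
Proof. by move=> c _ z _; exact: oner_neq0. Qed.

End Surface.

(** * Functions with zero complex derivative *)

Section ZeroDerivative.
Variable R : realType.
Local Notation C := R[i].
Local Notation normc := Normc.normc.

Lemma normr_normc (z : C) : `|z| = (normc z)%:C. Proof. by []. Qed.

Lemma derive0_small (g : C -> C) (w : C) : is_derive w 1 g 0 -> forall e : R, 0 < e ->
  \forall h \near (0 : C), normc (g (h + w) - g w) <= e * normc h.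
Proof.
move=> [dg Dg] e e0.
move: dg Dg; rewrite /derivable /derive => dg Dg; rewrite Dg in dg.
move: dg => /cvgrPdist_le /(_ e%:C).
rewrite ltcE /= eqxx /= => /(_ e0) H.
have {H} : \forall h \near (0 : C), h != 0 ->
  `|0 - h^-1 *: (g (h *: 1 + w) - g w)| <= e%:C := H.
apply: filterS => h; have [->|h0 /(_ isT)] := eqVneq h 0.
  by move=> _; rewrite (add0r w) subrr Normc.normc0 mulr0.
rewrite sub0r normrN normrZ normfV /GRing.scale /= mulr1 mulrC.
rewrite ler_pdivrMr ?normr_gt0// !normr_normc -rmorphM /= lecE /=.
by move=> /andP[_].
Qed.

Lemma Re_le_normc (z : C) : `|Re z| <= normc z.
Proof.
case: z => a b /=; rewrite -sqrtr_sqr ler_sqrt ?addr_ge0 ?sqr_ge0//.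
by rewrite lerDl sqr_ge0.
Qed.

Lemma Im_le_normc (z : C) : `|Im z| <= normc z.
Proof.
case: z => a b /=; rewrite -sqrtr_sqr ler_sqrt ?addr_ge0 ?sqr_ge0//.
by rewrite lerDr sqr_ge0.
Qed.

Lemma normc_ge0 (z : C) : 0 <= normc z.
Proof. exact: le_trans (normr_ge0 _) (Re_le_normc z). Qed.

Lemma normc_scale (s : R) (z : C) : normc (s%:C * z) = `|s| * normc z.
Proof.
by rewrite Normc.normcM /= expr0n /= addr0 sqrtr_sqr.
Qed.

Lemma Re_scale (s : R) (z : C) : Re (s%:C * z) = s * Re z.
Proof. by case: z => a b /=; rewrite mul0r subr0. Qed.

Lemma Im_scale (s : R) (z : C) : Im (s%:C * z) = s * Im z.
Proof. by case: z => a b /=; rewrite mul0r addr0. Qed.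

Lemma near_scale (eta : C) (A : C -> Prop) :
  (\forall h \near (0 : C), A h) -> \forall s \near (0 : R), A (s%:C * eta).
Proof.
move=> /nbhs_squareP[d d0 dA].
pose m := 1 + `|Re eta| + `|Im eta|.
have m0 : 0 < m by rewrite /m -addrA ltr_pwDl.
have : \forall s \near (0 : R), `|s| < d / m.
  apply/nbhs_ballP; exists (d / m) => /=; first by rewrite divr_gt0.
  by move=> s; rewrite /ball /= sub0r normrN.
apply: filterS => s sm; apply: dA; move: sm.
rewrite ltr_pdivlMr// => sm.
have h (x : R) : `|x| <= m -> `|s * x| < d.
  by move=> xm; apply: le_lt_trans sm; rewrite normrM ler_wpM2l.
split; rewrite ?Re_scale ?Im_scale subr0; apply: h; rewrite /m;
  have := normr_ge0 (Re eta); have := normr_ge0 (Im eta); lra.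
Qed.

Lemma small_is_derive (phi : R -> R) s :
  (forall e : R, 0 < e -> \forall h \near (0 : R), `|phi (h + s) - phi s| <= e * `|h|) ->
  is_derive s 1 phi 0.
Proof.
move=> H.
have c : (fun h : R => h^-1 *: (phi (h *: 1 + s) - phi s)) @ 0^' --> (0 : R).
  apply/cvgrPdist_le => e e0; have he := H e e0.
  have : \forall h \near (0 : R), h != 0 -> `|0 - h^-1 *: (phi (h *: 1 + s) - phi s)| <= e.
    move: he; apply: filterS => h he h0.
    rewrite sub0r normrN normrZ normfV /GRing.scale /= mulr1 mulrC.
    by rewrite ler_pdivrMr ?normr_gt0.
  by [].
by split; [apply/cvg_ex; exists 0|exact/cvg_lim].
Qed.

(** The square is convex, so real and imaginary parts can be restricted to the segment from [z] to
    [w]; they have zero derivative there and the real mean value theorem applies. *)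
Lemma derive0_cst (g : C -> C) z r :
  (forall w, square r z w -> is_derive w 1 g 0) ->
  forall w, square r z w -> g w = g z.
Proof.
move=> dg w zw; pose eta := w - z.
have seg (s : R) : 0 <= s <= 1 -> square r z (s%:C * eta + z).
  move=> /andP[s0 s1]; move: zw; rewrite /eta => -[h1 h2].
  have h (x : R) : `|x| < r -> `|s * x| < r.
    move=> xr; apply: le_lt_trans xr; rewrite normrM ger0_norm//.
    by rewrite ler_piMl.
  case: z {dg} @eta h1 h2 => a b; case: w => c d /= h1 h2; split=> /=;
    by rewrite !mul0r ?subr0 ?addr0 addrK; exact: h.
(* [p] is the real or the imaginary part; only additivity and the bound by the modulus matter. *)
have main (p : C -> R) : (forall a b, p (a - b) = p a - p b) ->
    (forall a, `|p a| <= normc a) -> p (g w) = p (g z).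
  move=> pB pn; pose phi (s : R) := p (g (s%:C * eta + z)).
  have dphi (s : R) : 0 <= s <= 1 -> is_derive s 1 phi 0.
    move=> s01; apply: small_is_derive => e e0.
    (* The summand 1 keeps the divisor positive when [w] is equal to [z]. *)
    have n0 : 0 < normc eta + 1 by rewrite ltr_wpDl// normc_ge0.
    have := derive0_small (dg _ (seg s s01)) (e := e / (normc eta + 1)).
    rewrite divr_gt0// => /(_ isT) /(near_scale eta); apply: filterS => h he.
    rewrite /phi -pB; apply: le_trans (pn _) _.
    have -> : (h + s)%:C * eta + z = h%:C * eta + (s%:C * eta + z).
      by rewrite rmorphD /= mulrDl addrA.
    apply: le_trans he _; rewrite normc_scale mulrCA [_ * `|h|]mulrC ler_wpM2l//.
    rewrite -mulrA ler_piMr ?(ltW e0)// mulrC ler_pdivrMr// mul1r.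
    by rewrite lerDl.
  have [||c] := @MVT R phi (fun=> 0) 0 1 ltr01.
  - by move=> s; rewrite in_itv /= => /andP[s0 s1]; apply: dphi; rewrite !ltW.
  - apply: derivable_within_continuous => s; rewrite in_itv /= => s01.
    by have [] := dphi s s01.
  - by move=> _; rewrite mul0r => /eqP; rewrite subr_eq0 /phi => /eqP;
      rewrite rmorph1 rmorph0 mul1r mul0r add0r subrK.
apply/eqP; rewrite eq_complex; apply/andP; split; apply/eqP.
  by apply: (main (@complex.Re R)); [exact: ReB|exact: Re_le_normc].
by apply: (main (@complex.Im R)); [exact: ImB|exact: Im_le_normc].
Qed.

End ZeroDerivative.

(** * Affine maps *)

Section Affine.
Variable R : realType.
Local Notation C := R[i].
Local Notation D := (@polygon R).
Local Notation Y := (@punctured_polygon R).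
Local Notation X := (Xinf R).
Local Notation box := (@box R).
Local Notation trans := (@trans R).

(** Compatibility with the box chart says that the chart, read in the box, has complex derivative 1;
    subtracting the identity leaves a function with zero derivative, constant on a square. *)
Lemma canonical_translation (c : chart R X) k n z :
  canonical_chart (@Ainf R) (@omega_inf R) c ->
  box k n z -> chart_dom c (bmap k n z) ->
  \forall w \near z, chart_map c (bmap k n w) - chart_map c (bmap k n z) = w - z.
Proof.
move=> can kz cz.
have [_ hol der] := can _ (@box_chart_Ainf R k n).
have dc : \forall w \near z, chart_dom c (bmap k n w).
  by apply/near_bmap => //; exact: chart_near.
have kw : \forall w \near z, box k n w.
  by apply: open_nbhs_nbhs; split=> //; exact: box_open.
have /nbhs_squareP[r r0 rd] : \forall w \near z, box k n w /\ chart_dom c (bmap k n w).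
  by move: kw dc; apply: filterS2.
have is1 w : square r z w -> is_derive w 1 (chart_map c \o bmap k n) 1.
  move=> /rd[bw cw].
  have ov : overlap (box_chart R k n) c w.
    exists (bmap k n w); last by rewrite box_chart_map bmapK.
    by split=> //; rewrite box_chart_dom; exists w.
  have := der w ov; have := hol w ov; rewrite derive1E /omega_inf /transition.
  by rewrite box_chart_inv => d1 d2; split.
have sc : square r z z by exact: square_center.
near=> w; have wz : square r z w by near: w; exact: near_square.
have := @derive0_cst R (fun w => (chart_map c \o bmap k n) w - w) z r _ w wz.
rewrite /= => h.
have {h} : chart_map c (bmap k n w) - w = chart_map c (bmap k n z) - z.
  apply: h => v zv; have := is1 v zv => dv.
  have -> : (0 : C) = 1 - 1 by rewrite subrr.
  exact: is_deriveB.
move/eqP; rewrite subr_eq => /eqP ->; ring.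
Unshelve. all: by end_near. Qed.

Definition act (M : 'M[R]_2) (z : C) : C :=
  (M 0 0 * Re z + M 0 1 * Im z) +i* (M 1 0 * Re z + M 1 1 * Im z).

Lemma vec_act M z : vec (act M z) = M *m vec z.
Proof.
apply/matrixP => i j; rewrite !mxE !big_ord_recl big_ord0 addr0 !mxE /=.
rewrite (_ : fintype.lift ord0 ord0 = 1); last exact: val_inj.
by have [->|->] : i = 0 \/ i = 1 by case: i => -[|[|//]] ?; [left|right]; exact: val_inj.
Qed.

Lemma actB M z w : act M (z - w) = act M z - act M w.
Proof.
by case: z w => a b [c d]; apply/eqP; rewrite eq_complex /=; apply/andP; split; apply/eqP; ring.
Qed.

Lemma near_act M z z' (A : C -> Prop) :
  (\forall w \near z', A w) -> \forall w \near z, A (act M (w - z) + z').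
Proof.
move=> /nbhs_squareP[d d0 dA].
pose m := 1 + (`|M 0 0| + `|M 0 1|) + (`|M 1 0| + `|M 1 1|).
have n00 := normr_ge0 (M 0 0); have n01 := normr_ge0 (M 0 1).
have n10 := normr_ge0 (M 1 0); have n11 := normr_ge0 (M 1 1).
have m0 : 0 < m by rewrite /m; lra.
have dm : 0 < d / m by rewrite divr_gt0.
have : \forall w \near z, square (d / m) z w by exact: near_square.
apply: filterS => w [w1 w2]; apply: dA.
have h (a b x y : R) : `|a| + `|b| <= m -> `|x| < d / m -> `|y| < d / m -> `|a * x + b * y| < d.
  move=> ab; rewrite !ltr_pdivlMr// => xd yd.
  have := ler_normD (a * x) (b * y); rewrite !normrM => xy.
  have [a0 b0] : 0 <= `|a| /\ 0 <= `|b| by split.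
  apply: le_lt_trans xy _.
  have [xly|/ltW yx] := lerP `|x| `|y|.
    apply: le_lt_trans yd; rewrite [leRHS]mulrC.
    apply: le_trans (_ : (`|a| + `|b|) * `|y| <= _); last by rewrite ler_wpM2r.
    by rewrite mulrDl lerD2r ler_wpM2l.
  apply: le_lt_trans xd; rewrite [leRHS]mulrC.
  apply: le_trans (_ : (`|a| + `|b|) * `|x| <= _); last by rewrite ler_wpM2r.
  by rewrite mulrDl lerD2l ler_wpM2l.
by split; rewrite ?ReD ?ImD /= addrK -ReB -ImB in w1 w2 *; apply: h; rewrite /m; lra.
Qed.

(** A single pair of boxes is enough, whereas [affine_at] quantifies over all canonical charts:
    these are translations of box coordinates, which leave the linear part unchanged. *)
Definition locally_affine (phi : X -> X) (M : 'M[R]_2) (x : X) : Prop :=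
  exists k n z k' n' z', [/\ box k n z /\ bmap k n z = x,
    box k' n' z' /\ bmap k' n' z' = phi x &
    \forall w \near z, phi (bmap k n w) = bmap k' n' (act M (w - z) + z')].

Lemma locally_affine_at phi M x : locally_affine phi M x ->
  affine_at (@Ainf R) (@omega_inf R) phi M x.
Proof.
move=> [k [n [z [k' [n' [z' [[kz <-] [kz' e] h]]]]]]] c c' can can' cz; rewrite -e => cz'.
apply/near_bmap => //.
have := canonical_translation can kz cz.
have := near_act M z (canonical_translation can' kz' cz').
move: h; apply: filterS3 => w -> h1 h2.
by rewrite h1 h2 addrK vec_act.
Qed.

Lemma locally_affine_continuous phi M : (forall x, locally_affine phi M x) ->
  continuous phi.
Proof.
move=> h x; have [k [n [z [k' [n' [z' [[kz <-] [kz' e] {}h]]]]]]] := h x.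
move=> V; rewrite -e => /(near_bmap _ kz') hV; apply/near_bmap => //.
have := near_act M z hV; move: h; apply: filterS2 => w hw /= hw'.
by change (V (phi (bmap k n w))); rewrite hw.
Qed.

(** The pieces are closed and finitely many, so a piece that contains a point [q] close to [p]
    contains [p] as well. Both are then moved by the same formula, and their images differ by
    [act M (q - p)] whatever the translation [b i]. *)
Lemma piecewise_affine (I : finType) (P : I -> set C) (b : I -> C) M (phi : X -> X) :
  (forall i, closed (P i)) ->
  (forall p, Y p -> exists i, P i p) ->
  (forall i p, Y p -> P i p -> Y (act M p + b i) /\ phi (toX p) = toX (act M p + b i)) ->
  forall x, locally_affine phi M x.
Proof.
move=> cP hP hphi x.
have [k [n [z kz ez]]] := bmap_surj x.
have [k' [n' [z' kz' ez']]] := bmap_surj (phi x).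
exists k, n, z, k', n', z'; split=> //.
have main p : Y p -> toX p = x -> \forall q \near p, Y q ->
    phi (toX q) = bmap k' n' (act M (q - p) + z').
  move=> Yp px.
  have n1 : \forall q \near p, forall i, P i q -> P i p.
    have := @filter_forall C I (fun i q => P i q -> P i p) (nbhs p) _; apply=> i; have [Pp|nPp] := pselect (P i p); first by near=> q.
    have : nbhs p (~` P i) by apply: open_nbhs_nbhs; split=> //; exact: closed_openC.
    by apply: filterS => q /=.
  have n2 : \forall q \near p, box k' n' (act M (q - p) + z').
    by apply: near_act; apply: open_nbhs_nbhs; split=> //; exact: box_open.
  move: n1 n2; apply: filterS2 => q h1 h2 Yq.
  have [i Piq] := hP q Yq; have Pip := h1 i Piq.
  have [Yr er] := hphi i p Yp Pip; have [Ys ->] := hphi i q Yq Piq.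
  have es : act M q + b i = act M (q - p) + (act M p + b i) by rewrite actB; ring.
  rewrite px -ez' in er.
  case: (toX_bmap kz' Yr (esym er)) => r; rewrite es r in Ys *.
    by rewrite bmapl//; exact: Y_D.
  rewrite bmapr//; last by rewrite -addrA; exact: Y_D.
  by rewrite addrA.
apply: (near_box (A := fun w y => phi y = bmap k' n' (act M (w - z) + z'))) => // Yz.
  by apply: main => //; rewrite -ez bmapl//; exact: Y_D.
have := main _ Yz; rewrite -ez bmapr//; last exact: Y_D.
move=> /(_ erefl); apply: filterS => w h Yw; rewrite h//.
by congr (bmap _ _ (act _ _ + _)); ring.
Unshelve. all: by end_near. Qed.

(** Compatibility is only asked inside D and across each edge. Two pieces that overlap at an edge
    point are compared through the glued partner of this point. *)
Lemma piecewise_exists (I : finType) (P : I -> set C) (F : I -> C -> C) :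
  (forall p, Y p -> exists i, P i p) ->
  (forall i p, Din p -> P i p -> Y (F i p)) ->
  (forall i j p, Din p -> P i p -> P j p -> related (F i p) (F j p)) ->
  (forall k n i j p, source k n p -> P i p -> P j (p + trans k n) ->
    [/\ Y (F i p), Y (F j (p + trans k n)) &
        related (F i p) (F j (p + trans k n))]) ->
  exists phi : X -> X, forall i p, Y p -> P i p ->
    Y (F i p) /\ phi (toX p) = toX (F i p).
Proof.
move=> hP hY hD hE.
have YF i p : Y p -> P i p -> Y (F i p).
  move=> /puncturedP[|[k [n [sp|[w sw ->]]]]] Pp; first exact: hY.
    have [_ /hP[j Pj]] := source_Y sp; by have [] := hE _ _ _ _ _ sp Pp Pj.
  have [/hP[j Pj] _] := source_Y sw; by have [] := hE _ _ _ _ _ sw Pj Pp.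
have rel1 i j p : Y p -> P i p -> P j p -> related (F i p) (F j p).
  move=> /puncturedP[|[k [n [sp|[w sw ->]]]]] Pi Pj; first exact: hD.
    have [_ /hP[l Pl]] := source_Y sp.
    have [_ _ r1] := hE _ _ _ _ _ sp Pi Pl; have [_ _ r2] := hE _ _ _ _ _ sp Pj Pl.
    exact: related_trans r1 (related_sym r2).
  have [/hP[l Pl] _] := source_Y sw.
  have [_ _ r1] := hE _ _ _ _ _ sw Pl Pi; have [_ _ r2] := hE _ _ _ _ _ sw Pl Pj.
  exact: related_trans (related_sym r1) r2.
have rel i j p q : Y p -> Y q -> P i p -> P j q -> related p q ->
    related (F i p) (F j q).
  move=> Yp Yq Pi Pj [e|/glueP[k [n [sp e]]]|/glueP[k [n [sp e]]]].
  - by subst q; exact: rel1.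
  - by subst q; have [] := hE _ _ _ _ _ sp Pi Pj.
  - by subst p; apply: related_sym; have [] := hE _ _ _ _ _ sp Pj Pi.
have ex x : exists ip : I * C, [/\ Y ip.2, P ip.1 ip.2 & toX ip.2 = x].
  by have [p Yp px] := toX_surj x; have [i Pi] := hP p Yp; exists (i, p).
(* The map is computed on a chosen representative; [rel] shows that any other choice gives the same
   point. *)
have [f hf] := choice ex.
exists (fun x => toX (F (f x).1 (f x).2)) => i p Yp Pi; split; first exact: YF.
have [Yq Pq e] := hf (toX p).
apply/toX_eqP; [exact: YF|exact: YF|apply: rel => //].
by apply/(toX_eqP Yq Yp).
Qed.

Definition diag2 (a d : R) : 'M[R]_2 :=
  \matrix_(i, j) (if i == j then if i == 0 then a else d else 0).

Lemma act_diag2 a d z : act (diag2 a d) z = (a * Re z) +i* (d * Im z).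
Proof. by rewrite /act !mxE /= !mul0r addr0 add0r. Qed.

Lemma det_diag2 a d : \det (diag2 a d) = a * d.
Proof.
rewrite (expand_det_row _ 0) !big_ord_recl big_ord0 /= !mxE /= mul0r !addr0.
by rewrite /cofactor /= expr0 mul1r det_mx11 !mxE.
Qed.

Lemma tr_diag2 a d : \tr (diag2 a d) = a + d.
Proof. by rewrite /mxtrace !big_ord_recl big_ord0 !mxE /= addr0. Qed.

Lemma diag2_isometry a d : a ^+ 2 = 1 -> d ^+ 2 = 1 ->
  (diag2 a d)^T *m diag2 a d = 1%:M.
Proof.
move=> a1 d1; apply/matrixP => i j; rewrite !mxE !big_ord_recl big_ord0 !mxE /=.
have h (k : 'I_2) : k = 0 \/ k = 1.
  by case: k => -[|[|//]] ?; [left|right]; exact: val_inj.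
by case: (h i) => ->; case: (h j) => -> /=; rewrite ?mul0r ?mulr0 ?addr0 ?add0r -?expr2.
Qed.

Lemma eigenvalue_diag2 a d x : eigenvalue (diag2 a d) x = (x == a) || (x == d).
Proof.
rewrite eigenvalue_root_char /char_poly (expand_det_row _ 0) !big_ord_recl big_ord0 /=.
rewrite /cofactor !det_mx11 /= !mxE /=.
rewrite !mulr1n !mulr0n polyC0 subr0 !mul0r !addr0 expr0 mul1r.
by rewrite rootM !root_XsubC.
Qed.

End Affine.

(** * The involution and the pseudo-Anosov map *)

Section Maps.
Variable R : realType.
Local Notation C := R[i].
Local Notation D := (@polygon R).
Local Notation Y := (@punctured_polygon R).
Local Notation X := (Xinf R).
Local Notation box := (@box R).
Local Notation trans := (@trans R).
Local Notation u := (@u R).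
Local Notation gap := (@gap R).

Lemma cplxE (a b c d : R) : a = c -> b = d -> a +i* b = c +i* d.
Proof. by move=> -> ->. Qed.

Definition joined (p q : C) := [/\ Y p, Y q & related p q].

Lemma joined_glue k n (p q : C) : source k n p -> q = p + trans k n -> joined p q.
Proof.
move=> sp ->; have [Yp Yq] := source_Y sp; split=> //.
by apply: Or32; apply/glueP; exists k, n.
Qed.

Lemma joined_sym p q : joined p q -> joined q p.
Proof. by case=> ? ? ?; split=> //; exact: related_sym. Qed.

Lemma joined_glueV k n (p q : C) : source k n q -> p = q + trans k n -> joined p q.
Proof. by move=> sq e; apply: joined_sym; exact: joined_glue sq e. Qed.

Lemma joined_eq (p q : C) : Y p -> p = q -> joined p q.
Proof. by move=> Yp <-; split=> //; exact: Or31. Qed.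

Lemma source_Yl k n (z : C) : source k n z -> Y z.
Proof. by move=> /source_Y[]. Qed.

Lemma source_Yr k n (z : C) : source k n (z - trans k n) -> Y z.
Proof. by move=> /source_Y[_]; rewrite subrK. Qed.

End Maps.

Ltac Y_in := apply: Din_Y; rewrite /Din /box /rect /setU /mkset /=; lra.

Ltac Y_src k n := apply: (@source_Yl _ k n); rewrite /= ?u0; lra.

Ltac Y_tgt k n := apply: (@source_Yr _ k n); rewrite /= ?/gap ?u0 /=; lra.

Ltac use_parity :=
  repeat match goal with e : odd _ = _ |- _ => rewrite e /=; clear e end.

Ltac glue k n := apply: (@joined_glue _ k n); rewrite /= ?/gap ?uS ?u0 /=;
  [lra|use_parity; apply: cplxE; lra].
Ltac glueV k n := apply: (@joined_glueV _ k n); rewrite /= ?/gap ?uS ?u0 /=;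
  [lra|use_parity; apply: cplxE; lra].
Ltac same := apply: joined_eq; [Y_in|apply: cplxE; lra].

Ltac impossible := try by exfalso; lra.

Section Rho.
Variable R : realType.
Local Notation C := R[i].
Local Notation Y := (@punctured_polygon R).
Local Notation X := (Xinf R).
Local Notation trans := (@trans R).

Definition rho_piece (i : bool) : set C :=
  if i then crect 0 1 (1 / 2) 1 else crect (- (1 / 2)) (1 / 2) 0 (1 / 2).

Definition rho_map (i : bool) (z : C) : C :=
  if i then (Re z - 1 / 2) +i* (1 - Im z) else (Re z + 1 / 2) +i* (1 - Im z).

(** The open segment common to the two rectangles goes to the slit edge, and the slit edge goes to
    this segment. [SideA] and [SideB] are exchanged with the direction of gluing kept, [TopL] and
    [TopR] with the direction reversed. *)
Lemma rho_exists : exists rho : X -> X, forall i p, Y p -> rho_piece i p ->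
  Y (rho_map i p) /\ rho (toX p) = toX (rho_map i p).
Proof.
apply: piecewise_exists.
- move=> p /Y_D [] h; [by exists true|by exists false].
- case=> -[x y]; rewrite /Din /box /rect /setU /rho_piece /crect /mkset /=;
    move=> p1 p2; have [y1|y1] := eqVneq y (1 / 2).
  + by Y_src Slit 0%N.
  + have {}y1 : 1 / 2 < y by lra.
    by Y_in.
  + by Y_tgt Slit 0%N.
  + have {}y1 : y < 1 / 2 by lra.
    by Y_in.
- have main p : Din p -> rho_piece true p -> rho_piece false p ->
     joined (rho_map true p) (rho_map false p).
    case: p => x y; rewrite /Din /box /rect /setU /rho_piece /crect /mkset /= => p1 p2 p3.
    by glue Slit 0%N.
  move=> [] [] p pi Pi Pj; try exact: Or31; first by have [] := main p pi Pi Pj.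
  by have [_ _ /related_sym] := main p pi Pj Pi.
- move=> k n i j [x y].
  have pu := u_gt0 R n; have pl := u_le1 R n; have pn := u_parity R n.
  rewrite /rho_piece /crect /mkset; case: k => //=; rewrite ?/gap => p0;
    case: i => /= p1; impossible.
  + by case: j => /= p2; impossible; same.
  + by case: j => /= p2; impossible; glueV TopR n.
  + by case: j => /= p2; impossible; glueV TopL n.
  + by case on: (odd n) pn => pn; case: j => /= p2; impossible; glue SideB n.
  + by case on: (odd n) pn => pn; case: j => /= p2; impossible; glue SideA n.
Qed.

End Rho.

Section Psi.
Variable R : realType.
Local Notation C := R[i].
Local Notation Y := (@punctured_polygon R).
Local Notation X := (Xinf R).
Local Notation trans := (@trans R).

Definition psi_piece (i : option bool) : set C :=
  match i with
  | None => crect (- (1 / 2)) (1 / 2) 0 (1 / 2)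
  | Some false => crect 0 1 (1 / 2) (3 / 4)
  | Some true => crect 0 1 (3 / 4) 1
  end.

(** The three images tile D again: [None] fills the column over [0, 1/2], [Some false] and
    [Some true] fill what remains on its left and on its right. The pieces [psiV_piece] are these
    images with the same indices. *)
Definition psi_map (i : option bool) (z : C) : C :=
  match i with
  | None => (Re z / 2 + 1 / 4) +i* (2 * Im z)
  | Some false => (Re z / 2 - 1 / 2) +i* (2 * Im z - 1)
  | Some true => (Re z / 2 + 1 / 2) +i* (2 * Im z - 1)
  end.

Lemma psi_cover p : Y p -> exists i, psi_piece i p.
Proof.
case: p => x y /Y_D [] [/= /andP[? ?] /andP[? ?]].
  case: (lerP y (3 / 4)) => ?; [exists (Some false)|exists (Some true)];
    by split => /=; lra.
by exists None; split => /=; lra.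
Qed.

Lemma psi_in i p : Din p -> psi_piece i p -> Y (psi_map i p).
Proof.
case: p => x y; case: i => [[]|];
  rewrite /Din /box /rect /setU /psi_piece /crect /mkset /= => p1 p2.
- have [y1|y1] := eqVneq y (3 / 4); first by Y_tgt Slit 0%N.
  have {}y1 : 3 / 4 < y by lra.
  by Y_in.
- have [y1|y1] := eqVneq y (3 / 4); first by Y_src Slit 0%N.
  have {}y1 : y < 3 / 4 by lra.
  have [y2|y2] := eqVneq y (1 / 2); first by Y_tgt TopR 0%N.
  have {}y2 : 1 / 2 < y by lra.
  by Y_in.
- have [y2|y2] := eqVneq y (1 / 2); first by Y_src TopR 0%N.
  have {}y2 : y < 1 / 2 by lra.
  by Y_in.
Qed.

(** The cut at height 1/2 opens into the edge [TopR 0], the cut at height 3/4 into the slit. *)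
Lemma psi_overlap i j p : Din p -> psi_piece i p -> psi_piece j p ->
  related (psi_map i p) (psi_map j p).
Proof.
have m1 q : Din q -> psi_piece None q -> psi_piece (Some false) q ->
    joined (psi_map None q) (psi_map (Some false) q).
  case: q => x y; rewrite /Din /box /rect /setU /psi_piece /crect /mkset /= => p1 p2 p3.
  by glue TopR 0%N.
have m2 q : Din q -> psi_piece (Some false) q -> psi_piece (Some true) q ->
    joined (psi_map (Some false) q) (psi_map (Some true) q).
  case: q => x y; rewrite /Din /box /rect /setU /psi_piece /crect /mkset /= => p1 p2 p3.
  by glue Slit 0%N.
have m3 q : psi_piece None q -> psi_piece (Some true) q -> False.
  by case: q => x y; rewrite /psi_piece /crect /mkset /=; lra.
move=> pi; case: i => [[]|]; case: j => [[]|] Pi Pj; try exact: Or31.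
- by have [_ _ /related_sym] := m2 p pi Pj Pi.
- by have := m3 p Pj Pi.
- by have [] := m2 p pi Pi Pj.
- by have [_ _ /related_sym] := m1 p pi Pj Pi.
- by have := m3 p Pi Pj.
- by have [] := m1 p pi Pi Pj.
Qed.

(** The slit becomes [TopL 0] and the top edges go from index [n] to [n.+1], while the side edges go
    from [n.+1] to [n]; [SideA 0] and [SideB 0] close up inside D. *)
Lemma psi_edge k n i j p : source k n p -> psi_piece i p ->
  psi_piece j (p + trans k n) -> joined (psi_map i p) (psi_map j (p + trans k n)).
Proof.
case: p => x y; rewrite /psi_piece /crect /mkset.
case: k => //=.
- move=> p0; case: i => [[]|] /= p1; impossible; case: j => [[]|] /= p2; impossible.
  by glue TopL 0%N.
- have pu := u_gt0 R n; have pn := u_le1 R n => p0.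
  case: i => [[]|] /= p1; impossible; case: j => [[]|] /= p2; impossible.
  by glue TopL n.+1.
- have pu := u_gt0 R n; have pn := u_le1 R n => p0.
  case: i => [[]|] /= p1; impossible; case: j => [[]|] /= p2; impossible.
  by glue TopR n.+1.
- case: n => [|n]; rewrite /gap /= ?uS ?u0 => p0.
    case: i => [[]|] /= p1; impossible; case: j => [[]|] /= p2; impossible.
    by same.
  have pu := u_gt0 R n; have pn := u_parity R n.
  case on: (odd n) pn => /= pn;
    (case: i => [[]|] /= p1; impossible; case: j => [[]|] /= p2; impossible);
    by glue SideA n.
- case: n => [|n]; rewrite /gap /= ?uS ?u0 => p0.
    case: i => [[]|] /= p1; impossible; case: j => [[]|] /= p2; impossible.
    by same.
  have pu := u_gt0 R n; have pn := u_parity R n.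
  case on: (odd n) pn => /= pn;
    (case: i => [[]|] /= p1; impossible; case: j => [[]|] /= p2; impossible);
    by glue SideB n.
Qed.

Lemma psi_exists : exists psi : X -> X, forall i p, Y p -> psi_piece i p ->
  Y (psi_map i p) /\ psi (toX p) = toX (psi_map i p).
Proof.
apply: piecewise_exists.
- exact: psi_cover.
- exact: psi_in.
- exact: psi_overlap.
- exact: psi_edge.
Qed.

(** The inverse is built by the same gluing procedure, so that its continuity comes from
    [piecewise_affine] as well. Its cuts at abscissas 0 and 1/2 open into [SideA 0] and
    [SideB 0]. *)
Definition psiV_piece (i : option bool) : set C :=
  match i with
  | None => crect 0 (1 / 2) 0 1
  | Some false => crect (- (1 / 2)) 0 0 (1 / 2)
  | Some true => crect (1 / 2) 1 (1 / 2) 1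
  end.

Definition psiV_map (i : option bool) (z : C) : C :=
  match i with
  | None => (2 * Re z - 1 / 2) +i* (Im z / 2)
  | Some false => (2 * Re z + 1) +i* (Im z / 2 + 1 / 2)
  | Some true => (2 * Re z - 1) +i* (Im z / 2 + 1 / 2)
  end.

Lemma psiV_cover p : Y p -> exists i, psiV_piece i p.
Proof.
case: p => x y /Y_D [] [/= /andP[? ?] /andP[? ?]].
  case: (lerP x (1 / 2)) => ?; [exists None|exists (Some true)];
    by split => /=; lra.
case: (lerP x 0) => ?; [exists (Some false)|exists None];
  by split => /=; lra.
Qed.

Lemma psiV_in i p : Din p -> psiV_piece i p -> Y (psiV_map i p).
Proof.
case: p => x y; case: i => [[]|];
  rewrite /Din /box /rect /setU /psiV_piece /crect /mkset /= => p1 p2.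
- have [x1|x1] := eqVneq x (1 / 2); first by Y_tgt SideB 0%N.
  have {}x1 : 1 / 2 < x by lra.
  by Y_in.
- have [x1|x1] := eqVneq x 0; first by Y_src SideA 0%N.
  have {}x1 : x < 0 by lra.
  by Y_in.
- have [x1|x1] := eqVneq x 0; first by Y_tgt SideA 0%N.
  have {}x1 : 0 < x by lra.
  have [x2|x2] := eqVneq x (1 / 2); first by Y_src SideB 0%N.
  have {}x2 : x < 1 / 2 by lra.
  by Y_in.
Qed.

Lemma psiV_overlap i j p : Din p -> psiV_piece i p -> psiV_piece j p ->
  related (psiV_map i p) (psiV_map j p).
Proof.
have m1 q : Din q -> psiV_piece None q -> psiV_piece (Some false) q ->
    joined (psiV_map (Some false) q) (psiV_map None q).
  case: q => x y; rewrite /Din /box /rect /setU /psiV_piece /crect /mkset /= => p1 p2 p3.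
  by glue SideA 0%N.
have m2 q : Din q -> psiV_piece None q -> psiV_piece (Some true) q ->
    joined (psiV_map None q) (psiV_map (Some true) q).
  case: q => x y; rewrite /Din /box /rect /setU /psiV_piece /crect /mkset /= => p1 p2 p3.
  by glue SideB 0%N.
have m3 q : psiV_piece (Some false) q -> psiV_piece (Some true) q -> False.
  by case: q => x y; rewrite /psiV_piece /crect /mkset /=; lra.
move=> pi; case: i => [[]|]; case: j => [[]|] Pi Pj; try exact: Or31.
- by have := m3 p Pj Pi.
- by have [_ _ /related_sym] := m2 p pi Pj Pi.
- by have := m3 p Pi Pj.
- by have [] := m1 p pi Pj Pi.
- by have [] := m2 p pi Pi Pj.
- by have [_ _ /related_sym] := m1 p pi Pi Pj.
Qed.

Lemma psiV_edge k n i j p : source k n p -> psiV_piece i p ->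
  psiV_piece j (p + trans k n) -> joined (psiV_map i p) (psiV_map j (p + trans k n)).
Proof.
case: p => x y; rewrite /psiV_piece /crect /mkset.
case: k => //=.
- move=> p0; case: i => [[]|] /= p1; impossible; case: j => [[]|] /= p2; impossible.
  by same.
- case: n => [|n]; rewrite /= ?uS ?u0 => p0.
    case: i => [[]|] /= p1; impossible; case: j => [[]|] /= p2; impossible.
    by glue Slit 0%N.
  have pu := u_gt0 R n; have pn := u_le1 R n.
  case: i => [[]|] /= p1; impossible; case: j => [[]|] /= p2; impossible.
  by glue TopL n.
- case: n => [|n]; rewrite /= ?uS ?u0 => p0.
    case: i => [[]|] /= p1; impossible; case: j => [[]|] /= p2; impossible.
    by same.
  have pu := u_gt0 R n; have pn := u_le1 R n.
  case: i => [[]|] /= p1; impossible; case: j => [[]|] /= p2; impossible.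
  by glue TopR n.
- have pu := u_gt0 R n; have pn := u_parity R n; rewrite /gap => p0.
  case on: (odd n) pn => /= pn;
    (case: i => [[]|] /= p1; impossible; case: j => [[]|] /= p2; impossible);
    by glue SideA n.+1.
- have pu := u_gt0 R n; have pn := u_parity R n; rewrite /gap => p0.
  case on: (odd n) pn => /= pn;
    (case: i => [[]|] /= p1; impossible; case: j => [[]|] /= p2; impossible);
    by glue SideB n.+1.
Qed.

Lemma psiV_exists : exists psiV : X -> X, forall i p, Y p -> psiV_piece i p ->
  Y (psiV_map i p) /\ psiV (toX p) = toX (psiV_map i p).
Proof.
apply: piecewise_exists.
- exact: psiV_cover.
- exact: psiV_in.
- exact: psiV_overlap.
- exact: psiV_edge.
Qed.

End Psi.

Section Automorphisms.
Variable R : realType.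
Local Notation C := R[i].
Local Notation Y := (@punctured_polygon R).
Local Notation X := (Xinf R).

Definition rho_shift (i : bool) : C :=
  if i then (- (1 / 2)) +i* 1 else (1 / 2) +i* 1.

Definition psi_shift (i : option bool) : C :=
  match i with
  | None => (1 / 4) +i* 0
  | Some false => (- (1 / 2)) +i* (- 1)
  | Some true => (1 / 2) +i* (- 1)
  end.

Definition psiV_shift (i : option bool) : C :=
  match i with
  | None => (- (1 / 2)) +i* 0
  | Some false => 1 +i* (1 / 2)
  | Some true => (- 1) +i* (1 / 2)
  end.

Lemma rho_mapE i p : rho_map i p = act (diag2 1 (- 1)) p + rho_shift i.
Proof. by rewrite act_diag2; case: i; apply: cplxE; lra. Qed.

Lemma psi_mapE i p : psi_map i p = act (diag2 (1 / 2) 2) p + psi_shift i.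
Proof. by rewrite act_diag2; case: i => [[]|]; apply: cplxE; lra. Qed.

Lemma psiV_mapE i p : psiV_map i p = act (diag2 2 (1 / 2)) p + psiV_shift i.
Proof. by rewrite act_diag2; case: i => [[]|]; apply: cplxE; lra. Qed.

(** The horizontal shift by 1/2 would have to be matched, up to sign, by a gluing translation. Only
    [SideB] with even index has such a horizontal part, and its source, below height 1/2, is not in
    the rectangle where it would have to be. *)
Lemma rho_no_fixpoint i p : Y p -> rho_piece i p -> ~ related (rho_map i p) p.
Proof.
case: p => x y Yp Pi; case=> [|/glueP[k [n [+ +]]]|/glueP[k [n [+ +]]]].
- by case: i Pi => _ [? ?]; lra.
- have pu := u_gt0 R n; have pn := u_le1 R n; move: Pi.
  rewrite /rho_piece /crect /mkset; case: i; case: k => //= Pi S /eqP;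
    rewrite eq_complex /= => /andP[/eqP + /eqP +]; case: (odd n); lra.
- have pu := u_gt0 R n; have pn := u_le1 R n; move: Pi.
  rewrite /rho_piece /crect /mkset; case: i; case: k => //= Pi S /eqP;
    rewrite eq_complex /= => /andP[/eqP + /eqP +]; case: (odd n); lra.
Qed.

Lemma automorphisms_exist : exists rho psi : X -> X,
  [/\ forall x, locally_affine rho (diag2 1 (- 1)) x, involutive rho
    & forall x, rho x <> x] /\
  [/\ forall x, locally_affine psi (diag2 (1 / 2) 2) x, homeomorphism psi &
      rho \o psi = psi \o rho].
Proof.
have [rho hrho] := rho_exists R.
have [psi hpsi] := psi_exists R.
have [psiV hpsiV] := psiV_exists R.
have rhocov p : Y p -> exists i, rho_piece i p.
  by move=> /Y_D [] h; [exists true|exists false].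
exists rho, psi; split; split.
- apply: (piecewise_affine (P := @rho_piece R) (b := rho_shift)) => //.
    by case; exact: crect_closed.
  by move=> i p Yp Pp; rewrite -rho_mapE; exact: hrho.
- move=> x; have [p Yp <-] := toX_surj x; have [i Pi] := rhocov p Yp.
  have [Yq ->] := hrho i p Yp Pi.
  have Pj : rho_piece (~~ i) (rho_map i p).
    by case: i Pi {Yq} => -[/= /andP[? ?] /andP[? ?]]; split => /=; lra.
  have [_ ->] := hrho _ _ Yq Pj; congr toX.
  by case: p {Yp Pi Yq Pj} => a b; case: i; apply: cplxE => /=; lra.
- move=> x; have [p Yp <-] := toX_surj x; have [i Pi] := rhocov p Yp.
  have [Yq ->] := hrho i p Yp Pi => /(toX_eqP Yq Yp).
  exact: rho_no_fixpoint.
- apply: (piecewise_affine (P := @psi_piece R) (b := psi_shift)).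
  + by case=> [[]|]; exact: crect_closed.
  + exact: psi_cover.
  + by move=> i p Yp Pp; rewrite -psi_mapE; exact: hpsi.
- have cpsi : continuous psi.
    apply: (@locally_affine_continuous _ _ (diag2 (1 / 2) 2)).
    apply: (piecewise_affine (P := @psi_piece R) (b := psi_shift)).
    + by case=> [[]|]; exact: crect_closed.
    + exact: psi_cover.
    + by move=> i p Yp Pp; rewrite -psi_mapE; exact: hpsi.
  split=> //; exists psiV; split.
  + apply: (@locally_affine_continuous _ _ (diag2 2 (1 / 2))).
    apply: (piecewise_affine (P := @psiV_piece R) (b := psiV_shift)).
    * by case=> [[]|]; exact: crect_closed.
    * exact: psiV_cover.
    * by move=> i p Yp Pp; rewrite -psiV_mapE; exact: hpsiV.
  + move=> x; have [p Yp <-] := toX_surj x; have [i Pi] := psi_cover Yp.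
    have [Yq ->] := hpsi i p Yp Pi.
    have Pj : psiV_piece i (psi_map i p).
      by case: i Pi {Yq} => [[]|] -[/= /andP[? ?] /andP[? ?]]; split => /=; lra.
    have [_ ->] := hpsiV _ _ Yq Pj; congr toX.
    by case: p {Yp Pi Yq Pj} => a b; case: i => [[]|]; apply: cplxE => /=; lra.
  + move=> x; have [p Yp <-] := toX_surj x; have [i Pi] := psiV_cover Yp.
    have [Yq ->] := hpsiV i p Yp Pi.
    have Pj : psi_piece i (psiV_map i p).
      by case: i Pi {Yq} => [[]|] -[/= /andP[? ?] /andP[? ?]]; split => /=; lra.
    have [_ ->] := hpsi _ _ Yq Pj; congr toX.
    by case: p {Yp Pi Yq Pj} => a b; case: i => [[]|]; apply: cplxE => /=; lra.
- apply/funext => x /=; have [p Yp <-] := toX_surj x; have [i Pi] := psi_cover Yp.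
  have [Yq ->] := hpsi i p Yp Pi.
  have [j [i' [j' [Pj Pi' Pj' e]]]] : exists j i' j', [/\ rho_piece j p,
      psi_piece i' (rho_map j p), rho_piece j' (psi_map i p) &
      psi_map i' (rho_map j p) = rho_map j' (psi_map i p)].
    case: p Pi {Yp Yq} => a b; case: i => [[]|] -[/= /andP[? ?] /andP[? ?]].
    + exists true, None, true; split; last by apply: cplxE => /=; lra.
      1-3: by rewrite /rho_piece /psi_piece /rho_map /crect /=; split; lra.
    + exists true, None, false; split; last by apply: cplxE => /=; lra.
      1-3: by rewrite /rho_piece /psi_piece /rho_map /crect /=; split; lra.
    (* At height 1/4 the image under [rho] crosses the cut 3/4 of [psi], and the image under [psi]
       crosses from the lower rectangle to the upper one. *)
    + case: (lerP b (1 / 4)) => ?.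
        exists false, (Some true), false; split; last by apply: cplxE => /=; lra.
        1-3: by rewrite /rho_piece /psi_piece /rho_map /crect /=; split; lra.
      exists false, (Some false), true; split; last by apply: cplxE => /=; lra.
      1-3: by rewrite /rho_piece /psi_piece /rho_map /crect /=; split; lra.
  have [Yr ->] := hrho j p Yp Pj.
  have [_ ->] := hpsi i' _ Yr Pi'; have [_ ->] := hrho j' _ Yq Pj'.
  by rewrite e.
Qed.

End Automorphisms.

(** * Connectedness *)

Section Connectivity.
Variable R : realType.
Local Notation C := R[i].
Local Notation D := (@polygon R).
Local Notation Y := (@punctured_polygon R).
Local Notation X := (Xinf R).
Local Notation box := (@box R).

Definition seg (p q : C) (t : R) : C :=
  (Re p + t * (Re q - Re p)) +i* (Im p + t * (Im q - Im p)).

Lemma seg0 p q : seg p q 0 = p.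
Proof. by case: p => a b; rewrite /seg !mul0r !addr0. Qed.

Lemma seg1 p q : seg p q 1 = q.
Proof. by case: p => a b; case: q => c d; rewrite /seg !mul1r /= !subrKC. Qed.

Lemma seg_continuous p q : continuous (seg p q).
Proof.
move=> t; apply/cvg_ballP => e e0.
have : nbhs (seg p q t) (ball (seg p q t) e) by exact: nbhsx_ballx.
move=> /nbhs_squareP[d d0 dA].
have h1 : {for t, continuous (fun t : R => Re p + t * (Re q - Re p))}.
  by apply: cvgD; [exact: cvg_cst|apply: cvgM; [exact: cvg_id|exact: cvg_cst]].
have h2 : {for t, continuous (fun t : R => Im p + t * (Im q - Im p))}.
  by apply: cvgD; [exact: cvg_cst|apply: cvgM; [exact: cvg_id|exact: cvg_cst]].
move: h1 h2 => /cvgrPdist_lt /(_ d d0) h1 /cvgrPdist_lt /(_ d d0) h2.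
by move: h1 h2; apply: filterS2 => s s1 s2; apply: dA; split; rewrite /= distrC.
Qed.

Lemma toX_path (f : R -> C) (A : set R) : continuous f ->
  (forall t, A t -> Y (f t)) -> {within A, continuous (@toX R \o f)}.
Proof.
move=> cf AY; apply/subspace_continuousP => t At V /=.
rewrite nbhsE => -[W [oW Wt] WV].
move/open_toXP: oW => /(_ _ (AY _ At) Wt) h.
have : \forall s \near t, Y (f s) -> W (toX (f s)) 
  by exact: (cf t [set w | Y w -> W (toX w)] h).
rewrite /within /= !near_simpl; apply: filterS => s h' As.
by apply: WV; apply: h'; exact: AY.
Qed.

Lemma seg_component U p q :
  (forall t, 0 <= t <= 1 -> Y (seg p q t) /\ U (toX (seg p q t))) ->
  connected_component U (toX p) (toX q).
Proof.
move=> h; pose f := @toX R \o seg p q.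
have cf : {within `[0, 1], continuous f}.
  apply: toX_path; first exact: seg_continuous.
  by move=> t /=; rewrite in_itv /= => /h[].
have cn : connected (f @` `[0, 1]).
  by apply: connected_continuous_connected => //; exact: segment_connected.
have i0 : (f @` `[0, 1]) (toX p).
  by exists 0; rewrite /= ?in_itv /= ?lexx ?ler01 // /f /= seg0.
apply: (connected_component_max i0) => //.
  by move=> _ [t /= + <-]; rewrite in_itv /= => /h[].
by exists 1; rewrite /= ?in_itv /= ?lexx ?ler01 // /f /= seg1.
Qed.

(** Only the open segment has to be controlled, so an endpoint may lie on an edge of D. *)
Lemma seg_component_in U p q : Y p -> Y q -> U (toX p) -> U (toX q) ->
  (forall t, 0 < t < 1 -> Y (seg p q t) /\ U (toX (seg p q t))) ->
  connected_component U (toX p) (toX q).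
Proof.
move=> Yp Yq Up Uq h; apply: seg_component => t /andP[].
rewrite le_eqVlt => /predU1P[<- _|t0]; first by rewrite seg0.
rewrite le_eqVlt => /predU1P[->|t1]; first by rewrite seg1.
by apply: h; rewrite t0.
Qed.

Lemma conv_lt (a x y t : R) : 0 < t < 1 -> a <= x -> a < y -> a < x + t * (y - x).
Proof. by move=> /andP[t0 t1] ax ay; nra. Qed.

Lemma conv_gt (a x y t : R) : 0 < t < 1 -> x <= a -> y < a -> x + t * (y - x) < a.
Proof. by move=> /andP[t0 t1] ax ay; nra. Qed.

Lemma conv_square r v p q t : 0 < t < 1 -> square r v p -> square r v q ->
  square r v (seg p q t).
Proof.
move=> t01 /squareP[/andP[? ?] /andP[? ?]] /squareP[/andP[? ?] /andP[? ?]].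
by apply/squareP; split; apply/andP; split; (apply: conv_lt || apply: conv_gt) => //; exact: ltW.
Qed.

Lemma conv_rect a b c d p q t : 0 < t < 1 ->
  (a <= Re p <= b) -> (c <= Im p <= d) -> rect a b c d q ->
  rect a b c d (seg p q t).
Proof.
move=> t01 /andP[? ?] /andP[? ?] [/andP[? ?] /andP[? ?]].
by split; apply/andP; split; (apply: conv_lt || apply: conv_gt).
Qed.

Lemma rect_component U r v a b c d p q :
  (forall z, Y z -> square r v z -> U (toX z)) ->
  rect a b c d `<=` (@Din R) -> Y p -> square r v p ->
  (a <= Re p <= b) -> (c <= Im p <= d) ->
  rect a b c d q -> square r v q ->
  connected_component U (toX p) (toX q).
Proof.
move=> hU sub Yp vp p1 p2 qr vq.
have Yq : Y q by apply: Din_Y; exact: sub.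
apply: seg_component_in => //; [exact: hU|exact: hU|] => t t01.
have Yt : Y (seg p q t) by apply: Din_Y; apply: sub; exact: conv_rect.
by split=> //; apply: hU => //; exact: conv_square.
Qed.

Lemma Low_Din : box Low 0 `<=` @Din R. Proof. by move=> z ?; left; left. Qed.
Lemma Up_Din : box Up 0 `<=` @Din R. Proof. by move=> z ?; left; right. Qed.
Lemma Mid_Din : box Mid 0 `<=` @Din R. Proof. by move=> z ?; right. Qed.

(** A short move towards the centre of a closed rectangle containing [p] enters the open rectangle
    without leaving the open square. *)
Lemma push_in r v p : D p -> square r v p -> exists2 q, square r v q &
  (box Low 0 q /\ (- (1 / 2) <= Re p <= 1 / 2) /\ (0 <= Im p <= 1 / 2)) \/
  (box Up 0 q /\ (0 <= Re p <= 1) /\ (1 / 2 <= Im p <= 1)).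
Proof.
move=> Dp vp.
have near (c : C) : exists2 t : R, 0 < t < 1 & square r v (seg p c t).
  have : \forall t \near (0 : R), square r v (seg p c t).
    apply: (@seg_continuous p c 0); rewrite seg0.
    by apply: open_nbhs_nbhs; split => //; exact: square_open.
  move=> /nbhs_ballP[e /= e0 eb].
  exists (Num.min (e / 2) (1 / 2)).
    by rewrite lt_min gt_min; apply/andP; split; [apply/andP; split|apply/orP; right]; lra.
  apply: eb; rewrite /ball /= sub0r normrN ger0_norm ?le_min ?gt_min; first by apply/orP; left; lra.
  by lra.
case: (Dp) => -[p1 p2].
  have [t t01 vt] := near ((1 / 2) +i* (3 / 4)).
  exists (seg p ((1 / 2) +i* (3 / 4)) t) => //; right; split=> //.
  by apply: conv_rect => //; split => /=; lra.
have [t t01 vt] := near (0 +i* (1 / 4)).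
exists (seg p (0 +i* (1 / 4)) t) => //; left; split=> //.
by apply: conv_rect => //; split => /=; lra.
Qed.

(** The path changes rectangle inside the column [Mid], at an abscissa [x] that also belongs to the
    square. *)
Lemma Low_Up_component U r v p q :
  (forall z, Y z -> square r v z -> U (toX z)) ->
  box Low 0 p -> box Up 0 q -> square r v p -> square r v q ->
  connected_component U (toX p) (toX q).
Proof.
move=> hU; case: p => x1 y1; case: q => x2 y2 pL qU vp vq.
have [x [x0 x1' vx]] : exists x, [/\ 0 < x, x < 1 / 2 & Re v - r < x < Re v + r].
  move: pL qU vp vq => [/= /andP[? ?] _] [/= /andP[? ?] _].
  move=> /squareP[/= /andP[? ?] _] /squareP[/= /andP[? ?] _].
  case: (ltrP 0 x1) => ?; first by exists x1; split => //; apply/andP; split.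
  (* When [x1] is not positive, this value lies between [x1] and [x2], hence in the square, and
     below 1/2. *)
  exists (Num.min x2 (1 / 2) / 2).
  have := ge_min (Num.min x2 (1 / 2)) x2 (1 / 2); rewrite lexx => /esym/orP mm.
  have m0 : 0 < Num.min x2 (1 / 2) by rewrite lt_min; lra.
  have m1 : Num.min x2 (1 / 2) <= x2 by rewrite ge_min lexx.
  have m2 : Num.min x2 (1 / 2) <= 1 / 2 by rewrite ge_min lexx orbT.
  by split; [lra|lra|lra].
move: (pL) (qU) (vp) (vq) => [/= /andP[? ?] /andP[? ?]] [/= /andP[? ?] /andP[? ?]].
move=> /squareP[/= _ v1] /squareP[/= _ v2].
have vm : square r v (x +i* y1) by apply/squareP.
have vm' : square r v (x +i* y2) by apply/squareP.
have mL : box Low 0 (x +i* y1) by split => /=; lra.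
have mM : box Mid 0 (x +i* y1) by split => /=; lra.
have m'M : box Mid 0 (x +i* y2) by split => /=; lra.
have m'U : box Up 0 (x +i* y2) by split => /=; lra.
apply: (@connected_component_trans _ _ (toX (x +i* y1))).
  apply: (rect_component hU Low_Din) => //; first by apply: Din_Y; exact: Low_Din.
    by rewrite /=; lra.
  by rewrite /=; lra.
apply: (@connected_component_trans _ _ (toX (x +i* y2))).
  apply: (rect_component hU Mid_Din) => //; first by apply: Din_Y; exact: Mid_Din.
    by rewrite /=; lra.
  by rewrite /=; lra.
apply: (rect_component hU Up_Din) => //; first by apply: Din_Y; exact: Up_Din.
  by rewrite /=; lra.
by rewrite /=; lra.
Qed.

(** D is not convex, yet its trace on any square is connected, whatever the centre. This serves both
    for the whole surface and for the neighbourhoods of removed points. *)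
Lemma square_component U r v p q :
  (forall z, Y z -> square r v z -> U (toX z)) ->
  Y p -> square r v p -> Y q -> square r v q ->
  connected_component U (toX p) (toX q).
Proof.
move=> hU Yp vp Yq vq.
have main p0 : Y p0 -> square r v p0 -> exists2 p', square r v p' &
    (box Low 0 p' \/ box Up 0 p') /\ connected_component U (toX p0) (toX p').
  move=> Yp0 vp0; have [p' vp' [[pL [p1 p2]]|[pU [p1 p2]]]] := push_in (Y_D Yp0) vp0.
    by exists p' => //; split; [left|exact: (rect_component hU Low_Din)].
  by exists p' => //; split; [right|exact: (rect_component hU Up_Din)].
have [p' vp' [p'b pp']] := main p Yp vp.
have [q' vq' [q'b qq']] := main q Yq vq.
apply: connected_component_trans pp' _.
apply: (@connected_component_trans _ _ (toX q')); last exact: connected_component_sym.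
case: p'b => [pL|pU]; case: q'b => [qL|qU].
- have [/andP[? ?] /andP[? ?]] := pL.
  apply: (rect_component hU Low_Din) => //; first by apply: Din_Y; exact: Low_Din.
    by rewrite !ltW.
  by rewrite !ltW.
- exact: (Low_Up_component hU pL qU).
- by apply: connected_component_sym; exact: (Low_Up_component hU qL pU).
- have [/andP[? ?] /andP[? ?]] := pU.
  apply: (rect_component hU Up_Din) => //; first by apply: Din_Y; exact: Up_Din.
    by rewrite !ltW.
  by rewrite !ltW.
Qed.

Lemma Xinf_connected : connected [set: X].
Proof.
have Y10 p : Y p -> square 10 0 p.
  by case: p => x y /Y_D [] [/= /andP[? ?] /andP[? ?]];
    apply/squareP; split => /=; lra.
have [p Yp _] := toX_surj (point : X).
suff -> : [set: X] = connected_component setT (toX p) by exact: component_connected.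
apply/seteqP; split=> // x _; have [q Yq <-] := toX_surj x.
by apply: (@square_component _ 10 0) => //; exact: Y10.
Qed.

End Connectivity.

(** * Genus *)

Section Genus.
Variable R : realType.
Local Notation C := R[i].
Local Notation D := (@polygon R).
Local Notation Y := (@punctured_polygon R).
Local Notation X := (Xinf R).
Local Notation box := (@box R).
Local Notation trans := (@trans R).
Local Notation u := (@u R).

(* The [k]th curve is a segment crossing the upper rectangle, from the midpoint
   of a left edge to the midpoint of the right edge [SideA k.*2.+1] glued to it. *)
Definition height (k : nat) (x : R) : R :=
  2 / 3 + x / 3 - u k.*2.+1 * (5 / 24 + x / 6).

Definition curve_point (k : nat) (t : R) : C := t +i* height k t.

Lemma u_odd_le k : u k.*2.+1 <= 1 / 2.
Proof. by have := u_parity R k.*2.+1; rewrite /= odd_double. Qed.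

Lemma height_bounds k t : 0 <= t <= 1 -> 1 / 2 < height k t < 1.
Proof.
move=> /andP[t0 t1]; have := u_gt0 R k.*2.+1; have := u_odd_le k; rewrite /height.
set v := u _ => v1 v0; apply/andP; split; nra.
Qed.

Lemma height_lt j k t : (j < k)%N -> 0 <= t <= 1 -> height j t < height k t.
Proof.
move=> jk /andP[t0 t1]; have := @u_half R j.*2.+1 k.*2.+1.
rewrite ltnS ltn_double => /(_ jk); have := u_gt0 R j.*2.+1.
rewrite /height; set v := u j.*2.+1; set w := u k.*2.+1 => v0 vw.
have : 0 < (v - w) * (5 / 24 + t / 6) by apply: mulr_gt0; lra.
by rewrite mulrBl; lra.
Qed.

Lemma height_le j k t : (j <= k)%N -> 0 <= t <= 1 -> height j t <= height k t.
Proof.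
by rewrite leq_eqVlt => /predU1P[->//|jk] t01; apply/ltW/height_lt.
Qed.

Lemma co01 (t : R) : 0 <= t < 1 -> 0 <= t <= 1.
Proof. by move=> /andP[-> /ltW]. Qed.

Lemma curve_source k : source (SideA) k.*2.+1 (curve_point k 1).
Proof.
have := u_gt0 R k.*2.+1; rewrite /= /height; set v := u _ => v0.
by split=> //; lra.
Qed.

Lemma curve_trans k : curve_point k 1 + trans SideA k.*2.+1 = curve_point k 0.
Proof.
rewrite /= /gap /= odd_double /=; apply/eqP; rewrite eq_complex /= /height.
by apply/andP; split; apply/eqP; lra.
Qed.

Lemma curve_Up k t : 0 < t < 1 -> box Up 0 (curve_point k t).
Proof.
move=> /andP[t0 t1]; split; first by apply/andP.
by apply: height_bounds; rewrite !ltW.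
Qed.

Lemma curve_Y k t : 0 <= t <= 1 -> Y (curve_point k t).
Proof.
have [Y1 Y0] := source_Y (curve_source k).
case/andP; rewrite le_eqVlt => /predU1P[<- _|t0]; first by rewrite -curve_trans.
rewrite le_eqVlt => /predU1P[->//|t1].
by apply: Din_Y; apply: Up_Din; apply: curve_Up; rewrite t0.
Qed.

Lemma curve_not_source k t j n : 0 <= t < 1 -> ~ source j n (curve_point k t).
Proof.
move=> /andP[t0 t1]; have /andP[h0 h1] : 1 / 2 < height k t < 1.
  by apply: height_bounds; rewrite t0 ltW.
have un := u_gt0 R n; have un1 := u_le1 R n.
by case: j => //= -[? ?]; lra.
Qed.

Definition curve (k : nat) : set X := (@toX R \o curve_point k) @` `[0, 1].

Lemma curveP k x : curve k x <-> exists2 t, 0 <= t < 1 & x = toX (curve_point k t).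
Proof.
split=> [[t /= + <-]|[t /andP[t0 t1] ->]]; last first.
  by exists t => //=; rewrite in_itv /= t0 ltW.
rewrite in_itv /= => /andP[t0]; rewrite le_eqVlt => /predU1P[->|t1].
  exists 0; first by rewrite lexx ltr01.
  have [Y1 Y0] := source_Y (curve_source k).
  apply/toX_eqP; [exact: Y1|by rewrite -curve_trans|].
  by apply: Or32; apply/glueP; exists SideA, k.*2.+1; rewrite curve_trans; split => //; exact: curve_source.
by exists t => //; rewrite t0.
Qed.

(** For parameters below 1 no point of a curve is a source, so no gluing step can join two of them.
    The end at parameter 1, which is a source, is represented by parameter 0. *)
Lemma curve_related j k s t : 0 <= s < 1 -> 0 <= t < 1 ->
  toX (curve_point j s) = toX (curve_point k t) -> curve_point j s = curve_point k t.
Proof.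
move=> s01 t01.
have Yp : Y (curve_point j s) by apply: curve_Y; exact: co01.
have Yq : Y (curve_point k t) by apply: curve_Y; exact: co01.
move=> /(toX_eqP Yp Yq)[//|/glueP[i [n [sp _]]]|/glueP[i [n [sp _]]]].
  by have := curve_not_source s01 sp.
by have := curve_not_source t01 sp.
Qed.

Lemma curve_continuous k : continuous (curve_point k).
Proof.
move=> t; rewrite /continuous_at.
have -> : curve_point k = seg (0 +i* height k 0) (1 +i* height k 1).
  apply/funext => s; apply/eqP; rewrite eq_complex /= /height.
  by apply/andP; split; apply/eqP; ring.
exact: seg_continuous.
Qed.

Lemma curve_simple k : simple_closed_curve R (curve k).
Proof.
exists (@toX R \o curve_point k); split=> //.
- apply: toX_path; first exact: curve_continuous.
  by move=> t /=; rewrite in_itv /=; exact: curve_Y.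
- have [Y1 Y0] := source_Y (curve_source k); rewrite /= -curve_trans.
  apply/toX_eqP => //; apply: Or33; apply/glueP.
  by exists SideA, k.*2.+1; split=> //; exact: curve_source.
- move=> s t; rewrite !inE /= !in_itv /= => s01 t01 /curve_related.
  by move=> /(_ s01 t01)[].
Qed.

Lemma curve_disjoint j k : j <> k -> curve j `&` curve k = set0.
Proof.
move=> jk; apply/seteqP; split=> // x [/curveP[s s01 ->] /curveP[t t01]].
move=> /(curve_related s01 t01)[st]; rewrite -{}st => /eqP.
have s01' := co01 s01.
case: (ltngtP j k) => [h|h|//].
  by rewrite lt_eqF //; exact: height_lt.
by rewrite gt_eqF //; exact: height_lt.
Qed.

Section Complement.
Variable g : nat.
Let U : set X := ~` \bigcup_(i : 'I_g) curve i.

Lemma off_curves p : Y p -> (forall k n, ~ source k n p) ->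
  (forall k : 'I_g, p = curve_point k (Re p) -> 0 <= Re p < 1 -> False) -> U (toX p).
Proof.
move=> Yp ns h [k _ /curveP[t t01]].
have Yq : Y (curve_point k t) by apply: curve_Y; exact: co01.
move=> /(toX_eqP Yp Yq)[e|/glueP[i [n [sp _]]]|/glueP[i [n [sp _]]]].
- by apply: (h k); rewrite e.
- exact: ns sp.
- exact: curve_not_source t01 sp.
Qed.

Lemma Din_not_source (p : C) k n : Din p -> ~ source k n p.
Proof. by move=> [[|]|] bp sp; have [] := box_source bp sp. Qed.

Lemma Low_off_curves p : box Low 0 p -> U (toX p).
Proof.
move=> pL; have pi := Low_Din pL.
apply: off_curves; [exact: Din_Y|by move=> k n; exact: Din_not_source|].
move=> k e /andP[p0 p1]; have : 1 / 2 < height k (Re p) < 1.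
  by apply: height_bounds; rewrite p0 ltW.
by move: pL; rewrite {1}e => -[_ /= /andP[? ?]] /andP[? ?]; clear e pi; lra.
Qed.

Lemma Up_off_curves p : box Up 0 p ->
  (forall k : 'I_g, Im p <> height k (Re p)) -> U (toX p).
Proof.
move=> pU hp; have pi := Up_Din pU.
apply: off_curves; [exact: Din_Y|by move=> k n; exact: Din_not_source|].
by move=> k e _; apply: (hp k); rewrite {1}e.
Qed.

Let base : C := 0 +i* (1 / 4).

Lemma base_Low : box Low 0 base.
Proof. by split => /=; lra. Qed.

Lemma lower_component p : Y p -> U (toX p) ->
  - (1 / 2) <= Re p <= 1 / 2 -> 0 <= Im p <= 1 / 2 ->
  connected_component U (toX p) (toX base).
Proof.
move=> Yp Up p1 p2; apply: seg_component_in => //.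
- by apply: Din_Y; apply: Low_Din; exact: base_Low.
- by apply: Low_off_curves; exact: base_Low.
- move=> t t01; have bt : box Low 0 (seg p base t) by apply: conv_rect => //; exact: base_Low.
  by split; [apply: Din_Y; exact: Low_Din|exact: Low_off_curves].
Qed.

(* The strip between two consecutive curves reaches the midpoint of
   [SideA j.*2], which is glued to the left side of the lower rectangle. *)
Let exit (j : nat) : C := 1 +i* (1 - 3 / 8 * u j.*2).
Let inner (j : nat) : C := (1 - u j.*2 / 4) +i* (1 - 3 / 8 * u j.*2).

Lemma exit_source j : source SideA j.*2 (exit j).
Proof. by have := u_gt0 R j.*2; split => //=; lra. Qed.

Lemma exit_U j : U (toX (exit j)).
Proof.
have sx := exit_source j; have [Yx Yx'] := source_Y sx.
move=> [k _ /curveP[t t01]].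
have Yq : Y (curve_point k t) by apply: curve_Y; exact: co01.
move=> /(toX_eqP Yx Yq)[[e _]|/glueP[i [n [sp]]]|/glueP[i [n [sp _]]]].
- by move: t01; rewrite -e ltxx andbF.
(* An edge [SideA] of even index is translated horizontally by -3/2, to abscissa -1/2, where no
   curve passes. *)
- rewrite -(source_inj sx sp) => /eqP; rewrite eq_complex /= odd_double => /andP[/eqP e _].
  by case/andP: t01 => ? ?; lra.
- exact: curve_not_source t01 sp.
Qed.

Lemma exit_component j : connected_component U (toX (exit j)) (toX base).
Proof.
have sx := exit_source j; have [Yx Yx'] := source_Y sx.
have e : toX (exit j) = toX (exit j + trans SideA j.*2).
  by apply/toX_eqP => //; apply: Or32; apply/glueP; exists SideA, j.*2.
have Ux : U (toX (exit j)) := exit_U (j := j); rewrite e in Ux *.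
have := u_gt0 R j.*2; have := u_le1 R j.*2 => ? ?.
by apply: lower_component => //; rewrite /= /gap odd_double /=; lra.
Qed.

(** On the right side, curve [k] is at height 1 - 3/8 [u k.*2.+1] and the exit at 1 - 3/8 [u j.*2],
    so their order is that of the exponents. The abscissa of [inner j] is close enough to 1 to
    preserve it. *)
Lemma inner_sides j (k : 'I_g) :
  ((k < j)%N -> height k (1 - u j.*2 / 4) < 1 - 3 / 8 * u j.*2 /\
     height k 1 < 1 - 3 / 8 * u j.*2) /\
  ((j <= k)%N -> 1 - 3 / 8 * u j.*2 < height k (1 - u j.*2 / 4) /\
     1 - 3 / 8 * u j.*2 < height k 1).
Proof.
have w0 := u_gt0 R j.*2; have w1 := u_le1 R j.*2.
have v0 := u_gt0 R k.*2.+1; have v1 := u_odd_le k.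
split=> jk.
  have := @u_half R k.*2.+1 j.*2; rewrite -doubleS leq_double => /(_ jk).
  by rewrite /height; split; nra.
have := @u_half R j.*2 k.*2.+1; rewrite ltnS leq_double => /(_ jk).
by rewrite /height; split; nra.
Qed.

Lemma upper_side p : Y p -> U (toX p) -> 0 <= Re p <= 1 ->
  forall k : 'I_g, Im p <> height k (Re p).
Proof.
case: p => x y Yp Up /= p1 k e; apply: Up; exists k => //.
by exists x => /=; rewrite ?in_itv //= e.
Qed.

(** [j] is the least index of a curve above [p], or [g] if there is none; since heights increase
    with the index, all earlier curves are below. *)
Lemma strip_exists p : Y p -> U (toX p) -> 0 <= Re p <= 1 ->
  exists j, forall k : 'I_g, ((k < j)%N -> height k (Re p) < Im p) /\
    ((j <= k)%N -> Im p < height k (Re p)).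
Proof.
move=> Yp Up p1; have ne := upper_side Yp Up p1.
pose P j := (g <= j)%N || (Im p < height j (Re p)).
have ex : exists j, P j by exists g; rewrite /P leqnn.
case: (ex_minnP ex) => j Pj jmin; exists j => k; split=> jk.
  have : ~~ P k by apply/negP => /jmin; rewrite leqNgt jk.
  rewrite negb_or -ltnNge -leNgt => /andP[_]; rewrite le_eqVlt => /predU1P[e|//].
  by have := ne k; rewrite e.
case/orP: Pj => [gj|h].
  by have := ltn_ord k; rewrite ltnNge (leq_trans gj jk).
by apply: lt_le_trans h _; exact: height_le.
Qed.

Lemma height_affine k a b t : height k (a + t * (b - a)) =
  height k a + t * (height k b - height k a).
Proof. by rewrite /height; ring. Qed.

Lemma conv_pos (a b t : R) : 0 <= t <= 1 -> 0 < a -> 0 < b -> 0 < (1 - t) * a + t * b.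
Proof.
move=> /andP[t0 t1] a0 b0; have [->|tn] := eqVneq t 1; first by rewrite subrr mul0r add0r mul1r.
by apply: ltr_pwDl; [rewrite mulr_gt0// subr_gt0 lt_neqAle tn|rewrite mulr_ge0// ltW].
Qed.

(** Each curve is the graph of an affine function, so both of its sides are convex. *)
Lemma side_seg_lt k p q t : 0 <= t <= 1 -> height k (Re p) < Im p -> height k (Re q) < Im q ->
  height k (Re (seg p q t)) < Im (seg p q t).
Proof.
rewrite /= height_affine -!(subr_gt0 (height _ _)) => t01 hp hq.
by rewrite -subr_gt0; have := conv_pos t01 hp hq; congr (_ < _); ring.
Qed.

Lemma side_seg_gt k p q t : 0 <= t <= 1 -> Im p < height k (Re p) -> Im q < height k (Re q) ->
  Im (seg p q t) < height k (Re (seg p q t)).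
Proof.
rewrite /= height_affine -!(subr_gt0 (Im _)) => t01 hp hq.
by rewrite -subr_gt0; have := conv_pos t01 hp hq; congr (_ < _); ring.
Qed.

(** The detour by [inner j] is needed when [p] is on the right side: the segment from [p] to
    [exit j] would run along this side and could contain removed points. *)
Lemma upper_component p : Y p -> U (toX p) ->
  0 <= Re p <= 1 -> 1 / 2 <= Im p <= 1 ->
  connected_component U (toX p) (toX base).
Proof.
move=> Yp Ux p1 p2; have [j hj] := strip_exists Yp Ux p1.
have w0 := u_gt0 R j.*2; have w1 := u_le1 R j.*2.
have iU : box Up 0 (inner j) by split => /=; lra.
have tle (t : R) : 0 < t < 1 -> 0 <= t <= 1 by move=> /andP[? ?]; rewrite !ltW.
have sides (q q' : C) :
    (forall k : 'I_g, ((k < j)%N -> height k (Re q) < Im q) /\ ((j <= k)%N -> Im q < height k (Re q))) ->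
    (forall k : 'I_g, ((k < j)%N -> height k (Re q') < Im q') /\ ((j <= k)%N -> Im q' < height k (Re q'))) ->
    forall t, 0 < t < 1 -> forall k : 'I_g, Im (seg q q' t) <> height k (Re (seg q q' t)).
  move=> hq hq' t /tle t01 k; apply/eqP; have [h1 h2] := hq k; have [h1' h2'] := hq' k.
  case: (ltnP k j) => jk; first by rewrite gt_eqF// side_seg_lt//; auto.
  by rewrite lt_eqF// side_seg_gt//; auto.
have hi (k : 'I_g) : ((k < j)%N -> height k (Re (inner j)) < Im (inner j)) /\
    ((j <= k)%N -> Im (inner j) < height k (Re (inner j))).
  by have [h1 h2] := inner_sides j k; split=> [/h1[]|/h2[]].
have he (k : 'I_g) : ((k < j)%N -> height k (Re (exit j)) < Im (exit j)) /\
    ((j <= k)%N -> Im (exit j) < height k (Re (exit j))).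
  by have [h1 h2] := inner_sides j k; split=> [/h1[]|/h2[]].
have Yi : Y (inner j) by apply: Din_Y; exact: Up_Din.
have Ui : U (toX (inner j)).
  apply: Up_off_curves => // k; apply/eqP; have [h1 h2] := hi k.
  by case: (ltnP k j) => jk; [rewrite gt_eqF//; exact: h1|rewrite lt_eqF//; exact: h2].
apply: (@connected_component_trans _ _ (toX (inner j))).
  apply: seg_component_in => // t t01.
  have bt : box Up 0 (seg p (inner j) t) by exact: conv_rect.
  split; first by apply: Din_Y; exact: Up_Din.
  by apply: Up_off_curves => //; exact: sides.
apply: (@connected_component_trans _ _ (toX (exit j))); last exact: exit_component.
have [Ye _] := source_Y (exit_source j).
apply: connected_component_sym; apply: seg_component_in => // [|t t01]; first exact: exit_U.
have bt : box Up 0 (seg (exit j) (inner j) t).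
  by apply: conv_rect => //; rewrite /=; lra.
split; first by apply: Din_Y; exact: Up_Din.
by apply: Up_off_curves => //; exact: sides.
Qed.

Lemma complement_connected : connected U.
Proof.
have Ub : U (toX base) by apply: Low_off_curves; exact: base_Low.
suff -> : U = connected_component U (toX base) by exact: component_connected.
apply/seteqP; split=> [x|x]; last exact: connected_component_sub.
have [p Yp <-] := toX_surj x => Up; apply: connected_component_sym.
by case: (Y_D Yp) => -[p1 p2]; [exact: upper_component|exact: lower_component].
Qed.

End Complement.

Lemma Xinf_infinite_genus : infinite_genus R X.
Proof.
move=> g; exists (fun i : 'I_g => curve i); split.
- by move=> i; exact: curve_simple.
- apply/trivIsetP => i j _ _ /eqP ij; apply: curve_disjoint => e.
  by apply: ij; exact: val_inj.
- exact: complement_connected.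
Qed.

End Genus.

(** * The end *)

Section Vertices.
Variable R : realType.
Local Notation C := R[i].
Local Notation D := (@polygon R).
Local Notation Y := (@punctured_polygon R).
Local Notation X := (Xinf R).
Local Notation box := (@box R).
Local Notation trans := (@trans R).
Local Notation u := (@u R).

Lemma dyadic (x : R) : 0 < x <= 1 -> exists n, u n.+1 < x <= u n.
Proof.
move=> /andP[x0 x1]; have [n0 hn0] := u_small x0.
have ex : exists n, u n < x by exists n0.
case: (ex_minnP ex) => -[|n] un nmin; first by move: un; rewrite u0; lra.
exists n; rewrite un /= leNgt; apply/negP => /nmin.
by rewrite ltnn.
Qed.

Lemma YP z : Y z -> [\/ Din z, exists k n, source k n z |
  exists k n, source k n (z - trans k n)].
Proof.
move=> /puncturedP[?|[k [n [sz|[w sw ->]]]]]; first exact: Or31.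
  by apply: Or32; exists k, n.
by apply: Or33; exists k, n; rewrite addrK.
Qed.

Lemma Y_top x : Y (x +i* 1) -> exists2 n, 1 - u n < x < 1 - u n / 2 & x <> 1 - 3 / 4 * u n.
Proof.
move=> /YP[[[|]|] [/= /andP[? ?] /andP[? ?]]|[k [n s]]|[k [n s]]]; try (exfalso; lra).
  have u0 := u_gt0 R n; have u1 := u_le1 R n.
  case: k s => //= -[? ?]; try (exfalso; lra); exists n; try lra;
  by lra.
have u0 := u_gt0 R n; have u1 := u_le1 R n; have pn := u_parity R n.
case: k s => //=; rewrite /gap; case on: (odd n) pn => pn; case => ? ?; exfalso; lra.
Qed.

Lemma Y_right y : 1 / 2 <= y -> Y (1 +i* y) -> exists n, 1 - u n / 2 < y < 1 - u n / 4.
Proof.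
move=> y0 /YP[[[|]|] [/= /andP[? ?] /andP[? ?]]|[k [n s]]|[k [n s]]]; try (exfalso; lra).
  have u0 := u_gt0 R n; have u1 := u_le1 R n.
  by case: k s => //= -[? ?]; try (exfalso; lra); exists n.
have u0 := u_gt0 R n; have u1 := u_le1 R n; have pn := u_parity R n.
case: k s => //=; rewrite /gap; case on: (odd n) pn => pn; case => ? ?; exfalso; lra.
Qed.

Lemma Y_left y : 1 / 2 <= y -> Y (0 +i* y) -> exists n,
  (odd n /\ 2 / 3 - u n / 3 < y < 2 / 3 - u n / 12) \/
  (~~ odd n /\ 2 / 3 + u n / 12 < y < 2 / 3 + u n / 3).
Proof.
move=> y0 /YP[[[|]|] [/= /andP[? ?] /andP[? ?]]|[k [n s]]|[k [n s]]]; try (exfalso; lra).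
  have u0 := u_gt0 R n; have u1 := u_le1 R n.
  by case: k s => //= -[? ?]; try (exfalso; lra).
have u0 := u_gt0 R n; have u1 := u_le1 R n; have pn := u_parity R n; exists n.
case: k s => //=; rewrite /gap; case on: (odd n) pn => pn; case => ? ?; try (exfalso; lra).
  by left; split => //; lra.
by right; split => //; lra.
Qed.

(* The vertices that are not accumulated by others: [vt], [vm] on the top side,
   [vr] on the right side; the orientation-reversing involution maps [vt], [vm],
   [vr] to [vb], [vk], [vr'], and exchanges [vl] and [vl']. *)
Definition vt n : C := (1 - u n) +i* 1.
Definition vm n : C := (1 - 3 / 4 * u n) +i* 1.
Definition vr n : C := 1 +i* (1 - u n / 2).
Definition vl n : C :=
  if odd n then 0 +i* (2 / 3 - u n / 3) else (- (1 / 2)) +i* (1 / 3 - u n / 3).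
Definition vr' n : C := (1 / 2) +i* (u n / 2).
Definition vl' n : C :=
  if odd n then (- (1 / 2)) +i* (1 / 3 + u n / 3) else 0 +i* (2 / 3 + u n / 3).
Definition vb n : C := (1 / 2 - u n) +i* 0.
Definition vk n : C := (1 / 2 - 3 / 4 * u n) +i* 0.

Definition vertex (v : C) := D v /\ ~ Y v.

Lemma rho_Y i p : Y p -> rho_piece i p -> Y (rho_map i p).
Proof. by have [rho h] := rho_exists R => Yp Pp; have [] := h i p Yp Pp. Qed.

Lemma rho_map_piece i (p : C) : rho_piece i p -> rho_piece (~~ i) (rho_map i p).
Proof.
by case: i => -[/= /andP[? ?] /andP[? ?]]; split => /=; lra.
Qed.

Lemma rho_mapK i (p : C) : rho_map (~~ i) (rho_map i p) = p.
Proof. by case: p => a b; case: i; apply: cplxE => /=; lra. Qed.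

Lemma rho_piece_D i (p : C) : rho_piece i p -> D p.
Proof. by case: i; [left|right]. Qed.

(** [rho_map] preserves [Y] and undoes itself, so a removed point cannot be sent into [Y]. Thus only
    the upper rectangle has to be examined directly. *)
Lemma vertex_rho i p : vertex p -> rho_piece i p -> vertex (rho_map i p).
Proof.
move=> [Dp nYp] Pp; have Pq := rho_map_piece Pp; split; first exact: rho_piece_D Pq.
by move=> Yq; apply: nYp; rewrite -(rho_mapK i p); exact: rho_Y.
Qed.

Lemma vertex_vt n : vertex (vt n).
Proof.
have u0 := u_gt0 R n; have u1 := u_le1 R n; split.
  by left; split => /=; lra.
move=> /Y_top[m /andP[? ?] _]; have um := u_gt0 R m.
by case: (u_cmp R m n) => [?|[|] ?]; [subst m|..]; lra.
Qed.

Lemma vertex_vm n : vertex (vm n).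
Proof.
have u0 := u_gt0 R n; have u1 := u_le1 R n; split.
  by left; split => /=; lra.
move=> /Y_top[m /andP[? ?] ne]; have um := u_gt0 R m.
by case: (u_cmp R m n) => [?|[|] ?]; [subst m|..]; lra.
Qed.

Lemma vertex_vr n : vertex (vr n).
Proof.
have u0 := u_gt0 R n; have u1 := u_le1 R n; split.
  by left; split => /=; lra.
move=> /Y_right[|m /andP[? ?]]; first by lra.
have um := u_gt0 R m; case: (u_cmp R m n) => [?|[|] ?]; [subst m|..]; lra.
Qed.

Lemma vertex_vl_odd n : odd n -> vertex (vl n).
Proof.
move=> on; have u0 := u_gt0 R n; have u1 := u_parity R n; rewrite on in u1.
rewrite /vl on; split; first by left; split => /=; lra.
move=> /Y_left[|m [[om]|[om]] /andP[? ?]]; first by lra.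
  have um := u_gt0 R m; case: (@u_cmp_parity R m n) => [|?|[|] ?]; [by rewrite om on|subst m|..]; lra.
by have um := u_gt0 R m; lra.
Qed.

Lemma vertex_vl'_even n : ~~ odd n -> vertex (vl' n).
Proof.
move=> on; have u0 := u_gt0 R n; have u1 := u_le1 R n.
rewrite /vl' (negbTE on); split; first by left; split => /=; lra.
move=> /Y_left[|m [[om]|[om]] /andP[? ?]]; first by lra.
  by have um := u_gt0 R m; lra.
have um := u_gt0 R m; case: (@u_cmp_parity R m n) => [|?|[|] ?];
  [by rewrite (negbTE om) (negbTE on)|subst m|..]; lra.
Qed.

Lemma vertex_corner : vertex (1 +i* 1).
Proof.
split; first by left; split => /=; lra.
by move=> /Y_top[m /andP[? ?] _]; have := u_gt0 R m; lra.
Qed.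

Lemma vertex_left : vertex (0 +i* (2 / 3)).
Proof.
split; first by left; split => /=; lra.
by move=> /Y_left[|m [[om]|[om]] /andP[? ?]]; [lra|..]; have := u_gt0 R m; lra.
Qed.

(** [vr' 0] is the reentrant corner (1/2, 1/2); the points (0, 1/2) and (1, 1/2) occur as [vl 1] and
    [vr 0]. *)
Definition upper_vertex z := (exists n, [\/ z = vt n, z = vm n | z = vr n]) \/
  (exists2 n, odd n & z = vl n) \/ (exists2 n, ~~ odd n & z = vl' n) \/
  z = 1 +i* 1 \/ z = 0 +i* (2 / 3) \/ z = vr' 0.

(** On each side with infinitely many edges, the distance to the accumulation point is placed
    between two powers of 1/2, which designates an edge. Points of an open edge are in [Y], so only
    end points remain. *)
Lemma upper_vertexP z : vertex z -> rho_piece true z -> upper_vertex z.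
Proof.
case: z => x y [_ nY] [/= /andP[x0 x1] /andP[y0 y1]].
have [y1'|y1'] := eqVneq y 1.
  have [->|x1'] := eqVneq x 1; first by right; right; right; left; rewrite y1'.
  have [|n /andP[n1 n2]] := @dyadic (1 - x).
    by rewrite subr_gt0 lt_neqAle x1' x1 /=; lra.
  rewrite uS in n1; left; exists n.
  have un := u_gt0 R n.
  have [e|ne] := eqVneq (1 - x) (u n).
    by apply: Or31; apply: cplxE; lra.
  have {ne}n2 : 1 - x < u n by rewrite lt_neqAle ne.
  case: (ltrgtP x (1 - 3 / 4 * u n)) => h.
  - by case: nY; apply: (@source_Yl _ TopL n); split => //=; lra.
  - by case: nY; apply: (@source_Yl _ TopR n); split => //=; lra.
  - by apply: Or32; apply: cplxE.
have {}y1 : y < 1 by rewrite lt_neqAle y1'.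
have [e1|x1'] := eqVneq x 1.
  rewrite {}e1 in nY *.
  have [|n /andP[n1 n2]] := @dyadic (2 * (1 - y)); first lra.
  rewrite uS in n1; left; exists n; apply: Or33.
  have [e|ne] := eqVneq (2 * (1 - y)) (u n); first by apply: cplxE; lra.
  have {ne}n2 : 2 * (1 - y) < u n by rewrite lt_neqAle ne.
  by case: nY; apply: (@source_Yl _ SideA n); split => //=; lra.
have {}x1 : x < 1 by rewrite lt_neqAle x1'.
have [x0'|x0'] := eqVneq x 0.
  rewrite {}x0' in nY *.
  case: (ltrgtP y (2 / 3)) => h; last by right; right; right; right; left; rewrite h.
    have [|n /andP[n1 n2]] := @dyadic (2 - 3 * y); first lra.
    rewrite uS in n1.
    case on: (odd n).
      have [e|ne] := eqVneq (2 - 3 * y) (u n).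
        by right; left; exists n => //; rewrite /vl on; apply: cplxE; lra.
      have {ne}n2 : 2 - 3 * y < u n by rewrite lt_neqAle ne.
      by case: nY; apply: (@source_Yr _ SideA n); rewrite /= /gap on;
        split => /=; lra.
    (* A target on this side spans two dyadic intervals; in the second one the edge has the
       preceding index, which is odd. *)
    case: n on n1 n2 => [_|n /= /negbFE on]; first by rewrite u0; lra.
    have un := u_gt0 R n; rewrite uS => ? ?.
    by case: nY; apply: (@source_Yr _ SideA n); rewrite /= /gap on;
      split => /=; lra.
  have [|n /andP[n1 n2]] := @dyadic (3 * y - 2); first lra.
  rewrite uS in n1; case on: (odd n); last first.
    have [e|ne] := eqVneq (3 * y - 2) (u n).
      by right; right; left; exists n; rewrite ?on // /vl' on; apply: cplxE; lra.
    have {ne}n2 : 3 * y - 2 < u n by rewrite lt_neqAle ne.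
    by case: nY; apply: (@source_Yr _ SideB n); rewrite /= /gap on;
      split => /=; lra.
  case: n on n1 n2 => [//|n /= /negbTE on].
  have un := u_gt0 R n; rewrite uS => ? ?.
  by case: nY; apply: (@source_Yr _ SideB n); rewrite /= /gap on;
    split => /=; lra.
have {x0'}x0 : 0 < x by rewrite lt_neqAle eq_sym x0'.
have [y0'|y0'] := eqVneq y (1 / 2); last first.
  have {}y0 : 1 / 2 < y by rewrite lt_neqAle eq_sym y0'.
  by case: nY; apply: Din_Y; left; right; split; apply/andP.
rewrite {}y0' in nY *.
case: (ltrgtP x (1 / 2)) => h.
- by case: nY; apply: Din_Y; right; split => /=; lra.
- by case: nY; apply: (@source_Yr _ Slit 0); split => /=; lra.
- by do 5!right; apply: cplxE; rewrite ?u0; lra.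
Qed.

Variable r : R.
Hypothesis r0 : 0 < r.

Definition near_vertices : set X :=
  [set x | exists2 v, vertex v & exists p, [/\ Y p, square r v p & toX p = x]].

Definition linked (v w : C) := forall p q, Y p -> square r v p ->
  Y q -> square r w q -> connected_component near_vertices (toX p) (toX q).

Lemma near_vertex v p : vertex v -> Y p -> square r v p -> near_vertices (toX p).
Proof. by move=> Vv Yp vp; exists v => //; exists p. Qed.

Lemma square_nonempty s v : 0 < s -> D v -> exists2 p, Y p & square s v p.
Proof.
move=> s0 Dv; have [p vp [[bp _]|[bp _]]] := push_in Dv (square_center v s0); exists p => //.
  by apply: Din_Y; exact: Low_Din.
by apply: Din_Y; exact: Up_Din.
Qed.

Lemma linked_refl v : vertex v -> linked v v.
Proof.
move=> Vv p q Yp vp Yq vq; apply: (@square_component _ _ r v) => //.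
by move=> z Yz vz; exact: near_vertex vz.
Qed.

Lemma linked_sym v w : linked v w -> linked w v.
Proof. by move=> vw p q ? ? ? ?; apply: connected_component_sym; exact: vw. Qed.

Lemma linked_trans w v v' : D w -> linked v w -> linked w v' -> linked v v'.
Proof.
move=> Dw vw wv' p q Yp vp Yq vq; have [m Ym wm] := square_nonempty r0 Dw.
by apply: connected_component_trans (wv' m q _ _ _ _) => //; exact: vw.
Qed.

Lemma linked_meet v w p q : vertex v -> vertex w -> Y p -> Y q ->
  square r v p -> square r w q -> toX p = toX q -> linked v w.
Proof.
move=> Vv Vw Yp Yq vp wq e p' q' Yp' vp' Yq' wq'.
apply: (@connected_component_trans _ _ (toX p)); first exact: (linked_refl Vv).
by rewrite e; exact: (linked_refl Vw).
Qed.

Lemma linked_near v w : vertex v -> vertex w -> square r w v -> linked v w.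
Proof.
move=> Vv Vw wv.
have : nbhs v (square r w `&` square r v).
  apply: open_nbhs_nbhs; split; first by apply: openI; exact: square_open.
  by split=> //; exact: square_center.
move=> /nbhs_squareP[s s0 sw].
have [p Yp vp] := square_nonempty s0 Vv.1; have [wp vp'] := sw _ vp.
exact: (@linked_meet v w p p).
Qed.

(** A point of the edge close to its end [v] is glued to a point equally close to [w], so the two
    neighbourhoods meet in the surface. *)
Lemma linked_edge k n v w p : vertex v -> vertex w -> source k n p -> square r v p ->
  w = v + trans k n -> linked v w.
Proof.
move=> Vv Vw sp vp e; have [Yp Yq] := source_Y sp.
apply: (@linked_meet v w p (p + trans k n)) => //.
  by rewrite e; apply/square_shift.
by apply/toX_eqP => //; apply: Or32; apply/glueP; exists k, n.
Qed.

Lemma small_step (a : R) : 0 < a -> exists d, [/\ 0 < d, d < a & d < r].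
Proof.
move=> a0; exists (Num.min a r / 2).
have m0 : 0 < Num.min a r by rewrite lt_min a0.
have m1 : Num.min a r <= a by rewrite ge_min lexx.
have m2 : Num.min a r <= r by rewrite ge_min lexx orbT.
by split; lra.
Qed.

Lemma rho_vt n : rho_map true (vt n) = vb n.
Proof. by apply: cplxE => /=; lra. Qed.
Lemma rho_vm n : rho_map true (vm n) = vk n.
Proof. by apply: cplxE => /=; lra. Qed.
Lemma rho_vr n : rho_map true (vr n) = vr' n.
Proof. by apply: cplxE => /=; lra. Qed.
Lemma rho_vl n : odd n -> rho_map true (vl n) = vl' n.
Proof. by move=> on; rewrite /vl /vl' on; apply: cplxE => /=; lra. Qed.
Lemma rho_vl' n : ~~ odd n -> rho_map true (vl' n) = vl n.
Proof. by move=> on; rewrite /vl /vl' (negbTE on); apply: cplxE => /=; lra. Qed.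

Ltac in_upper n := have := u_gt0 R n; have := u_parity R n; have := u_le1 R n; move=> ? ? ?;
  split => /=; lra.

Lemma vertex_vb n : vertex (vb n).
Proof. by rewrite -rho_vt; apply: vertex_rho; [exact: vertex_vt|in_upper n]. Qed.
Lemma vertex_vk n : vertex (vk n).
Proof. by rewrite -rho_vm; apply: vertex_rho; [exact: vertex_vm|in_upper n]. Qed.
Lemma vertex_vr' n : vertex (vr' n).
Proof. by rewrite -rho_vr; apply: vertex_rho; [exact: vertex_vr|in_upper n]. Qed.

Lemma vertex_vl n : vertex (vl n).
Proof.
have [on|on] := boolP (odd n); first exact: vertex_vl_odd.
rewrite -rho_vl'//; apply: vertex_rho; first exact: vertex_vl'_even.
by rewrite /vl' (negbTE on); in_upper n.
Qed.

Lemma vertex_vl' n : vertex (vl' n).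
Proof.
have [on|on] := boolP (odd n); last exact: vertex_vl'_even.
rewrite -rho_vl//; apply: vertex_rho; first exact: vertex_vl_odd.
have := u_gt0 R n; have := u_parity R n; rewrite /vl on => ? ?.
by split => /=; lra.
Qed.

Lemma vertex_corner' : vertex ((1 / 2) +i* 0).
Proof.
have -> : (1 / 2) +i* 0 = rho_map true (1 +i* 1) :> C by apply: cplxE => /=; lra.
by apply: vertex_rho; [exact: vertex_corner|split => /=; lra].
Qed.

Lemma vertex_left' : vertex ((- (1 / 2)) +i* (1 / 3)).
Proof.
have -> : (- (1 / 2)) +i* (1 / 3) = rho_map true (0 +i* (2 / 3)) :> C by apply: cplxE => /=; lra.
by apply: vertex_rho; [exact: vertex_left|split => /=; lra].
Qed.

Ltac near_point := apply/squareP; split => /=; lra.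

Lemma linked_lr n : linked (vr n) (vl n).
Proof.
have un := u_gt0 R n; have [|d [d0 d1 dr]] := @small_step (u n / 4); first lra.
apply: (@linked_edge SideA n _ _ (1 +i* (1 - u n / 2 + d))).
- exact: vertex_vr.
- exact: vertex_vl.
- by split => //=; lra.
- by near_point.
- by rewrite /vl /= /gap; case: (odd n); apply: cplxE; lra.
Qed.

(** The upper end of [SideA n] is [vr n.+1]. Its image has index [n.+2] because targets of the same
    parity are adjacent on the left side. *)
Lemma linked_rl n : linked (vr n.+1) (vl n.+2).
Proof.
have un := u_gt0 R n; have [|d [d0 d1 dr]] := @small_step (u n / 4); first lra.
apply: (@linked_edge SideA n _ _ (1 +i* (1 - u n / 4 - d))).
- exact: vertex_vr.
- exact: vertex_vl.
- by split => //=; lra.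
- by rewrite /vr uS; near_point.
- by rewrite /vl /vr /= negbK !uS /gap; case: (odd n); apply: cplxE; lra.
Qed.

(** The right end (0, 1/2) of the slit is [vl 1], glued to (1, 1/2). It supplies the link between
    indices 0 and 1, which [linked_rl] does not give. *)
Lemma linked_slit : linked (vl 1) (vr 0).
Proof.
have [|d [d0 d1 dr]] := @small_step (1 / 2); first lra.
have e : vl 1 = 0 +i* (1 / 2) by rewrite /vl /= uS u0; apply: cplxE; lra.
apply: (@linked_edge Slit 0 _ _ ((- d) +i* (1 / 2))).
- exact: vertex_vl.
- exact: vertex_vr.
- by split => //=; lra.
- by rewrite e; near_point.
- by rewrite e /vr u0; apply: cplxE; lra.
Qed.

Lemma linked_lr' n : linked (vr' n) (vl' n).
Proof.
have un := u_gt0 R n; have [|d [d0 d1 dr]] := @small_step (u n / 4); first lra.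
apply: (@linked_edge SideB n _ _ ((1 / 2) +i* (u n / 2 - d))).
- exact: vertex_vr'.
- exact: vertex_vl'.
- by split => //=; lra.
- by near_point.
- by rewrite /vl' /= /gap; case: (odd n); apply: cplxE; lra.
Qed.

Lemma linked_rl' n : linked (vr' n.+1) (vl' n.+2).
Proof.
have un := u_gt0 R n; have [|d [d0 d1 dr]] := @small_step (u n / 4); first lra.
apply: (@linked_edge SideB n _ _ ((1 / 2) +i* (u n / 4 + d))).
- exact: vertex_vr'.
- exact: vertex_vl'.
- by split => //=; lra.
- by rewrite /vr' uS; near_point.
- by rewrite /vl' /vr' /= negbK !uS /gap; case: (odd n); apply: cplxE; lra.
Qed.

Lemma linked_slit' : linked (vl' 1) (vr' 0).
Proof.
have [|d [d0 d1 dr]] := @small_step (1 / 2); first lra.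
have e : vl' 1 = (- (1 / 2)) +i* (1 / 2) by rewrite /vl' /= uS u0; apply: cplxE; lra.
apply: (@linked_edge Slit 0 _ _ ((- (1 / 2) + d) +i* (1 / 2))).
- exact: vertex_vl'.
- exact: vertex_vr'.
- by split => //=; lra.
- by rewrite e; near_point.
- by rewrite e /vr' u0; apply: cplxE; lra.
Qed.

Lemma linked_tk n : linked (vt n) (vk n).
Proof.
have un := u_gt0 R n; have [|d [d0 d1 dr]] := @small_step (u n / 4); first lra.
apply: (@linked_edge TopL n _ _ ((1 - u n + d) +i* 1)).
- exact: vertex_vt.
- exact: vertex_vk.
- by split => //=; lra.
- by near_point.
- by apply: cplxE; lra.
Qed.

Lemma linked_kt n : linked (vt n.+1) (vk n).
Proof.
have un := u_gt0 R n; have [|d [d0 d1 dr]] := @small_step (u n / 4); first lra.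
apply: (@linked_edge TopR n _ _ ((1 - u n / 2 - d) +i* 1)).
- exact: vertex_vt.
- exact: vertex_vk.
- by split => //=; lra.
- by rewrite /vt uS; near_point.
- by rewrite /vt uS; apply: cplxE; lra.
Qed.

Lemma linked_mb n : linked (vm n) (vb n).
Proof.
have un := u_gt0 R n; have [|d [d0 d1 dr]] := @small_step (u n / 4); first lra.
apply: (@linked_edge TopR n _ _ ((1 - 3 / 4 * u n + d) +i* 1)).
- exact: vertex_vm.
- exact: vertex_vb.
- by split => //=; lra.
- by near_point.
- by apply: cplxE; lra.
Qed.

Lemma linked_bm n : linked (vm n) (vb n.+1).
Proof.
have un := u_gt0 R n; have [|d [d0 d1 dr]] := @small_step (u n / 4); first lra.
apply: (@linked_edge TopL n _ _ ((1 - 3 / 4 * u n - d) +i* 1)).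
- exact: vertex_vm.
- exact: vertex_vb.
- by split => //=; lra.
- by near_point.
- by rewrite /vb uS; apply: cplxE; lra.
Qed.

Let base : C := vl 0.
Let ends_at v := linked v base.

Lemma ends_trans w v : D w -> linked v w -> ends_at w -> ends_at v.
Proof. exact: linked_trans. Qed.

Lemma ends_vlr n : ends_at (vl n) /\ ends_at (vr n).
Proof.
have lr m : ends_at (vl m) -> ends_at (vr m).
  by move=> h; apply: (@ends_trans (vl m)) => //; [have [] := vertex_vl m|exact: linked_lr].
have rl m : ends_at (vr m) -> ends_at (vl m.+1).
  move=> h; apply: (@ends_trans (vr m)) => //; first by have [] := vertex_vr m.
  by case: m {h} => [|m]; [exact: linked_slit|apply: linked_sym; exact: linked_rl].
elim: n => [|n [_ /rl ih]]; last by split=> //; exact: lr.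
have h0 : ends_at (vl 0) by exact/linked_refl/vertex_vl.
by split=> //; exact: lr.
Qed.

Lemma ends_vbm n : ends_at (vb n) /\ ends_at (vm n).
Proof.
have bm m : ends_at (vb m) -> ends_at (vm m).
  by move=> h; apply: (@ends_trans (vb m)) => //; [have [] := vertex_vb m|exact: linked_mb].
have mb m : ends_at (vm m) -> ends_at (vb m.+1).
  move=> h; apply: (@ends_trans (vm m)) => //; first by have [] := vertex_vm m.
  by apply: linked_sym; exact: linked_bm.
elim: n => [|n [_ /mb ih]]; last by split=> //; exact: bm.
have h0 : ends_at (vb 0).
  (* The second chain starts at the same corner (-1/2, 0) as the first. *)
  have -> : vb 0 = vl 0 by rewrite /vb /vl /= u0; apply: cplxE; lra.
  exact/linked_refl/vertex_vl.
by split=> //; exact: bm.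
Qed.

Lemma ends_corner : ends_at (1 +i* 1).
Proof.
have [n nr] := u_small r0; have un := u_gt0 R n.
apply: (@ends_trans (vr n)); [by have [] := vertex_vr n| |by have [] := ends_vlr n].
apply: linked_sym; apply: linked_near; [exact: vertex_vr|exact: vertex_corner|by near_point].
Qed.

Lemma linked_tt m n : linked (vt m) (vt n).
Proof.
suff h k : linked (vt k) (vt 0).
  by apply: linked_trans (h m) _; [have [] := vertex_vt 0|apply: linked_sym].
elim: k => [|k ih]; first exact/linked_refl/vertex_vt.
apply: linked_trans ih; first by have [] := vertex_vt k.
apply: (@linked_trans (vk k)); [by have [] := vertex_vk k|exact: linked_kt|].
by apply: linked_sym; exact: linked_tk.
Qed.

(** The chain of [vt] and [vk] is reached through the corner (1, 1), where both the [vr] and the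
    [vt] accumulate: for large [m] the neighbourhood of [vt m] meets that of the corner. *)
Lemma ends_vt n : ends_at (vt n).
Proof.
have [m mr] := u_small r0; have um := u_gt0 R m.
apply: (@ends_trans (vt m)); [by have [] := vertex_vt m|exact: linked_tt|].
apply: (ends_trans _ _ ends_corner); first by have [] := vertex_corner.
apply: linked_near; [exact: vertex_vt|exact: vertex_corner|by near_point].
Qed.

Lemma ends_vk n : ends_at (vk n).
Proof.
apply: (@ends_trans (vt n)); [by have [] := vertex_vt n| |exact: ends_vt].
by apply: linked_sym; exact: linked_tk.
Qed.

Lemma ends_vlr' n : ends_at (vl' n) /\ ends_at (vr' n).
Proof.
have lr m : ends_at (vl' m) -> ends_at (vr' m).
  by move=> h; apply: (@ends_trans (vl' m)) => //; [have [] := vertex_vl' m|exact: linked_lr'].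
have rl m : ends_at (vr' m) -> ends_at (vl' m.+1).
  move=> h; apply: (@ends_trans (vr' m)) => //; first by have [] := vertex_vr' m.
  by case: m {h} => [|m]; [exact: linked_slit'|apply: linked_sym; exact: linked_rl'].
elim: n => [|n [_ /rl ih]]; last by split=> //; exact: lr.
have h0 : ends_at (vl' 0).
  (* The last chain starts at (0, 1), which belongs to the chain just reached. *)
  have -> : vl' 0 = vt 0 by rewrite /vl' /vt /= u0; apply: cplxE; lra.
  exact: ends_vt.
by split=> //; exact: lr.
Qed.

Lemma ends_left : ends_at (0 +i* (2 / 3)).
Proof.
have [n nr] := u_small r0; have un := u_gt0 R n; have un1 := uS R n.
have un2 := uS R n.+1.
(* Only the [vl m] with [m] odd lie on the side of abscissa 0. *)
pose m := if odd n then n else n.+1.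
have om : odd m by rewrite /m; case on: (odd n) => //=; rewrite on.
have um : u m <= u n by rewrite /m; case: (odd n); lra.
have um0 := u_gt0 R m.
apply: (@ends_trans (vl m)); [by have [] := vertex_vl m| |by have [] := ends_vlr m].
apply: linked_sym; apply: linked_near; [exact: vertex_vl|exact: vertex_left|].
by rewrite /vl om; near_point.
Qed.

Lemma ends_left' : ends_at ((- (1 / 2)) +i* (1 / 3)).
Proof.
have [n nr] := u_small r0; have un := u_gt0 R n; have un1 := uS R n.
pose m := if odd n then n.+1 else n.
have om : ~~ odd m by rewrite /m; case on: (odd n) => //=; rewrite ?on.
have um : u m <= u n by rewrite /m; case: (odd n); lra.
have um0 := u_gt0 R m.
apply: (@ends_trans (vl m)); [by have [] := vertex_vl m| |by have [] := ends_vlr m].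
apply: linked_sym; apply: linked_near; [exact: vertex_vl|exact: vertex_left'|].
by rewrite /vl (negbTE om); near_point.
Qed.

Lemma ends_corner' : ends_at ((1 / 2) +i* 0).
Proof.
have [n nr] := u_small r0; have un := u_gt0 R n.
apply: (@ends_trans (vb n)); [by have [] := vertex_vb n| |by have [] := ends_vbm n].
apply: linked_sym; apply: linked_near; [exact: vertex_vb|exact: vertex_corner'|by near_point].
Qed.

Lemma ends_vertex v : vertex v -> ends_at v.
Proof.
move=> Vv; case: (Vv) => -[] vp _.
  case: (@upper_vertexP v Vv vp) => [[n [->|->|->]]|[[n _ ->]|[[n _ ->]|[->|[->|->]]]]].
  - exact: ends_vt.
  - by have [] := ends_vbm n.
  - by have [] := ends_vlr n.
  - by have [] := ends_vlr n.
  - by have [] := ends_vlr' n.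
  - exact: ends_corner.
  - exact: ends_left.
  - by have [] := ends_vlr' 0.
have vf : rho_piece false v by [].
have Vw := vertex_rho Vv vf; have wp := rho_map_piece vf.
have e := rho_mapK false v; rewrite -e.
case: (@upper_vertexP _ Vw wp) => [[n [->|->|->]]|[[n on ->]|[[n on ->]|[->|[->|->]]]]].
- by rewrite rho_vt; have [] := ends_vbm n.
- by rewrite rho_vm; exact: ends_vk.
- by rewrite rho_vr; have [] := ends_vlr' n.
- by rewrite rho_vl//; have [] := ends_vlr' n.
- by rewrite rho_vl'//; have [] := ends_vlr n.
- have -> : rho_map true (1 +i* 1) = (1 / 2) +i* 0 :> C by apply: cplxE => /=; lra.
  exact: ends_corner'.
- have -> : rho_map true (0 +i* (2 / 3)) = (- (1 / 2)) +i* (1 / 3) :> C by apply: cplxE => /=; lra.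
  exact: ends_left'.
- have -> : rho_map true (vr' 0) = vl 1 by rewrite /vr' /vl /= uS u0; apply: cplxE => /=; lra.
  by have [] := ends_vlr 1.
Qed.

Lemma near_vertices_connected : connected near_vertices.
Proof.
have Vb : vertex base := vertex_vl 0.
have [b Yb bb] := square_nonempty r0 Vb.1.
suff -> : near_vertices = connected_component near_vertices (toX b).
  exact: component_connected.
apply/seteqP; split=> [_ [v Vv [p [Yp vp <-]]]|x]; last exact: connected_component_sub.
by apply: connected_component_sym; exact: (ends_vertex Vv).
Qed.

End Vertices.

(** * Compact sets and uniqueness of the end *)

Section Ends.
Variable R : realType.
Local Notation C := R[i].
Local Notation D := (@polygon R).
Local Notation Y := (@punctured_polygon R).
Local Notation X := (Xinf R).
Local Notation box := (@box R).
Local Notation trans := (@trans R).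
Local Notation u := (@u R).

(** For positive [r] this set is closed, bounded and inside [Y], so its image is compact, and the
    complement of this image is contained in [near_vertices r]. *)
Definition far (r : R) : set C := [set z | D z /\ forall v, vertex v -> ~ square r v z].

Lemma far_closed r : closed (far r).
Proof.
rewrite -[X in closed X]setCK; apply: open_closedC; rewrite openE => z nz.
have [Dz|nDz] := pselect (D z).
  have [v Vv vz] : exists2 v, vertex v & square r v z.
    by apply: contrapT => h; apply: nz; split=> // v Vv vz; apply: h; exists v.
  have : nbhs z (square r v) by apply: open_nbhs_nbhs; split=> //; exact: square_open.
  by apply: filterS => w vw [_ /(_ v Vv)].
have : nbhs z (~` D).
  by apply: open_nbhs_nbhs; split=> //; apply: closed_openC; exact: polygon_closed.
by apply: filterS => w nDw [].
Qed.

Lemma crect_compact (a b c d : R) : compact (crect a b c d).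
Proof.
have -> : crect a b c d = (fun p : R * R => p.1 +i* p.2) @` (`[a, b] `*` `[c, d]).
  apply/seteqP; split=> [[x y] [/= xx yy]|_ [[x y] [/= xx yy] <-]].
    by exists (x, y) => //; split => /=; rewrite in_itv.
  by move: xx yy; rewrite !in_itv.
apply: continuous_compact; last by apply: compact_setX; exact: segment_compact.
apply: continuous_subspaceT => -[x y] A /nbhs_squareP[e e0 eA].
exists (ball x e, ball y e); first by split; exact: nbhsx_ballx.
move=> [x' y'] [/= xx yy]; apply: eA; split => /=; rewrite distrC.
  exact: xx.
exact: yy.
Qed.

Lemma polygon_crect : D `<=` crect (- 1) 1 0 1.
Proof.
by case=> x y [] [/= /andP[? ?] /andP[? ?]]; split => /=; lra.
Qed.

Lemma far_compact r : compact (far r).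
Proof.
apply: (subclosed_compact (@far_closed r) (@crect_compact (- 1) 1 0 1)).
by move=> z [/polygon_crect].
Qed.

Lemma far_Y r : 0 < r -> far r `<=` Y.
Proof.
move=> r0 z [Dz h]; apply: contrapT => nY.
by apply: (h z); [split|exact: square_center].
Qed.

Lemma image_compact (A : set C) : A `<=` Y -> compact A -> compact (@toX R @` A).
Proof.
move=> AY; apply: continuous_compact; apply/subspace_continuousP => t At V /=.
rewrite nbhsE => -[W [oW Wt] WV].
move/open_toXP: oW => /(_ _ (AY _ At) Wt) h.
rewrite /within /= !near_simpl; move: h; apply: filterS => s h' As.
by apply: WV; apply: h'; exact: AY.
Qed.

Lemma compact_far_image r : 0 < r -> compact (@toX R @` far r).
Proof. by move=> r0; apply: image_compact (@far_compact r); exact: far_Y. Qed.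

Lemma near_vertices_mono r s : r <= s -> near_vertices r `<=` @near_vertices R s.
Proof.
move=> rs x [v Vv [p [Yp vp <-]]]; exists v => //; exists p; split=> //.
exact: subset_square vp.
Qed.

Lemma near_vertices_nonempty r : 0 < r -> @near_vertices R r !=set0.
Proof.
move=> r0; have V := @vertex_corner R; have [p Yp vp] := square_nonempty r0 V.1.
by exists (toX p), (1 +i* 1) => //; exists p.
Qed.

Lemma far_cover r : ~` (@toX R @` far r) `<=` near_vertices r.
Proof.
move=> x nx; have [p Yp px] := toX_surj x.
have : ~ far r p by move=> fp; apply: nx; exists p.
move=> nf; apply: contrapT => h; apply: nf; split; first exact: Y_D.
by move=> v Vv vp; apply: h; exists v => //; exists p.
Qed.

Lemma compact_away (K : set X) : compact K ->
  exists2 r, 0 < r & near_vertices r `<=` ~` K.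
Proof.
(* Compactness in its near-covering form: a radius [u n] that works around each point of [K] yields
   one for all of [K]. *)
move=> /compact_near_coveringP /(_ nat \oo (fun n x => ~ near_vertices (u n) x) _) h.
have {h} : \forall n \near \oo, K `<=` (fun x => ~ near_vertices (u n) x).
  apply: h => x _; have [k [n [z kz <-]]] := bmap_surj x.
  have /nbhs_squareP[r r0 rb] : nbhs z (box k n).
    by apply: open_nbhs_nbhs; split=> //; exact: box_open.
  have r20 : 0 < r / 2 by lra.
  have [m mr] := u_small r20.
  exists (bmap k n @` (square (r / 2) z `&` box k n), [set i | (m <= i)%N]).
    split; last by exists m.
    apply: open_nbhs_nbhs; split; last by exists z => //; split=> //; exact: square_center.
    by apply: bmap_open; [move=> ? []|apply: openI; [exact: square_open|exact: box_open]].
  move=> [_ i] [[w [zw kw] <-] /= mi] [v [Dv nYv] [p [Yp vp e]]].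
  have ui : u i <= u m.
    by move: mi; rewrite leq_eqVlt => /predU1P[->//|/(@u_half R)]; have := u_gt0 R m; lra.
  have near_z (v' w' : C) : square (r / 2) z w' -> square (u i) v' w' -> square r z v'.
    move=> /squareP[/andP[? ?] /andP[? ?]] /squareP[/andP[? ?] /andP[? ?]].
    by apply/squareP; split; lra.
  (* A removed point this close would fall in the box or in its translate, whose points in D all
     belong to [Y]. *)
  case: (toX_bmap kw Yp e) => ep; rewrite ep in vp.
    by apply: nYv; apply: box_Y Dv; apply: rb; exact: near_z vp.
  apply: nYv; rewrite -(subrK (trans k n) v); apply: (@box_trans_Y _ k n).
    apply: rb; apply: near_z zw _.
    by apply/(square_shift _ _ _ (trans k n)); rewrite subrK.
  by rewrite subrK.
move=> [n _ /(_ n (leqnn n)) h]; exists (u n); first exact: u_gt0.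
by move=> x nx Kx; exact: h Kx nx.
Qed.

Lemma near_component (K : set X) r x y : 0 < r -> near_vertices r `<=` ~` K ->
  near_vertices r x -> near_vertices r y -> connected_component (~` K) x y.
Proof.
move=> r0 rK rx ry; apply: (connected_component_max rx) => //.
exact: near_vertices_connected.
Qed.

Lemma Xinf_one_end : exactly_one_end X.
Proof.
(* The implication is inside the existential so that [choice] gives a function on all sets, with
   arbitrary values on non compact ones. *)
have ex (K : set X) : exists x, compact K ->
    exists r, [/\ 0 < r, near_vertices r `<=` ~` K & near_vertices r x].
  have [cK|] := pselect (compact K); last by exists point.
  have [r r0 rK] := compact_away cK; have [x rx] := near_vertices_nonempty r0.
  by exists x => _; exists r.
have [f hf] := choice ex.
split.
  exists (fun K => connected_component (~` K) (f K)); split.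
    move=> K /hf[r [r0 rK rf]]; exists (f K) => //; exact: rK.
  move=> K L cK cL KL y Ly.
  have [r [r0 rK rf]] := hf K cK; have [s [s0 sL sf]] := hf L cL.
  pose t := Num.min r s.
  have t0 : 0 < t by rewrite lt_min r0.
  have [x tx] := near_vertices_nonempty t0.
  have rx : near_vertices r x by apply: near_vertices_mono tx; rewrite ge_min lexx.
  have sx : near_vertices s x by apply: near_vertices_mono tx; rewrite ge_min lexx orbT.
  apply: (@connected_component_trans _ _ x); first exact: near_component rf rx.
  have : connected_component (~` L) x y.
    apply: connected_component_trans Ly; apply: connected_component_sym.
    exact: near_component sf sx.
  move=> [B [Bx BL cB] By]; exists B => //; split=> // z Bz Kz.
  by apply: (BL z Bz); exact: KL.
have main (e : set X -> set X) (K : set X) (r : R) (x : X) : is_end e -> compact K -> 0 < r -> near_vertices r `<=` ~` K ->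
    near_vertices r x -> e K = connected_component (~` K) x.
  move=> [e1 e2] cK r0 rK rx.
  (* On this larger compact set the end is a component inside [near_vertices r], which is connected
     and avoids [K]; monotonicity then determines its value on [K]. *)
  have cL : compact (@toX R @` far r `|` K) by apply: compactU => //; exact: compact_far_image.
  have [y nLy ey] := e1 _ cL.
  have [z nKz ez] := e1 _ cK.
  have ry : near_vertices r y by apply: far_cover => h; apply: nLy; left.
  have : e K y.
    apply: (e2 _ _ cK cL); first by move=> w; right.
    by rewrite ey; exact: connected_component_refl.
  rewrite ez => /same_connected_component ->.
  by apply: same_connected_component; exact: near_component ry rx.
move=> e1 e2 he1 he2 K cK; have [r r0 rK] := compact_away cK.
have [x rx] := near_vertices_nonempty r0.
by rewrite (main e1 K r x)// (main e2 K r x).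
Qed.

End Ends.

(** * Area *)

Section PushMeasure.
Context d1 d2 (T1 : measurableType d1) (T2 : measurableType d2) (R : realType).
Variables (m : {measure set T1 -> \bar R}) (E : set T1) (f : T1 -> T2).
Hypotheses (mE : measurable E) (mf : measurable_fun E f).

(** Intersecting with [E] allows a map that is only measurable there, such as [toX], which takes a
    default value outside [Y]. *)
Lemma push_measure_exists : exists mu : {measure set T2 -> \bar R},
  forall B, mu B = m (E `&` f @^-1` B).
Proof.
pose nu (B : set T2) := m (E `&` f @^-1` B).
have nu0 : nu set0 = 0%E by rewrite /nu preimage_set0 setI0 measure0.
have nu_ge0 B : (0 <= nu B)%E by exact: measure_ge0.
have nu_add : semi_sigma_additive nu.
  move=> F mF tF mUF; rewrite /nu preimage_bigcup setI_bigcupr.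
  apply: measure_semi_sigma_additive.
  - by move=> n; exact: mf.
  - apply/trivIsetP => i j _ _ ij; apply/seteqP; split=> // x [[_ Fi] [_ Fj]].
    have : (F i `&` F j) (f x) by [].
    by move/trivIsetP : tF => /(_ i j I I ij) ->.
  - by rewrite -setI_bigcupr -preimage_bigcup; exact: mf.
pose M := isMeasure.Build _ T2 R nu nu0 nu_ge0 nu_add.
pose mu : {measure set T2 -> \bar R} := HB.pack nu M.
by exists mu.
Qed.

End PushMeasure.

Section Plane.
Variable R : realType.
Local Notation C := R[i].
Local Notation mR := (measurableTypeR R).
Local Notation plane := (mR * mR)%type.
Local Notation area := ((@lebesgue_measure R \x @lebesgue_measure R)%E : set plane -> \bar R).

Lemma measurable_translate (a : R) : measurable_fun [set: mR] (fun x : mR => (x + a : mR)).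
Proof.
apply: continuous_measurable_fun => x.
by apply: cvgD; [exact: cvg_id|exact: cvg_cst].
Qed.

(** By uniqueness of Lebesgue measure: the translated measure has the same values on half-open
    intervals. The planar version uses products of measurable sets in the same way. *)
Lemma lebesgue_translate (a : R) (A : set mR) : measurable A ->
  lebesgue_measure ((fun x : mR => x + a) @^-1` A) = lebesgue_measure A.
Proof.
move=> mA; have mf : measurable_fun [set: mR] (fun x : mR => (x + a : mR)).
  exact: measurable_translate.
have [mu hmu] := push_measure_exists (@lebesgue_measure R) measurableT mf.
rewrite (@lebesgue_measure_unique R mu _ A mA) ?hmu ?setTI// => _ [[b c] _ <-].
rewrite hmu setTI /=.
have -> : (fun x : mR => x + a) @^-1` `]b, c] = (`](b - a), (c - a)]%classic : set mR).
  apply/seteqP; split=> x /=; rewrite !in_itv /= => /andP[? ?]; lra.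
rewrite !lebesgue_measure_itv /= !lte_fin ltrD2r; case: ifP => // _.
by rewrite -!EFinD; congr EFin; ring.
Qed.

Lemma area_translate (a b : R) (A : set plane) : measurable A ->
  area ((fun p : plane => (p.1 + a, p.2 + b)) @^-1` A) = area A.
Proof.
move=> mA; pose f (p : plane) : plane := (p.1 + a, p.2 + b).
have mf : measurable_fun [set: plane] f.
  apply: measurable_fun_pair => /=.
    exact: measurableT_comp (measurable_translate a) measurable_fst.
  exact: measurableT_comp (measurable_translate b) measurable_snd.
have [mu hmu] := push_measure_exists (@lebesgue_measure R \x @lebesgue_measure R)%E measurableT mf.
rewrite (@product_measure_unique _ _ _ _ _ _ _ mu _ A mA) ?hmu ?setTI// => B B' mB mB'.
rewrite hmu setTI.
have -> : f @^-1` (B `*` B') = ((fun x : mR => x + a) @^-1` B) `*` ((fun x : mR => x + b) @^-1` B').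
  by [].
have mt (c : R) (B0 : set mR) : measurable B0 -> measurable ((fun x : mR => x + c) @^-1` B0).
  move=> mB0; rewrite -[X in measurable X]setTI.
  have : measurable_fun [set: mR] (fun x : mR => (x + c : mR)).
    exact: measurable_translate.
  exact.
rewrite [LHS](product_measure1E _ _ (mt a B mB) (mt b B' mB')).
by congr (_ * _)%E; exact: lebesgue_translate.
Qed.

Definition cx (p : plane) : C := p.1 +i* p.2.

(** The plane carries the product sigma-algebra, so an open set is written as a countable union of
    rational squares, which are products of intervals. *)
Lemma open_measurable_plane (A : set C) : open A -> measurable (cx @^-1` A : set plane).
Proof.
move=> oA.
pose sq (i : rat * rat * nat) : set C := square (u R i.2) (ratr i.1.1 +i* ratr i.1.2).
have [e he] : exists e : nat -> option (rat * rat * nat), forall i, exists n, e n = Some i.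
  by exists unpickle => i; exists (pickle i); exact: pickleK.
pose G (n : nat) : set C := match e n with
  | Some i => if `[< sq i `<=` A >] then sq i else set0 | None => set0 end.
have -> : A = \bigcup_n G n.
  apply/seteqP; split=> [z Az|z [n _]]; last first.
    by rewrite /G; case: (e n) => // i; case: asboolP => // h /h.
  have : nbhs z A by apply: open_nbhs_nbhs.
  move=> /nbhs_squareP[r r0 rA]; have [a [b [m [mz mr]]]] := rat_square z r0.
  have [n en] := he (a, b, m); exists n => //; rewrite /G en.
  by case: asboolP => // -[] w /mr/rA.
rewrite preimage_bigcup; apply: bigcup_measurable => n _.
rewrite /G; case: (e n) => [i|]; last by rewrite preimage_set0.
case: asboolP => _; last by rewrite preimage_set0.
have -> : cx @^-1` sq i =
    (`](ratr i.1.1 - u R i.2), (ratr i.1.1 + u R i.2)[%classic : set mR) `*`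
    (`](ratr i.1.2 - u R i.2), (ratr i.1.2 + u R i.2)[%classic : set mR) :> set plane.
  apply/seteqP; split=> [[x y] /squareP[/= ? ?]|[x y] [/=]]; first by split; rewrite /= in_itv.
  by rewrite !in_itv /= => ? ?; apply/squareP.
by apply: measurableX; exact: measurable_itv.
Qed.

Lemma closed_measurable_plane (A : set C) : closed A -> measurable (cx @^-1` A : set plane).
Proof.
move=> cA; have := measurableC (open_measurable_plane (closed_openC cA)).
by rewrite preimage_setC setCK.
Qed.

End Plane.

Section Area.
Variable R : realType.
Local Notation C := R[i].
Local Notation D := (@polygon R).
Local Notation Y := (@punctured_polygon R).
Local Notation X := (Xinf R).
Local Notation box := (@box R).
Local Notation trans := (@trans R).
Local Notation plane := (measurableTypeR R * measurableTypeR R)%type.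
Local Notation lambda := ((@lebesgue_measure R \x @lebesgue_measure R)%E : set plane -> \bar R).
Local Notation borelX := (g_sigma_algebraType (@open X)).
Local Notation cx := (@cx R).

Definition measC (A : set C) := measurable (cx @^-1` A : set plane).
Definition areaC (A : set C) : \bar R := lambda (cx @^-1` A).

Lemma measC_shift t A : measC A -> measC [set z | A (z - t)].
Proof.
move=> mA; have mf : measurable_fun [set: plane] (fun p : plane => (p.1 + - Re t, p.2 + - Im t) : plane).
  apply: measurable_fun_pair => /=.
    exact: measurableT_comp (measurable_translate _) measurable_fst.
  exact: measurableT_comp (measurable_translate _) measurable_snd.
have := mf measurableT _ mA; rewrite setTI /measC.
by congr measurable; apply/seteqP; split=> -[x y] /=; case: t {mf}.
Qed.

Lemma areaC_shift t A : measC A -> areaC [set z | A (z - t)] = areaC A.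
Proof.
move=> mA; rewrite -[RHS](area_translate (- Re t) (- Im t) mA) /areaC.
by congr (lambda _); apply/seteqP; split=> -[x y] /=; case: t.
Qed.

Lemma measCU A B : measC A -> measC B -> measC (A `|` B).
Proof. by move=> mA mB; rewrite /measC preimage_setU; exact: measurableU. Qed.

Lemma measCI A B : measC A -> measC B -> measC (A `&` B).
Proof. by move=> mA mB; rewrite /measC preimage_setI; exact: measurableI. Qed.

Lemma measCD A B : measC A -> measC B -> measC (A `\` B).
Proof. by move=> mA mB; exact: (measurableD mA mB). Qed.

Lemma areaCU A B : measC A -> measC B -> A `&` B = set0 ->
  areaC (A `|` B) = (areaC A + areaC B)%E.
Proof.
move=> mA mB AB; rewrite /areaC preimage_setU; apply: measureU => //.
by rewrite -preimage_setI AB preimage_set0.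
Qed.

Lemma eq_areaC_bigcup (F G : nat -> set C) :
  (forall j, measC (F j)) -> (forall j, measC (G j)) ->
  trivIset setT F -> trivIset setT G -> (forall j, areaC (F j) = areaC (G j)) ->
  areaC (\bigcup_j F j) = areaC (\bigcup_j G j).
Proof.
move=> mF mG tF tG FG.
have h (H : nat -> set C) : (forall j, measC (H j)) -> trivIset setT H ->
    areaC (\bigcup_j H j) = (\sum_(j <oo | j \in [set: nat]) areaC (H j))%E.
  move=> mH tH; rewrite /areaC preimage_bigcup.
  apply: (@measure_bigcup _ _ _ lambda setT (fun j => cx @^-1` H j)) => [j _|]; first exact: mH.
  move/trivIsetP : tH => tH; apply/trivIsetP => i j _ _ ij.
  by rewrite -preimage_setI tH// preimage_set0.
rewrite (h F mF tF) (h G mG tG).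
by congr (limn _); apply/funext => m; apply: eq_bigr => j _; exact: FG.
Qed.

(* A fundamental domain of the projection [toX]. *)
Definition domain : set C := [set p | Y p /\ forall q, ~ edge_glue q p].

Lemma domainP k n z p : box k n z -> domain p -> toX p = bmap k n z ->
  if `[< D z >] then p = z else p = z + trans k n.
Proof.
move=> kz [Yp np] e; case: (toX_bmap kz Yp e) => ep.
  by case: asboolP => // -[]; rewrite -ep; exact: Y_D.
case: asboolP => // Dz; have Dp := Y_D Yp; rewrite ep in Dp.
by case: (np z); rewrite ep; apply/glueP; exists k, n; split=> //; exact: box_both.
Qed.

Lemma domainl k n z : box k n z -> D z -> domain z.
Proof.
move=> kz Dz; split; first exact: box_Y kz Dz.
by move=> q /glueP[k' [n' [sq e]]]; exact: box_target kz sq e.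
Qed.

Lemma domainr k n z : box k n z -> ~ D z -> domain (z + trans k n).
Proof.
move=> kz nDz; have Dzt : D (z + trans k n) by case: (box_cover kz).
split; first exact: box_trans_Y kz Dzt.
move=> q /glueP[k' [n' [sq e]]]; apply: nDz.
by rewrite -(box_trans_target kz sq e); have [/Y_D] := source_Y sq.
Qed.

(** The trace of [W] on the fundamental domain: what leaves D is brought back by the gluing
    translation, without changing the area ([areaC_unfold]). *)
Definition unfold k n (W : set C) : set C :=
  (W `&` D) `|` [set z | (W `\` D) (z - trans k n)].

Lemma domain_preimage k n (W : set C) : W `<=` box k n ->
  domain `&` @toX R @^-1` (bmap k n @` W) = unfold k n W.
Proof.
move=> sW; apply/seteqP; split=> [p [dp [z Wz /= e]]|p].
  have := domainP (sW _ Wz) dp (esym e); case: asboolP => Dz ->; first by left.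
  by right; rewrite /= addrK.
case=> [[Wp Dp]|[Wp nDp]].
  by split; [exact: domainl (sW _ Wp) Dp|exists p => //; rewrite bmapl].
have := domainr (sW _ Wp) nDp; rewrite subrK => dp; split=> //.
exists (p - trans k n) => //; rewrite bmapr ?subrK//; first exact: sW.
by apply: Y_D; case: dp.
Qed.

Lemma measC_polygon : measC D.
Proof. exact: closed_measurable_plane (@polygon_closed R). Qed.

Lemma measC_unfold k n W : measC W -> measC (unfold k n W).
Proof.
move=> mW; apply: measCU; first exact: measCI mW measC_polygon.
exact: (@measC_shift (trans k n) (W `\` D) (measCD mW measC_polygon)).
Qed.

Lemma areaC_unfold k n W : W `<=` box k n -> measC W -> areaC (unfold k n W) = areaC W.
Proof.
move=> sW mW; have m1 := measCI mW measC_polygon; have m2 := measCD mW measC_polygon.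
rewrite areaCU//; last 2 first.
- exact: (@measC_shift (trans k n) (W `\` D)).
- apply/seteqP; split=> // z [[Wz Dz] [Wz' nDz']].
  have := @box_trans_disj _ k n z (z - trans k n) (sW _ Wz) (sW _ Wz').
  by rewrite subrK => /(_ erefl).
rewrite (@areaC_shift _ (W `\` D))// -areaCU//.
  by rewrite setUIDK.
by apply/seteqP; split=> // z [[_ Dz] [_ nDz]].
Qed.

Lemma measurable_from_opens (W : set plane) (f : plane -> borelX) :
  (forall O : set X, open O -> measurable (W `&` f @^-1` O)) -> measurable_fun W f.
Proof.
move=> h; apply: (@measurability _ _ _ _ W f (@open X)) => //.
by move=> _ [V oV <-]; exact: h.
Qed.

Lemma domain_bigcup (O : set X) (e : nat -> option (nat * nat)) :
  (forall i, exists n, e n = Some i) ->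
  domain `&` @toX R @^-1` O = \bigcup_j
    (if e j is Some (k, n) then unfold (kind_of k) n (box (kind_of k) n `&` bmap (kind_of k) n @^-1` O)
     else set0).
Proof.
move=> he; apply/seteqP; split=> [p [dp Op]|p [j _]].
  have [k [n [z kz ez]]] := bmap_surj (toX p); have [l el] := kind_ofK k; subst k.
  have [j ej] := he (l, n); exists j => //; rewrite ej.
  rewrite -domain_preimage; last by move=> ? [].
  by split=> //; exists z => //; split=> //=; rewrite ez.
case: (e j) => // -[k n]; rewrite -domain_preimage; last by move=> ? [].
by move=> [dp [z [_ Oz] e']]; split=> //=; rewrite -e'.
Qed.

Lemma measC_preimage k n (W : set C) (O : set X) : open W -> W `<=` box k n -> open O ->
  measC (W `&` bmap k n @^-1` O).
Proof.
move=> oW sW oO; apply: open_measurable_plane; rewrite openE => z [Wz Oz].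
have n1 : nbhs z W by apply: open_nbhs_nbhs.
have : \forall w \near z, O (bmap k n w).
  by apply/(near_bmap _ (sW _ Wz)); apply: open_nbhs_nbhs.
by move: n1; apply: filterS2.
Qed.

Lemma measC_domain_open (O : set X) : open O -> measC (domain `&` @toX R @^-1` O).
Proof.
move=> oO; have [e he] : exists e : nat -> option (nat * nat), forall i, exists n, e n = Some i.
  by exists unpickle => i; exists (pickle i); exact: pickleK.
rewrite (domain_bigcup O he) /measC preimage_bigcup; apply: bigcup_measurable => j _.
case: (e j) => [[k n]|]; last by rewrite preimage_set0.
by apply: measC_unfold; apply: measC_preimage => //; exact: box_open.
Qed.

Lemma measC_domain : measC domain.
Proof. by have := measC_domain_open openT; rewrite preimage_setT setIT. Qed.

Lemma toX_measurable : measurable_fun (cx @^-1` domain) (@toX R \o cx : plane -> borelX).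
Proof. by apply: measurable_from_opens => O oO; exact: measC_domain_open. Qed.

Lemma measC_cell i (B : set borelX) : measurable B -> measC (@cell R i `&` cell_map i @^-1` B).
Proof.
have oi := cell_open (R := R) (i := i).
have mi : measurable (cx @^-1` (@cell R i) : set plane) by exact: open_measurable_plane.
have : measurable_fun (cx @^-1` (@cell R i)) (cell_map i \o cx : plane -> borelX).
  apply: measurable_from_opens => O oO.
  case: i oi mi => [[[k n] ab] m] oi mi.
  have := @measC_preimage (kind_of k) n (@cell R (k, n, ab, m)) O oi _ oO.
  by apply; case: ab oi mi => a b _ _ z [].
by move=> mf mB; exact: mf.
Qed.

Lemma translation_area (c : chart R X) i v (B : set borelX) :
  (forall z, @cell R i z -> chart_map c (cell_map i z) = z + v) ->
  measurable B -> B `<=` cell_map i @` (@cell R i) ->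
  measC (chart_map c @` B) /\
  areaC (chart_map c @` B) = areaC (domain `&` @toX R @^-1` B).
Proof.
move=> hv mB sB; have := measC_cell i mB; set W := _ `&` _ => mW.
have eB : cell_map i @` W = B.
  apply/seteqP; split=> [_ [z [_ Bz] <-]//|x Bx].
  by have [z cz ez] := sB x Bx; exists z => //; split=> //=; rewrite ez.
have -> : chart_map c @` B = [set z | W (z - v)].
  apply/seteqP; split=> [_ [x Bx <-]|z [cz Bz]].
    by have [z cz ez] := sB x Bx; rewrite -ez hv//= addrK; split=> //=; rewrite ez.
  by exists (cell_map i (z - v)) => //; rewrite hv// subrK.
split; first exact: (@measC_shift v W mW).
rewrite (@areaC_shift v W mW) -eB.
have [k [n [ei sW]]] : exists k n, cell_map i = bmap (R := R) k n /\ W `<=` box k n.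
  case: i @W {hv sB mW eB} => [[[k n] [a b]] m] W; exists (kind_of k), n.
  by split=> // z [[]].
by rewrite ei domain_preimage// areaC_unfold.
Qed.

(** A chart is only locally a translation, with varying constants. [B] is cut along the countably
    many cells on which a single constant works, made disjoint by [seqDU]; the chart is injective,
    so the images of the pieces stay disjoint and areas add up. *)
Lemma chart_area (c : chart R X) (B : set borelX) : Ainf c -> measurable B ->
  B `<=` chart_dom c ->
  measC (chart_map c @` B) /\
  areaC (chart_map c @` B) = areaC (domain `&` @toX R @^-1` B).
Proof.
move=> Ac mB Bc.
have [e he] : exists e : nat -> option (nat * nat * (rat * rat) * nat),
    forall i, exists n, e n = Some i.
  by exists unpickle => i; exists (pickle i); exact: pickleK.
pose good i := exists v, forall z, @cell R i z ->
  chart_dom c (cell_map i z) /\ chart_map c (cell_map i z) = z + v.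
pose A j : set borelX := if e j is Some i then
  (if `[< good i >] then cell_map i @` (@cell R i) else set0) else set0.
have mA j : measurable (A j).
  rewrite /A; case: (e j) => // i; case: asboolP => // _.
  apply: sub_sigma_algebra; case: i => [[[k n] [a b]] m].
  apply: bmap_open; first by move=> z [].
  exact: (@cell_open R (k, n, (a, b), m)).
have Acover x : chart_dom c x -> (\bigcup_j A j) x.
  move=> cx'; have [k [n [z kz ez]]] := bmap_surj x; rewrite -ez in cx'.
  have h1 := Ainf_translation Ac kz cx'.
  have h2 : \forall w \near z, chart_dom c (bmap k n w).
    by apply/near_bmap => //; exact: chart_near.
  have h3 : nbhs z [set w | chart_dom c (bmap k n w) /\
      chart_map c (bmap k n w) - chart_map c (bmap k n z) = w - z].
    by move: h2 h1; apply: filterS2.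
  have [i [iz iW fi]] := cell_exists kz h3.
  have [j ej] := he i; exists j => //; rewrite /A ej.
  case: asboolP => [_|[]]; first by exists z => //; rewrite fi.
  exists (chart_map c (bmap k n z) - z) => w /iW[dw ew]; rewrite fi; split=> //.
  by move/eqP: ew; rewrite subr_eq => /eqP ->; rewrite -addrA [- z + _]addrC.
pose Bj j : set borelX := B `&` seqDU A j.
have mseq j : measurable (seqDU A j).
  by apply: measurableD => //; apply: bigsetU_measurable.
have mBj j : measurable (Bj j) by exact: measurableI.
have tBj : trivIset setT Bj by apply: trivIset_setIl; exact: trivIset_seqDU.
have BE : B = \bigcup_j Bj j.
  rewrite /Bj -setI_bigcupr -seqDU_bigcup_eq; apply/seteqP; split=> [x Bx|x []//].
  by split=> //; apply: Acover; exact: Bc.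
have key j : measC (chart_map c @` Bj j) /\
    areaC (chart_map c @` Bj j) = areaC (domain `&` @toX R @^-1` (Bj j)).
  have sA : Bj j `<=` A j by move=> x [_ []].
  have empty : Bj j = set0 -> measC (chart_map c @` Bj j) /\
      areaC (chart_map c @` Bj j) = areaC (domain `&` @toX R @^-1` (Bj j)).
    move=> ->; rewrite image_set0 preimage_set0 setI0; split=> //.
    by rewrite /measC preimage_set0.
  move: sA; rewrite /A; case: (e j) => [i|]; last by move=> h; apply: empty; apply/seteqP; split.
  case: asboolP => [[v hv]|_]; last by move=> h; apply: empty; apply/seteqP; split.
  move=> h; apply: (@translation_area c i v) => //.
  by move=> z /hv[].
have cinj x y : B x -> B y -> chart_map c x = chart_map c y -> x = y.
  by move=> /Bc cx' /Bc cy exy; rewrite -(chart_mapK cx') exy chart_mapK.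
have imE : chart_map c @` B = \bigcup_j (chart_map c @` Bj j).
  by rewrite {1}BE image_bigcup.
split; first by rewrite imE /measC preimage_bigcup; apply: bigcup_measurable => j _; have [] := key j.
have dE : domain `&` @toX R @^-1` B = \bigcup_j (domain `&` @toX R @^-1` Bj j).
  by rewrite {1}BE preimage_bigcup setI_bigcupr.
rewrite imE dE; apply: eq_areaC_bigcup.
- by move=> j; have [] := key j.
- by move=> j; exact: (toX_measurable measC_domain (mBj j)).
- apply/trivIsetP => i j _ _ ij; apply/seteqP; split=> // p [[x Bx ex] [y By ey]].
  have xy : x = y.
    by apply: cinj; [case: Bx|case: By|rewrite ex ey].
  have : (Bj i `&` Bj j) x by split=> //; rewrite xy.
  by move/trivIsetP : tBj => /(_ i j I I ij) ->.
- apply/trivIsetP => i j _ _ ij; apply/seteqP; split=> // p [[_ Bx] [_ By]].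
  have : (Bj i `&` Bj j) (toX p) by [].
  by move/trivIsetP : tBj => /(_ i j I I ij) ->.
- by move=> j; have [] := key j.
Qed.

Lemma areaC_domain_lty : (areaC domain < +oo)%E.
Proof.
apply: (@le_lt_trans _ _ (areaC (rect (- 2) 2 (- 2) 2))).
  apply: le_measure; rewrite ?inE; [exact: measC_domain|exact: (open_measurable_plane (@rect_open R (- 2) 2 (- 2) 2))|].
  move=> [x y] [/Y_D + _]; case=> -[/= /andP[? ?] /andP[? ?]];
  by split => /=; lra.
have -> : areaC (rect (- 2) 2 (- 2) 2) =
    lambda ((`](- 2), 2[%classic : set (measurableTypeR R)) `*` (`](- 2), 2[%classic : set (measurableTypeR R))).
  by congr (lambda _); apply/seteqP; split=> -[x y] []; rewrite /= ?in_itv.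
rewrite product_measure1E; [|exact: measurable_itv|exact: measurable_itv].
have l4 : lebesgue_measure (`](- 2), 2[%classic : set (measurableTypeR R)) = 4%:E.
  rewrite lebesgue_measure_itv /= lte_fin ifT; last by lra.
  by rewrite -EFinD; congr EFin; lra.
rewrite [X in (X < _)%E](_ : _ = (4%:E * 4%:E)%E); last by congr (_ * _)%E; exact: l4.
by rewrite -EFinM ltry.
Qed.

Lemma Xinf_finite_area : finite_area (@Ainf R) (@omega_inf R).
Proof.
have mD : measurable (cx @^-1` domain : set plane) := measC_domain.
have [mu hmu] := push_measure_exists lambda mD toX_measurable.
exists mu; last first.
  by rewrite hmu preimage_setT setIT; exact: areaC_domain_lty.
move=> c Ac B mB Bc; have [mS eS] := chart_area Ac mB Bc.
rewrite hmu -[LHS]/(areaC (domain `&` @toX R @^-1` B)) -eS.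
(* The form has coefficient 1, so its area density is 1 in every chart of [Ainf]. *)
transitivity (\int[lambda]_(p in cx @^-1` (chart_map c @` B)) (cst 1 p))%E.
  by rewrite integral_cst// mul1e.
apply: eq_integral => p _ /=.
by rewrite /omega_inf /= expr0n /= addr0 expr1n sqrtr1 expr1n.
Qed.

End Area.

Lemma Xinf_riemann_surface (R : realType) : riemann_surface (@Ainf R).
Proof.
split; [exact: Xinf_hausdorff|exact: Xinf_second_countable|
  exact: Xinf_connected|exact: Ainf_atlas].
Qed.

Lemma has_derivative_affine (R : realType) (phi : Xinf R -> Xinf R) (M : 'M[R]_2) :
  (forall x, locally_affine phi M x) ->
  has_derivative (@Ainf R) (@omega_inf R) phi M.
Proof. by move=> h x; exact: locally_affine_at. Qed.

Theorem theorem3p1 (R : realType) :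
  [/\ riemann_surface (@Ainf R),
      infinite_genus R (Xinf R)
    & exactly_one_end (Xinf R)] /\
  [/\ holomorphic_form (@Ainf R) (@omega_inf R),
      finite_area (@Ainf R) (@omega_inf R)
    & without_zeros (@Ainf R) (@omega_inf R)] /\
  exists rho psi : Xinf R -> Xinf R,
    [/\ Aff (@Ainf R) (@omega_inf R) rho,
        orientation_reversing (@Ainf R) (@omega_inf R) rho,
        isometric (@Ainf R) (@omega_inf R) rho,
        involutive rho
      & forall x, rho x <> x] /\
    [/\ pseudo_Anosov (@Ainf R) (@omega_inf R) psi,
        expansion_constant (@Ainf R) (@omega_inf R) psi 2
      & rho \o psi = psi \o rho].
Proof.
split.
  by split; [exact: Xinf_riemann_surface|exact: Xinf_infinite_genus|exact: Xinf_one_end].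
split.
  by split; [exact: omega_inf_holomorphic|exact: Xinf_finite_area|
    exact: omega_inf_without_zeros].
have [rho [psi [[lrho irho frho] [lpsi hpsi comm]]]] := automorphisms_exist R.
have drho := has_derivative_affine lrho; have dpsi := has_derivative_affine lpsi.
exists rho, psi; split; split=> //.
- split=> [|x].
    (* The involution is its own inverse, so the same continuity argument serves twice. *)
    by split; [exact: locally_affine_continuous lrho|exists rho; split=> //;
      exact: locally_affine_continuous lrho].
  by exists (diag2 1 (- 1)) => //; rewrite unitmxE det_diag2 mul1r unitfE oppr_eq0 oner_eq0.
- by exists (diag2 1 (- 1)) => //; rewrite det_diag2 mul1r oppr_lt0 ltr01.
- by exists (diag2 1 (- 1)) => //; apply: diag2_isometry; rewrite ?sqrrN expr1n.
- split.
    split=> // x; exists (diag2 (1 / 2) 2) => //.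
    by rewrite unitmxE det_diag2 unitfE; apply/eqP; lra.
  by exists (diag2 (1 / 2) 2) => //; rewrite tr_diag2 ger0_norm; lra.
- exists (diag2 (1 / 2) 2); split=> //.
    by exists 2; [rewrite eigenvalue_diag2 eqxx orbT|rewrite ger0_norm].
  by move=> a; rewrite eigenvalue_diag2 => /orP[] /eqP ->; rewrite ger0_norm; lra.
Qed.
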